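(* If a $2$-torus manifold $W$ is equivariantly formal, then $W$ is locally standard.
   Context: A $2$-torus manifold of dimension $n$ is a closed connected smooth $n$-manifold $W$ with a non-free effective smooth action of $\mathbb{Z}_2^n$. It is equivariantly formal if the fiber inclusion $W\to E\mathbb{Z}_2^n\times_{\mathbb{Z}_2^n}W$ of the Borel fibration induces a surjection $H^*_{\mathbb{Z}_2^n}(W;\mathbb{Z}_2):=H^*(E\mathbb{Z}_2^n\times_{\mathbb{Z}_2^n}W;\mathbb{Z}_2)\to H^*(W;\mathbb{Z}_2)$. It is locally standard if every point of $W$ has a $\mathbb{Z}_2^n$-invariant neighborhood equivariantly homeomorphic to an invariant open subset of a real $n$-dimensional faithful linear representation space of $\mathbb{Z}_2^n$. *)

(* Defs.v *)
From HB Require Import structures.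
From mathcomp Require Import all_boot all_order all_algebra all_fingroup.
From mathcomp Require Import generic_quotient ring_quotient mxrepresentation.
From mathcomp Require Import all_classical all_reals all_analysis.

Set Implicit Arguments.
Unset Strict Implicit.
Unset Printing Implicit Defensive.

Import Order.TTheory GRing.Theory Num.Theory.
Import numFieldTopology.Exports numFieldNormedType.Exports.

Local Open Scope classical_set_scope.
Local Open Scope ring_scope.
Local Open Scope quotient_scope.

(* The additive group 'rV['F_2]_n, which MathComp also regards as a
   (multiplicatively written) finite group: its unit 1%g is 0 and its product
   is the addition. As it is abelian, MathComp's right actions and right
   multiplications by matrices are the same thing as left actions. *)
Notation Z2 n := 'rV['F_2]_n.
Notation Z2_action n X := {action Z2 n &-> X}.

Section Simplices.
Variable R : realType.

Definition simplex (k : nat) : set 'rV[R]_k.+1 :=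
  [set x | (forall i, 0 <= x ord0 i) /\ \sum_i x ord0 i = 1].
Arguments simplex : clear implicits.

Definition insert0 k (i : 'I_k.+2) (x : 'rV[R]_k.+1) : 'rV[R]_k.+2 :=
  \row_j if unlift i j is Some j' then x ord0 j' else 0.

Lemma insert0_continuous k (i : 'I_k.+2) : continuous (@insert0 k i).
Proof.
move=> x A [P nP sPA]; exists (fun a b => P a (lift i b)) => [a b|y Py].
  by have := nP a (lift i b); rewrite mxE liftK !ord1.
apply: sPA => a j; rewrite mxE; case: unliftP => [j' ->|jE].
  by have := Py a j'; rewrite !ord1.
by have := nP a j; rewrite mxE jE unlift_none => /nbhs_singleton.
Qed.

Lemma insert0_simplex k (i : 'I_k.+2) (x : simplex k) :
  insert0 i (\val x) \in simplex k.+1.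
Proof.
case: x => x /=; rewrite !inE => -[x_ge0 x_sum1]; split.
  by move=> j; rewrite mxE; case: unliftP.
rewrite (bigD1 i) //= mxE unlift_none add0r -[RHS]x_sum1.
rewrite (reindex_onto (lift i) (fun j => odflt ord0 (unlift i j))) /=.
  apply: eq_big => [j|j _]; last by rewrite mxE liftK.
  by rewrite liftK eqxx andbT eq_sym neq_lift.
by move=> j ji; case: unliftP ji => [j' -> //|->]; rewrite eqxx.
Qed.

Definition face_map k (i : 'I_k.+2) (x : simplex k) : simplex k.+1 :=
  exist _ (insert0 i (\val x)) (insert0_simplex i x).

Lemma face_map_continuous k (i : 'I_k.+2) : continuous (@face_map k i).
Proof.
apply: (@continuous_comp_initial _ _ _ (@set_val _ (simplex k.+1))).
move=> x; apply: (@continuous_comp _ _ _ set_val (@insert0 k i)).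
  exact: initial_continuous.
exact: insert0_continuous.
Qed.

HB.instance Definition _ k (i : 'I_k.+2) :=
  @isContinuous.Build _ _ (@face_map k i) (@face_map_continuous k i).
End Simplices.
Arguments simplex : clear implicits.


Section Cochains.
Variables (R : realType) (X : topologicalType).

Definition singular (k : nat) : Type := continuousType (simplex R k) X.

Definition face k (i : 'I_k.+2) (s : singular k.+1) : singular k :=
  s \o @face_map R k i.

Definition cochain (k : nat) : Type := singular k -> 'F_2.
HB.instance Definition _ k := GRing.Zmodule.on (cochain k).

(* No signs are needed since the coefficients have characteristic 2. *)
Definition coboundary k (c : cochain k) : cochain k.+1 :=
  fun s => \sum_(i < k.+2) c (face i s).

Lemma coboundary_is_zmod_morphism k : zmod_morphism (@coboundary k).
Proof.
by move=> b c; apply/funext => s; apply: sumrB.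
Qed.
HB.instance Definition _ k :=
  GRing.isZmodMorphism.Build _ _ (@coboundary k)
    (@coboundary_is_zmod_morphism k).

Definition cocycle_pred k : {pred cochain k} := fun c => coboundary c == 0.

Lemma cocycle_pred_closed k : zmod_closed (@cocycle_pred k).
Proof.
split=> [|b c]; rewrite !unfold_in ?raddf0 // => /eqP b0 /eqP c0.
by rewrite [coboundary _]raddfB [X in X - _]b0 [X in _ - X]c0 subrr.
Qed.
HB.instance Definition _ k :=
  GRing.isZmodClosed.Build _ (@cocycle_pred k) (@cocycle_pred_closed k).

Record cocycle k := Cocycle {
  cocycle_val :> cochain k;
  cocycle_valP : cocycle_val \in @cocycle_pred k }.
HB.instance Definition _ k := [isSub for @cocycle_val k].
HB.instance Definition _ k := [Choice of cocycle k by <:].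
HB.instance Definition _ k := [SubChoice_isSubZmodule of cocycle k by <:].

Definition coboundary_pred k : {pred cocycle k} :=
  match k with
  | 0 => fun c => c == 0
  | j.+1 => fun c => `[< exists b : cochain j, coboundary b = c >]
  end.

Lemma coboundary_pred_closed k : zmod_closed (@coboundary_pred k).
Proof.
case: k => [|k].
  split=> [|b c]; rewrite !unfold_in /= ?eqxx // => /eqP -> /eqP ->.
  by rewrite subrr.
split=> [|b c]; first by apply/asboolP; exists 0; rewrite raddf0.
move=> /asboolP[b' b'E] /asboolP[c' c'E].
by apply/asboolP; exists (b' - c'); rewrite [LHS]raddfB; congr (_ - _).
Qed.
HB.instance Definition _ k :=
  GRing.isZmodClosed.Build _ (@coboundary_pred k) (@coboundary_pred_closed k).

Definition cohomology k : Type := Quotient.quot (@coboundary_pred k).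
HB.instance Definition _ k := GRing.Zmodule.on (cohomology k).
HB.instance Definition _ k := Quotient.on (cohomology k).
End Cochains.

Section InducedMap.
Variables (R : realType) (X Y : topologicalType) (f : continuousType X Y).

Definition pullback k (c : cochain R Y k) : cochain R X k :=
  fun s => c (f \o s : singular R Y k).

Lemma pullback_coboundary k (c : cochain R Y k) :
  pullback (coboundary c) = coboundary (pullback c).
Proof.
apply/funext => s; rewrite /pullback /coboundary; apply: eq_bigr => i _.
by congr c; apply/continuousEP.
Qed.

Lemma pullback_cocycle k (c : cocycle R Y k) :
  pullback c \in @cocycle_pred R X k.
Proof.
have /eqP c0 : coboundary c == 0 := cocycle_valP c.
by apply/eqP; rewrite -pullback_coboundary c0; apply/funext.
Qed.

Definition cocycle_map k (c : cocycle R Y k) : cocycle R X k :=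
  Cocycle (pullback_cocycle c).

Definition cohomology_map k (h : cohomology R Y k) : cohomology R X k :=
  \pi_(cohomology R X k) (cocycle_map (repr h)).

Lemma cohomology_map_pi k (c : cocycle R Y k) :
  cohomology_map (\pi_(cohomology R Y k) c) =
  \pi_(cohomology R X k) (cocycle_map c).
Proof.
have : repr (\pi_(cohomology R Y k) c) = c %[mod (cohomology R Y k)].
  by rewrite reprK.
rewrite /cohomology_map; move: (repr _) => c' /eqP.
rewrite -Quotient.idealrBE => c'c; apply/eqP.
rewrite -Quotient.idealrBE; move: c'c.
case: k c c' => [|k] c c'; rewrite !unfold_in /=.
  by move=> /eqP/subr0_eq ->; rewrite subrr.
move=> /asboolP[b bE]; apply/asboolP; exists (pullback b).
by rewrite -pullback_coboundary bE; apply/funext.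
Qed.
End InducedMap.

Definition contractible (R : realType) (X : topologicalType) : Prop :=
  exists (x0 : X) (H : R * X -> X),
    [/\ {within `[0, 1]%classic `*` [set: X], continuous H},
        forall x, H (0, x) = x & forall x, H (1, x) = x0].

Section Actions.
Variable n : nat.

Lemma Z2_actD (X : Type) (a : Z2_action n X) x g h :
  a x (g + h) = a (a x g) h.
Proof. by case: a => a [a_inj aM] /=; rewrite -aM ?inE. Qed.

Lemma Z2_act0 (X : Type) (a : Z2_action n X) x : a x 0 = x.
Proof.
have := Z2_actD a x 0 0; rewrite addr0; case: a => a [a_inj aM] /=.
by move=> /a_inj.
Qed.

Definition continuous_action (X : topologicalType) (a : Z2_action n X) : Prop :=
  forall g, continuous (a ^~ g).

Definition free_action (X : Type) (a : Z2_action n X) : Prop :=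
  forall x g, a x g = x -> g = 0.

Definition effective_action (X : Type) (a : Z2_action n X) : Prop :=
  forall g, (forall x, a x g = x) -> g = 0.

(* E is a model of EZ_2^n: since Z_2^n is finite and E is Hausdorff, freeness
   makes E -> E / Z_2^n a principal bundle, i.e. a regular covering. For
   instance, (S^oo)^n with coordinatewise antipodal maps. *)
Definition universal_action (R : realType) (E : topologicalType)
    (aE : Z2_action n E) : Prop :=
  [/\ hausdorff_space E, continuous_action aE, free_action aE
    & contractible R E].
End Actions.

Section Borel.
Variables (n : nat) (E W : topologicalType).
Variables (aE : Z2_action n E) (aW : Z2_action n W).

Definition borel_rel (p q : E * W) : bool :=
  `[< exists g, (aE p.1 g, aW p.2 g) = q >].

Lemma borel_rel_equiv : equiv_class_of borel_rel.
Proof.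
split=> [[e w]|[e w] [e' w']|[e w] [e' w'] [e'' w'']].
- by apply/asboolP; exists 0; rewrite !Z2_act0.
- by apply/asboolP/asboolP => -[g [<- <-]]; exists (- g);
    rewrite /= -!Z2_actD subrr !Z2_act0.
- move=> /asboolP[g [<- <-]] /asboolP[h [<- <-]].
  by apply/asboolP; exists (g + h); rewrite !Z2_actD.
Qed.
Canonical borel_equiv := EquivRelPack borel_rel_equiv.

(* The space E x_{Z_2^n} W *)
Definition borel : topologicalType := quotient_topology {eq_quot borel_equiv}.

Definition fiber_inclusion (e0 : E) (w : W) : borel := \pi_borel (e0, w).

Lemma fiber_inclusion_continuous e0 : continuous (fiber_inclusion e0).
Proof.
move=> w; apply: (@continuous_comp _ _ _ (pair e0) \pi_borel).
  by apply: cvg_pair; [exact: cvg_cst|exact: cvg_id].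
exact: pi_continuous.
Qed.
HB.instance Definition _ e0 :=
  isContinuous.Build _ _ (fiber_inclusion e0) (@fiber_inclusion_continuous e0).

(* The choice of the model E and of the fiber, i.e. of e0, is immaterial: two
   models give weakly equivalent Borel constructions, and E is path connected. *)
Definition equivariantly_formal (R : realType) (e0 : E) : Prop :=
  forall (k : nat) (h : cohomology R W k),
    exists h' : cohomology R borel k,
      cohomology_map (fiber_inclusion e0) h' = h.
End Borel.

Section Smooth.
Variable R : realType.

(* C^k functions on U, which is meant to be open: all the directional
   derivatives exist on U and are again of class C^(k-1). *)
Fixpoint Ck m n (k : nat) (U : set 'rV[R]_m) (f : 'rV[R]_m -> 'rV[R]_n) : Prop :=
  match k with
  | 0 => {in U, continuous f}
  | j.+1 => forall v, (forall x, U x -> derivable f x v) /\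
                      Ck j U (fun x => 'D_v f x)
  end.

Definition Cinfty m n (U : set 'rV[R]_m) (f : 'rV[R]_m -> 'rV[R]_n) : Prop :=
  forall k, Ck k U f.

Variables (n : nat) (W : topologicalType).

(* A homeomorphism from the open set chart_dom onto an open subset of R^n,
   with inverse chart_inv; both maps are extended arbitrarily. *)
Record chart := Chart {
  chart_dom : set W;
  chart_map : W -> 'rV[R]_n;
  chart_inv : 'rV[R]_n -> W;
  chart_dom_open : open chart_dom;
  chart_img_open : open (chart_map @` chart_dom);
  chart_map_continuous : {within chart_dom, continuous chart_map};
  chart_inv_continuous :
    {within chart_map @` chart_dom, continuous chart_inv};
  chart_mapK : {in chart_dom, cancel chart_map chart_inv} }.

Record smooth_atlas := SmoothAtlas {
  charts : set chart;
  charts_cover : forall x, exists2 c, charts c & chart_dom c x;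
  charts_smooth : forall c d, charts c -> charts d ->
    Cinfty (chart_map c @` (chart_dom c `&` chart_dom d))
           (chart_map d \o chart_inv c) }.

Definition smooth_map (A : smooth_atlas) (f : W -> W) : Prop :=
  continuous f /\
  forall c d, charts A c -> charts A d ->
    Cinfty (chart_map c @` (chart_dom c `&` f @^-1` chart_dom d))
           (chart_map d \o f \o chart_inv c).

Definition smooth_action (A : smooth_atlas) (a : Z2_action n W) : Prop :=
  forall g, smooth_map A (a ^~ g).

Definition two_torus_manifold (A : smooth_atlas) (a : Z2_action n W) : Prop :=
  [/\ [/\ hausdorff_space W, @second_countable W, compact [set: W]
         & connected [set: W]],
      smooth_action A a, effective_action a & ~ free_action a].

Definition locally_standard (a : Z2_action n W) : Prop :=
  forall x : W, exists (U : set W) (rho : mx_representation R (setT_group (Z2 n)) n)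
      (V : set 'rV[R]_n) (phi : W -> 'rV[R]_n) (psi : 'rV[R]_n -> W),
    [/\ nbhs x U /\ (forall y g, U y -> U (a y g)),
        mx_faithful rho,
        open V /\ (forall v g, V v -> V (v *m rho g)),
        [/\ set_fun U V phi, set_fun V U psi,
            {in U, cancel phi psi} & {in V, cancel psi phi}] /\
        ({within U, continuous phi} /\ {within V, continuous psi})
      & forall y g, U y -> phi (a y g) = phi y *m rho g].
End Smooth.

(* Main.v *)
(* Equivariant formality makes the product with the Euler class of any nontrivial
   character of G = Z_2^n injective on equivariant cohomology: by the Gysin
   sequence of a double cover, a class killed by it is the transfer of a class
   that itself is a restriction.

   Let Y be an invariant, closed and relatively open part of the fixed point set
   W^H of a subgroup H, without G-fixed point. Then W has a finite cover by an
   open set V meeting W^H in the rest of W^H and by invariant open sets on which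
   the Euler class of some character chi vanishes, where chi is nontrivial on H
   away from W^H, and merely nontrivial on a neighborhood U of Y disjoint from V.
   The product of the Euler classes of the first kind, cut off outside U, is a
   class v on the complex of simplices that are small for this cover, and the
   Euler classes of the second kind kill it, so v = 0. But over a point of Y the
   restriction of v to BH is a product of Euler classes of nontrivial characters
   of H, hence nonzero. So every such Y contains a G-fixed point.

   Apply this to the closure Y of the set of points with stabilizer H around which
   the action does not look like an open part of a faithful representation of G.
   By linearization around its points Y is open in W^H. At a G-fixed point p of Y
   the linearized action is itself a faithful representation of G, so that all
   points near p are good: Y is empty. *)
Require Import Defs.
From HB Require Import structures.
From mathcomp Require Import all_boot all_order all_algebra all_fingroup.
From mathcomp Require Import generic_quotient ring_quotient mxrepresentation.
From mathcomp Require Import all_classical all_reals all_analysis.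
From mathcomp Require Import lra zify.

Set Implicit Arguments.
Unset Strict Implicit.
Unset Printing Implicit Defensive.

Import Order.TTheory GRing.Theory Num.Theory.
Import numFieldTopology.Exports numFieldNormedType.Exports.

Local Open Scope classical_set_scope.
Local Open Scope ring_scope.

(** * The Gysin sequence of a double cover *)

(** Equivariant cohomology is computed by the invariant cochains on [E * W]; classes of the quotient
    enter only through their pullbacks, so no simplex of the quotient ever has to be lifted. Cup
    products are avoided as well: a function on simplices that changes by chi under the group
    trivializes the double cover of chi, and its commutator with the coboundary acts as the Euler
    class. Such a function need not be continuous, so it can be prescribed to be locally constant on
    an open set where the cover is trivial; there the product vanishes as a cochain, not just up to
    a coboundary. The obstacle is the cut-off: a cocycle set to 0 outside [U] need not stay closed
    on simplices that cross the border of [U]. Hence cochain conditions are restricted to small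
    simplices, and formality is carried over to these by iterated subdivision. The Gysin argument
    allows any class of simplices and any subgroup because it is used twice: for small simplices
    with all of G, and for simplices over one point with its stabilizer, where formality is
    automatic and injectivity says that products of Euler classes do not vanish. *)

Lemma F2_dichotomy (x : 'F_2) : x = 0 \/ x = 1.
Proof. by case: x => -[|[|//]] p; [left|right]; apply: val_inj. Qed.

Lemma F2_addrr (x : 'F_2) : x + x = 0.
Proof. by case: (F2_dichotomy x) => ->; apply: val_inj. Qed.

Lemma F2_oppr (x : 'F_2) : - x = x.
Proof. by case: (F2_dichotomy x) => ->; apply: val_inj. Qed.

Ltac F2_case x := case: (F2_dichotomy x) => ->.

Lemma Z2_addrr n (g : Z2 n) : g + g = 0.
Proof. by apply/rowP => j; rewrite !mxE F2_addrr. Qed.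

(* [S k] stands for the [k]-simplices, on which the group acts; all conditions
   on cochains are only required on the simplices satisfying [P]. *)
Section Gysin.
Variables (n : nat) (S : nat -> Type).
Variable d : forall k, 'I_k.+2 -> S k.+1 -> S k.
Variable act : forall k, S k -> Z2 n -> S k.
Variable P : forall k, S k -> Prop.
Variable Gam : {set Z2 n}.

Definition cob k (c : S k -> 'F_2) : S k.+1 -> 'F_2 :=
  fun s => \sum_(i < k.+2) c (d i s).

Hypothesis cob_cob : forall k (c : S k -> 'F_2) s, cob (cob c) s = 0.
Hypothesis d_act : forall k (i : 'I_k.+2) s g, d i (act s g) = act (d i s) g.
Hypothesis actD : forall k (s : S k) g h, act s (g + h) = act (act s g) h.
Hypothesis act0 : forall k (s : S k), act s 0 = s.
Hypothesis P_d : forall k (i : 'I_k.+2) (s : S k.+1), P s -> P (d i s).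
Hypothesis P_act : forall k (s : S k) g, g \in Gam -> P s -> P (act s g).

Definition subgrp (K : {set Z2 n}) :=
  0 \in K /\ forall g h, g \in K -> h \in K -> g + h \in K.

Definition invar (K : {set Z2 n}) k (c : S k -> 'F_2) :=
  forall s g, P s -> g \in K -> c (act s g) = c s.

Definition closedc k (c : S k -> 'F_2) := forall s, P s -> cob c s = 0.

Definition exactc (K : {set Z2 n}) k : (S k -> 'F_2) -> Prop :=
  match k return (S k -> 'F_2) -> Prop with
  | 0 => fun c => forall s, P s -> c s = 0
  | j.+1 => fun c => exists2 b, invar K b & forall s, P s -> c s = cob b s
  end.

(* [f] trivializes over the total space the double cover given by [chi]. *)
Definition twisted (f : forall k, S k -> 'F_2) (chi : Z2 n -> 'F_2) :=
  forall k (s : S k) g, P s -> g \in Gam -> f k (act s g) = f k s + chi g.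

Definition mulf (f : forall k, S k -> 'F_2) k (c : S k -> 'F_2) : S k -> 'F_2 :=
  fun s => f k s * c s.

(* The commutator of the coboundary with the multiplication by [f]. If [f] is
   twisted by [chi], it commutes with the group and represents the product with
   the Euler class of [chi] on equivariant cohomology. *)
Definition euler (f : forall k, S k -> 'F_2) k (c : S k -> 'F_2) :
    S k.+1 -> 'F_2 :=
  fun s => cob (mulf f c) s + mulf f (cob c) s.

Lemma cobD k (b c : S k -> 'F_2) s :
  cob (fun s => b s + c s) s = cob b s + cob c s.
Proof. by rewrite /cob big_split. Qed.

Lemma invarD K k (b c : S k -> 'F_2) : invar K b -> invar K c ->
  invar K (fun s => b s + c s).
Proof. by move=> bK cK s g Ps Kg; rewrite bK// cK. Qed.

Lemma invar_sub (K L : {set Z2 n}) k (c : S k -> 'F_2) :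
  K \subset L -> invar L c -> invar K c.
Proof. by move=> /fintype.subsetP KL cL s g Ps /KL; exact: cL. Qed.

Lemma exactc_ext K k (b c : S k -> 'F_2) :
  (forall s, P s -> b s = c s) -> exactc K b -> exactc K c.
Proof.
case: k b c => [|k] b c bc /=; first by move=> b0 s Ps; rewrite -bc ?b0.
by move=> [a aK aE]; exists a => // s Ps; rewrite -bc ?aE.
Qed.

Lemma exactcD K k (b c : S k -> 'F_2) :
  exactc K b -> exactc K c -> exactc K (fun s => b s + c s).
Proof.
case: k b c => [|k] b c /=; first by move=> b0 c0 s Ps; rewrite b0// c0// addr0.
move=> [b' b'K bE] [c' c'K cE]; exists (fun s => b' s + c' s).
  exact: invarD.
by move=> s Ps; rewrite cobD bE// cE.
Qed.

Lemma closedcD k (b c : S k -> 'F_2) : closedc b -> closedc c ->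
  closedc (fun s => b s + c s).
Proof. by move=> b0 c0 s Ps; rewrite cobD b0// c0// addr0. Qed.

(** Only the change of [f] from [s] to its faces matters: this makes the operator commute with the
    group and vanish wherever [f] is constant. *)
Lemma eulerE f k (c : S k -> 'F_2) s :
  euler f c s = \sum_i (f k (d i s) + f k.+1 s) * c (d i s).
Proof.
rewrite /euler /cob /mulf mulr_sumr -big_split /=.
by apply: eq_bigr => i _; rewrite mulrDl.
Qed.

Lemma euler_ext f k (b c : S k -> 'F_2) s : P s ->
  (forall s, P s -> b s = c s) -> euler f b s = euler f c s.
Proof.
move=> Ps bc; rewrite !eulerE; apply: eq_bigr => i _; rewrite bc//.
exact: P_d.
Qed.

Lemma eulerD f k (b c : S k -> 'F_2) s :
  euler f (fun s => b s + c s) s = euler f b s + euler f c s.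
Proof. by rewrite !eulerE -big_split; apply: eq_bigr => i _; rewrite mulrDr. Qed.

Lemma invar_euler f chi (K : {set Z2 n}) k (c : S k -> 'F_2) : twisted f chi ->
  K \subset Gam -> invar K c -> invar K (euler f c).
Proof.
move=> fT /fintype.subsetP KG cK s g Ps Kg; rewrite !eulerE.
apply: eq_bigr => i _; have Pi := P_d i Ps.
rewrite d_act cK// !fT ?KG//; congr (_ * _).
by rewrite addrACA F2_addrr addr0.
Qed.

Lemma cob_euler f k (c : S k -> 'F_2) s :
  cob (euler f c) s = euler f (cob c) s.
Proof.
rewrite /euler cobD cob_cob add0r [X in _ = _ + X]/mulf cob_cob mulr0 addr0.
by [].
Qed.

Lemma closedc_euler f k (c : S k -> 'F_2) : closedc c -> closedc (euler f c).
Proof.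
move=> c0 s Ps; rewrite cob_euler eulerE big1// => i _.
by rewrite c0 ?mulr0//; exact: P_d.
Qed.

Lemma exactc_euler f chi (K : {set Z2 n}) k (c : S k -> 'F_2) : twisted f chi ->
  K \subset Gam -> exactc K c -> exactc K (euler f c).
Proof.
move=> fT KG; case: k c => [|k] c /=.
  move=> c0; exists (fun=> 0) => // s Ps.
  by rewrite eulerE /cob !big1// => i _; rewrite c0 ?mulr0//; exact: P_d.
move=> [b bK bE]; exists (euler f b); first exact: (invar_euler fT).
by move=> s Ps; rewrite cob_euler; apply: euler_ext.
Qed.


(* If [b] is a [K]-invariant primitive of [v], with [K] the kernel of [chi], the
   primitive [b + f (b + h b)] of [v + euler f (b + h b)] is [L]-invariant. *)
Lemma gysin_restrict f chi (L : {set Z2 n}) h k (v : S k -> 'F_2) :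
  subgrp L -> L \subset Gam -> twisted f chi ->
  (forall g h, chi (g + h) = chi g + chi h) -> h \in L -> chi h = 1 ->
  invar L v -> exactc [set g in L | chi g == 0]%SET v ->
  match k return (S k -> 'F_2) -> Prop with
  | 0 => fun v => forall s, P s -> v s = 0
  | j.+1 => fun v => exists c : S j -> 'F_2, [/\ invar L c, closedc c
      & exactc L (fun s => v s + euler f c s)]
  end v.
Proof.
set K := [set g in L | _]%SET => -[L0 LD] LG fT chiD Lh h1.
have PL k' (s : S k') g : g \in L -> P s -> P (act s g).
  by move=> Lg; apply: P_act; exact: (fintype.subsetP LG).
have LG' g : g \in L -> g \in Gam by exact: (fintype.subsetP LG).
case: k v => [|k] v //= vL [b bK bE].
pose c s := b s + b (act s h).
have bL s g : P s -> g \in L -> b (act s g) =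
    if chi g == 0 then b s else b (act s h).
  move=> Ps Lg; case: ifPn => [g0|]; first by rewrite bK// inE Lg.
  case: (F2_dichotomy (chi g)) => [->|g1 _]; first by rewrite eqxx.
  have -> : act s g = act (act s h) (h + g).
    by rewrite -actD addrA Z2_addrr add0r.
  rewrite bK //; first exact: PL.
  by rewrite inE LD//= chiD h1 g1 F2_addrr.
have cL : invar L c.
  move=> s g Ps Lg; rewrite /c -actD (bL _ _ Ps (LD _ _ Lg Lh)) (bL _ _ Ps Lg) chiD h1.
  by case: (F2_dichotomy (chi g)) => -> //=; rewrite addrC.
have c0 : closedc c.
  move=> s Ps; rewrite /c cobD -bE//.
  have -> : cob (fun s => b (act s h)) s = v (act s h).
    by rewrite bE; [apply: eq_bigr => i _; rewrite d_act | exact: PL].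
  by rewrite vL// F2_addrr.
exists c; split=> //; exists (fun s => b s + mulf f c s).
  move=> s g Ps Lg; rewrite /mulf cL// fT ?LG'// bL//.
  case: (F2_dichotomy (chi g)) => -> /=; rewrite ?addr0// /c.
  by F2_case (f k s); F2_case (b s); F2_case (b (act s h)); apply: val_inj.
move=> s Ps; rewrite cobD -bE//; congr (_ + _).
by rewrite /euler /mulf c0// mulr0 addr0.
Qed.

Fixpoint eulers (J : Type) (F : J -> forall k, S k -> 'F_2) (js : seq J) k
    (c : S k -> 'F_2) : S (size js + k) -> 'F_2 :=
  match js return S (size js + k) -> 'F_2 with
  | [::] => c
  | j :: js' => euler (F j) (@eulers J F js' k c)
  end.
Arguments eulers {J} F js {k} c.

Lemma closedc_eulers (J : Type) (F : J -> forall k, S k -> 'F_2) js k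
  (c : S k -> 'F_2) : closedc c -> closedc (eulers F js c).
Proof. by move=> c0; elim: js => //= j js IHjs; exact: closedc_euler. Qed.

Lemma invar_eulers (J : eqType) (F : J -> forall k, S k -> 'F_2)
    (chi : J -> Z2 n -> 'F_2) (K : {set Z2 n}) js k (c : S k -> 'F_2) :
  {in js, forall j, twisted (F j) (chi j)} -> K \subset Gam ->
  invar K c -> invar K (eulers F js c).
Proof.
move=> Fchi KG cK; elim: js Fchi => //= j js IHjs Fchi.
apply: (invar_euler (Fchi j (mem_head _ _)) KG).
by apply: IHjs => i ijs; apply: Fchi; rewrite inE ijs orbT.
Qed.

Hypothesis twistedP : forall chi : Z2 n -> 'F_2,
  (forall g h, chi (g + h) = chi g + chi h) -> exists f, twisted f chi.
Hypothesis Gam_subgrp : subgrp Gam.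
Hypothesis formal : forall k (c : S k -> 'F_2), closedc c ->
  exists d, [/\ invar Gam d, closedc d & exactc [set 0]%SET (fun s => c s + d s)].

(** Induction on the order of [K] and, inside, on the degree. A character that is nontrivial on [K]
    cuts out the smaller group [K1]; after a correction [d'] the class dies on [K1], so by the Gysin
    sequence it is an Euler class times a class [e] of lower degree, which lifts by induction. *)
Lemma formal_restrict (K : {set Z2 n}) k (c : S k -> 'F_2) :
  subgrp K -> K \subset Gam -> invar K c -> closedc c ->
  exists d, [/\ invar Gam d, closedc d & exactc K (fun s => c s + d s)].
Proof.
have [m] := ubnP #|K|; elim: m K k c => // m IHm K k c.
rewrite ltnS => Km Ksub KG.
have [K0|] := boolP (K \subset [set 0])%SET.
  have -> : K = [set 0]%SET.
    by apply/eqP; rewrite finset.eqEsubset K0 finset.sub1set; case: Ksub.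
  by move=> _; exact: formal.
move=> /subsetPn[h Kh]; rewrite !inE => h0.
have [j hj] : exists j, h ord0 j <> 0.
  apply: contrapT => h0'; move/eqP: h0; apply; apply/rowP => j.
  by rewrite mxE; apply: contrapT => ?; apply: h0'; exists j.
pose chi (g : Z2 n) : 'F_2 := g ord0 j.
have chiD g g' : chi (g + g') = chi g + chi g' by rewrite /chi mxE.
have h1 : chi h = 1 by case: (F2_dichotomy (chi h)).
have [f fT] := twistedP chiD.
pose K1 := [set g in K | chi g == 0]%SET.
have K1K : K1 \subset K by apply/fintype.subsetP => g; rewrite inE => /andP[].
have K1m : (#|K1| < m)%N.
  apply: leq_trans Km; apply: proper_card; apply/properP; split => //.
  by exists h => //; rewrite inE h1 andbF.
have K1sub : subgrp K1.
  case: Ksub => K0 KD; split; rewrite ?inE ?K0 /chi ?mxE //.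
  move=> g g'; rewrite !inE => /andP[Kg /eqP g0] /andP[Kg' /eqP g0'].
  by rewrite KD//= chiD g0 g0' addr0 eqxx.
have K1G := fintype.subset_trans K1K KG.
(* In degree 0 exactness means vanishing, whatever the group, so the correction for [K1] already
   serves for [K]. *)
elim: k c => [|k IHk] c cK c0.
  have [d' [dG d0 dE]] := IHm K1 0 c K1m K1sub K1G (invar_sub K1K cK) c0.
  by exists d'; split.
have [d' [dG d0 dE]] := IHm K1 k.+1 c K1m K1sub K1G (invar_sub K1K cK) c0.
have vK : invar K (fun s => c s + d' s).
  by apply: invarD => //; exact: invar_sub dG.
have [e [eK e0 vE]] := gysin_restrict Ksub KG fT chiD Kh h1 vK dE.
have [e' [e'G e'0 e'E]] := IHk e eK e0.
exists (fun s => d' s + euler f e' s); split.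
- apply: invarD => //; exact: (invar_euler fT).
- by apply: closedcD => //; exact: closedc_euler.
- have := exactcD vE (exactc_euler fT KG e'E); apply: exactc_ext => s Ps.
  rewrite eulerD; move: (euler f e s) (euler f e' s) (c s) (d' s) => w x y z.
  by F2_case w; F2_case x; F2_case y; F2_case z; apply: val_inj.
Qed.

(* If [euler f v] is the coboundary of [b], then [z = f v + b] is a [K]-invariant
   cocycle and [v] is its transfer [z + h z]; as [z] lifts to a [Gam]-invariant
   cocycle, the transfer is exact. *)
Lemma euler_injective f chi h k (v : S k -> 'F_2) :
  twisted f chi -> (forall g h, chi (g + h) = chi g + chi h) ->
  h \in Gam -> chi h = 1 -> invar Gam v -> closedc v ->
  exactc Gam (euler f v) -> exactc Gam v.
Proof.
move=> fT chiD Gh h1 vG v0 [b bG bE].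
pose K := [set g in Gam | chi g == 0]%SET.
have KG : K \subset Gam by apply/fintype.subsetP => g; rewrite inE => /andP[].
have chi0 : chi 0 = 0 by rewrite -(Z2_addrr h) chiD F2_addrr.
have Ksub : subgrp K.
  case: Gam_subgrp => G0 GD; split; rewrite ?inE ?G0 ?chi0 //.
  move=> g g'; rewrite !inE => /andP[Kg /eqP g0] /andP[Kg' /eqP g0'].
  by rewrite GD// chiD g0 g0' addr0 eqxx.
pose z s := mulf f v s + b s.
have zK : invar K z.
  move=> s g Ps; rewrite inE => /andP[Gg /eqP g0].
  by rewrite /z /mulf fT// vG// bG// g0 addr0.
have z0 : closedc z.
  move=> s Ps; rewrite /z cobD -bE// /euler /mulf v0// mulr0 addr0.
  exact: F2_addrr.
have [d' [dG d0 dE]] := formal_restrict Ksub KG zK z0.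
(* The two copies of [d'] cancel by invariance; what remains is the transfer of [z], which is [v]
   because chi is 1 on [h]. *)
have vE s : P s -> v s = (z s + d' s) + (z (act s h) + d' (act s h)).
  move=> Ps; rewrite /z /mulf fT// vG// bG// h1 dG//.
  by F2_case (f k s); F2_case (v s); F2_case (b s); F2_case (d' s);
    apply: val_inj.
case: k v vG v0 b bG bE z zK z0 d' dG d0 dE vE => [|k] v vG v0 b bG bE z zK z0
    d' dG d0 /= dE vE; first by move=> s Ps; rewrite vE// !dE// ?addr0//;
    exact: P_act.
case: dE => e eK eE; exists (fun s => e s + e (act s h)).
  have eL s g : P s -> g \in Gam -> e (act s g) =
      if chi g == 0 then e s else e (act s h).
    move=> Ps Gg; case: ifPn => [g0|]; first by rewrite eK// inE Gg.
    case: (F2_dichotomy (chi g)) => [->|g1 _]; first by rewrite eqxx.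
    have -> : act s g = act (act s h) (h + g).
      by rewrite -actD addrA Z2_addrr add0r.
    rewrite eK //; first exact: P_act.
    by rewrite inE (proj2 Gam_subgrp)//= chiD h1 g1 F2_addrr.
  move=> s g Ps Gg; rewrite -actD (eL _ _ Ps (proj2 Gam_subgrp _ _ Gg Gh)).
  rewrite (eL _ _ Ps Gg) chiD h1.
  by case: (F2_dichotomy (chi g)) => -> //=; rewrite addrC.
move=> s Ps; rewrite cobD vE// eE// eE; last exact: P_act.
congr (_ + _); by apply: eq_bigr => i _; rewrite d_act.
Qed.

Lemma eulers_injective (J : eqType) (F : J -> forall k, S k -> 'F_2)
    (chi : J -> Z2 n -> 'F_2) js k (v : S k -> 'F_2) :
  {in js, forall j, [/\ twisted (F j) (chi j),
    forall g h, chi j (g + h) = chi j g + chi j h &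
    exists2 h, h \in Gam & chi j h = 1]} ->
  invar Gam v -> closedc v -> exactc Gam (eulers F js v) -> exactc Gam v.
Proof.
move=> Fchi vG v0; elim: js Fchi => //= j js IHjs Fchi ev.
have Fchi' : {in js, forall j, [/\ twisted (F j) (chi j),
    forall g h, chi j (g + h) = chi j g + chi j h &
    exists2 h, h \in Gam & chi j h = 1]}.
  by move=> i ijs; apply: Fchi; rewrite inE ijs orbT.
apply: IHjs => //; have [fT chiD [h Gh h1]] := Fchi j (mem_head _ _).
apply: (euler_injective fT chiD Gh h1) => //.
  by apply: (invar_eulers (chi := chi)) => // i /Fchi'[].
exact: closedc_eulers.
Qed.
End Gysin.
Arguments eulers {S} d {J} F js {k} c.

(** * Chains of affine simplices, as lists of vertices *)

Section Lists.
Variable T : Type.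
Implicit Types (l m : seq T) (c : seq T -> 'F_2).

(* The faces of a simplex. The empty list counts as a simplex (of dimension -1),
   so this is the augmented boundary and coning is always a homotopy. *)
Fixpoint bd l : seq (seq T) :=
  if l is p :: l' then l' :: [seq p :: m | m <- bd l'] else [::].

Lemma bd_cons p l : bd (p :: l) = l :: [seq p :: m | m <- bd l].
Proof. by []. Qed.
Arguments bd : simpl never.

Definition del i l := take i l ++ drop i.+1 l.

Lemma big_bd c l : \sum_(m <- bd l) c m = \sum_(i < size l) c (del i l).
Proof.
elim: l c => [|p l IHl] c; first by rewrite big_nil big_ord0.
rewrite bd_cons big_cons big_ord_recl /= /del /= drop0; congr (_ + _).
by rewrite big_map IHl; apply: eq_bigr => i _.
Qed.


Lemma all_bd_size l : all (fun m => (size m).+1 == size l) (bd l).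
Proof.
elim: l => // p l IHl; rewrite bd_cons /= eqxx all_map; apply: sub_all IHl => m /= /eqP <-.
by [].
Qed.

Lemma bd_bd c l : \sum_(m <- bd l) \sum_(x <- bd m) c x = 0.
Proof.
elim: l c => [|p l IHl] c; first by rewrite big_nil.
rewrite bd_cons big_cons big_map.
under [X in _ + X]eq_bigr do rewrite bd_cons big_cons big_map.
by rewrite big_split /= IHl addr0 F2_addrr.
Qed.
End Lists.
Arguments bd {T} : simpl never.

Lemma bd_map T U (f : T -> U) l : bd (map f l) = map (map f) (bd l).
Proof. by elim: l => // p l IHl; rewrite map_cons !bd_cons IHl map_cons -!map_comp. Qed.

(** * The prism operator on lists of vertices *)

Section Prism.
Variables (T U : Type) (i0 i1 : T -> U).

(** The usual triangulation of a prism: bottom vertices up to some place, then top vertices from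
    that same place on. *)
Fixpoint prism (l : seq T) : seq (seq U) :=
  if l is p :: l' then (i0 p :: map i1 l) :: map (cons (i0 p)) (prism l')
  else [::].

Lemma prism_cons p l : prism (p :: l) =
  (i0 p :: map i1 (p :: l)) :: map (cons (i0 p)) (prism l).
Proof. by []. Qed.
Arguments prism : simpl never.

(** The induction needs all [c] at once: the hypothesis is applied to [c] precomposed with adding
    the vertex [i0 p]. *)
Lemma prism_bd (c : seq U -> 'F_2) l :
  \sum_(x <- prism l) \sum_(m <- bd x) c m
    + \sum_(m <- bd l) \sum_(x <- prism m) c x
  = c (map i0 l) + c (map i1 l).
Proof.
elim: l c => [|p l IHl] c; first by rewrite big_nil /= big_nil !F2_addrr.
rewrite prism_cons map_cons big_cons (bd_cons (i0 p)) big_cons big_map.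
rewrite (bd_cons (i1 p)) big_cons big_map bd_map big_map big_map.
rewrite (bd_cons p) big_cons big_map.
under [X in _ + X + _]eq_bigr do rewrite bd_cons big_cons big_map.
under [X in _ + (_ + X)]eq_bigr do rewrite prism_cons big_cons big_map /=.
rewrite !big_split /=.
have := IHl (fun x => c (i0 p :: x)).
move: (\sum_(x <- prism l) \sum_(m <- bd x) c (i0 p :: m)) => A.
move: (\sum_(m <- bd l) \sum_(x <- prism m) c (i0 p :: x)) => B.
move: (\sum_(i <- prism l) c i) => C.
move: (\sum_(j <- bd l) c (i0 p :: i1 p :: map i1 j)) => D.
move: (c (i1 p :: _)) (c (i0 p :: map i0 l)) (c (i0 p :: map i1 l)) => x y z.
move=> H; have -> : A = y + z + B by rewrite -H -addrA F2_addrr addr0.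
by F2_case B; F2_case C; F2_case D; F2_case x; F2_case y; F2_case z;
  apply: val_inj.
Qed.

Lemma all_prism_size l : all (fun x => size x == (size l).+1) (prism l).
Proof.
elim: l => // p l IHl; rewrite prism_cons /= size_map eqxx all_map.
by apply: sub_all IHl => x /= /eqP ->.
Qed.
End Prism.
Arguments prism {T U} i0 i1 : simpl never.

(** * Barycentric subdivision of lists of vertices *)

Section Subdivision.
Variables (T : Type) (bar : seq T -> T).

(* [sd] is the barycentric subdivision and [td] a chain homotopy from the
   identity to it; both cone from [bar l] and recurse on the dimension. *)
Fixpoint sdn (n : nat) (l : seq T) : seq (seq T) :=
  if n is n'.+1 then map (cons (bar l)) (flatten (map (sdn n') (bd l)))
  else [:: [::]].
Definition sd l := sdn (size l) l.

Fixpoint tdn (n : nat) (l : seq T) : seq (seq T) :=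
  if n is n'.+1 then map (cons (bar l)) (l :: flatten (map (tdn n') (bd l)))
  else [::].
Definition td l := tdn (size l) l.

Lemma big_flatten_map (A B : Type) (f : A -> seq B) (s : seq A) (c : B -> 'F_2) :
  \sum_(x <- flatten (map f s)) c x = \sum_(y <- s) \sum_(x <- f y) c x.
Proof. by rewrite big_flatten big_map. Qed.

Lemma eq_big_bd n (l : seq T) (c c' : seq T -> 'F_2) : size l = n.+1 ->
  (forall m, size m = n -> c m = c' m) ->
  \sum_(m <- bd l) c m = \sum_(m <- bd l) c' m.
Proof.
move=> ln cc'; have := all_bd_size l; rewrite ln; elim: (bd l) => [|m L IHL].
  by rewrite !big_nil.
by rewrite !big_cons /= => /andP[/eqP[mn] /IHL ->]; rewrite cc'.
Qed.

(** The boundary of the cones in [td l] consists of their bases, namely [l] and the [td] of its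
    faces, and of the cone on the boundary of these bases. By the induction hypothesis and [bd_bd]
    the latter is the cone on the subdivided faces, that is [sd l]. *)
Lemma td_bd (c : seq T -> 'F_2) l :
  \sum_(x <- td l) \sum_(m <- bd x) c m + \sum_(m <- bd l) \sum_(x <- td m) c x
  = c l + \sum_(m <- sd l) c m.
Proof.
move ln: (size l) => n; elim: n l ln c => [|n IHn] l ln c.
  by case: l ln => // _; rewrite !big_nil /sd /= big_seq1 F2_addrr addr0.
rewrite /td /sd ln [tdn _ l]/= [sdn _ l]/=.
rewrite big_map big_cons big_map !big_flatten_map bd_cons big_cons big_map.
under [X in _ + X + _]eq_bigr do under eq_bigr do rewrite bd_cons big_cons big_map.
under [X in _ + X + _]eq_bigr do rewrite big_split /=.
rewrite big_split /=.
have -> : \sum_(m <- bd l) \sum_(x <- tdn (size m) m) c x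
       = \sum_(m <- bd l) \sum_(x <- tdn n m) c x.
  by apply: (eq_big_bd ln) => m ->.
have key : \sum_(m <- bd l) (\sum_(x <- tdn n m) \sum_(y <- bd x) c (bar l :: y)
      + \sum_(y <- bd m) \sum_(x <- td y) c (bar l :: x)) =
    \sum_(m <- bd l) (c (bar l :: m) + \sum_(x <- sdn n m) c (bar l :: x)).
  apply: (eq_big_bd ln) => m mn; have := IHn m mn (fun x => c (bar l :: x)).
  by rewrite /sd /td mn.
move: key; rewrite !big_split /= bd_bd addr0 => ->.
move: (c l) (\sum_(y <- bd l) \sum_(x <- tdn n y) c x) => x y.
set z := \sum_(m <- bd l) c (bar l :: m).
set w := \sum_(m <- bd l) _.
by F2_case x; F2_case y; F2_case z; F2_case w; apply: val_inj.
Qed.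

Fixpoint sdN (N : nat) (l : seq T) : seq (seq T) :=
  if N is N'.+1 then flatten (map (sdN N') (sd l)) else [:: l].
End Subdivision.

Lemma sdn_map T U (bar : seq T -> T) (bar' : seq U -> U) (f : T -> U) n l :
  (forall l, (0 < size l)%N -> f (bar l) = bar' (map f l)) ->
  size l = n -> sdn bar' n (map f l) = map (map f) (sdn bar n l).
Proof.
move=> fbar; elim: n l => //= n IHn l ln.
rewrite -fbar ?ln// bd_map map_flatten -!map_comp map_flatten -!map_comp.
congr flatten; have := all_bd_size l; rewrite ln; elim: (bd l) => //= m L IHL.
move=> /andP[/eqP[mn] /IHL ->]; congr (_ :: _).
by rewrite IHn// -!map_comp; apply: eq_map.
Qed.

Lemma sd_map T U (bar : seq T -> T) (bar' : seq U -> U) (f : T -> U) l :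
  (forall l, (0 < size l)%N -> f (bar l) = bar' (map f l)) ->
  sd bar' (map f l) = map (map f) (sd bar l).
Proof. by move=> fbar; rewrite /sd size_map; apply: sdn_map. Qed.

Lemma sdN_map T U (bar : seq T -> T) (bar' : seq U -> U) (f : T -> U) N l :
  (forall l, (0 < size l)%N -> f (bar l) = bar' (map f l)) ->
  sdN bar' N (map f l) = map (map f) (sdN bar N l).
Proof.
move=> fbar; elim: N l => //= N IHN l; rewrite (sd_map _ fbar) -map_comp.
by rewrite map_flatten -!map_comp; congr flatten; apply: eq_map => m /=.
Qed.

Lemma all_flatten T (a : pred T) ss : all a (flatten ss) = all (all a) ss.
Proof. by elim: ss => //= s ss IHs; rewrite all_cat IHs. Qed.

Lemma sd_size T (bar : seq T -> T) l :
  all (fun m => size m == size l) (sd bar l).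
Proof.
rewrite /sd; move ln: (size l) => n; elim: n l ln => //= n IHn l ln.
rewrite all_map all_flatten all_map; have := all_bd_size l; rewrite ln.
by apply: sub_all => m /eqP[mn]; apply: sub_all (IHn _ mn) => x /= /eqP ->.
Qed.

Lemma td_size T (bar : seq T -> T) l :
  all (fun m => size m == (size l).+1) (td bar l).
Proof.
rewrite /td; move ln: (size l) => n; elim: n l ln => //= n IHn l ln.
rewrite all_map all_flatten all_map ln eqxx /=; have := all_bd_size l; rewrite ln.
by apply: sub_all => m /eqP[mn]; apply: sub_all (IHn _ mn) => x /= /eqP ->.
Qed.

Lemma sdN_size T (bar : seq T -> T) N l :
  all (fun m => size m == size l) (sdN bar N l).
Proof.
elim: N l => [|N IHN] l /=; first by rewrite eqxx.
rewrite all_flatten all_map; apply: sub_all (sd_size bar l) => m /eqP <-.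
exact: IHN.
Qed.

(** * Singular simplices and affine maps *)

Section Affine.
Variable R : realType.

Definition dlt k (i : nat) : 'rV[R]_k.+1 := \row_j (i == j)%:R.

Lemma dlt_simplex k (i : nat) : (i < k.+1)%N -> dlt k i \in simplex R k.
Proof.
move=> ik; rewrite inE; split=> [j|]; first by rewrite mxE ler0n.
rewrite (bigD1 (Ordinal ik)) //= mxE eqxx big1 ?addr0// => j ji.
by rewrite mxE; case: eqP => // E; case/eqP: ji; apply/val_inj.
Qed.

Definition vtx k (i : 'I_k.+1) : simplex R k := exist _ (dlt k i) (dlt_simplex (ltn_ord i)).

Lemma simplex_inj k (x y : simplex R k) : \val x = \val y -> x = y.
Proof. exact: val_inj. Qed.

Lemma simplexP k (x : simplex R k) :
  (forall i, 0 <= \val x ord0 i) /\ \sum_i \val x ord0 i = 1.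
Proof. by case: x => x /=; rewrite inE. Qed.

(* The default value of [nth] keeps the combination in the simplex even when [l]
   has the wrong length. *)
Definition comb k j (l : seq (simplex R k)) (t : 'rV[R]_j.+1) : 'rV[R]_k.+1 :=
  \sum_(i < j.+1) t ord0 i *: \val (nth (vtx ord0) l i).

Lemma comb_simplex k j (l : seq (simplex R k)) (t : simplex R j) :
  comb l (\val t) \in simplex R k.
Proof.
have [t0 t1] := simplexP t; rewrite inE; split=> [i|].
  rewrite summxE sumr_ge0// => a _; rewrite mxE mulr_ge0//.
  exact: (simplexP _).1.
under eq_bigr do rewrite summxE.
rewrite exchange_big -[RHS]t1 /=; apply: eq_bigr => a _.
under eq_bigr do rewrite mxE.
by rewrite -mulr_sumr (simplexP _).2 mulr1.
Qed.

Definition aff k j (l : seq (simplex R k)) (t : simplex R j) : simplex R k :=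
  exist _ (comb l (\val t)) (comb_simplex l t).

Lemma comb_continuous k j (l : seq (simplex R k)) : continuous (@comb k j l).
Proof.
have scale_continuous (f : 'rV[R]_j.+1 -> R) (v : 'rV[R]_k.+1) :
    continuous f -> continuous (fun x => f x *: v).
  by move=> fc x; apply: (@cvgZr_tmp R _ _ (nbhs x) _ f); exact: fc.
apply: (@continuous_big 'rV[R]_k.+1) => [|i _]; first exact: add_continuous.
apply: scale_continuous; exact: coord_continuous.
Qed.

Lemma aff_continuous k j (l : seq (simplex R k)) : continuous (@aff k j l).
Proof.
apply: (@continuous_comp_initial _ _ _ (@set_val _ (simplex R k))).
move=> x; apply: (@continuous_comp _ _ _ set_val (@comb k j l)).
  exact: initial_continuous.
exact: comb_continuous.
Qed.
HB.instance Definition _ k j l :=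
  @isContinuous.Build _ _ (@aff k j l) (@aff_continuous k j l).

Lemma nth_del (T : Type) (x0 : T) (l : seq T) i j : (i < size l)%N ->
  nth x0 (del i l) j = nth x0 l (bump i j).
Proof.
move=> il; rewrite nth_cat size_take il; case: ltnP => ji.
  by rewrite nth_take// /bump leqNgt ji.
by rewrite nth_drop /bump ji addSn subnKC.
Qed.

Lemma sum_insert0 (V : lmodType R) j (v : nat -> V) (i : 'I_j.+2)
    (t : 'rV[R]_j.+1) :
  \sum_(a < j.+2) insert0 i t ord0 a *: v a =
  \sum_(a < j.+1) t ord0 a *: v (bump i a).
Proof.
rewrite (bigD1 i)//= mxE unlift_none scale0r add0r.
rewrite (reindex_onto (lift i) (fun j => odflt ord0 (unlift i j))) /=; last first.
  by move=> a ai; case: unliftP ai => [j' -> //|->]; rewrite eqxx.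
apply: eq_big => [a|a _]; first by rewrite liftK eqxx andbT eq_sym neq_lift.
by rewrite mxE liftK.
Qed.

Lemma comb_insert0 k j (l : seq (simplex R k)) (i : 'I_j.+2) (t : 'rV[R]_j.+1) :
  size l = j.+2 -> comb l (insert0 i t) = comb (del i l) t.
Proof.
move=> ls; rewrite /comb (sum_insert0 (fun a => \val (nth (vtx ord0) l a))).
by apply: eq_bigr => a _; rewrite nth_del// ls.
Qed.

Definition iota_vtx k : seq (simplex R k) := [seq vtx i | i <- enum 'I_k.+1].

Lemma size_iota_vtx k : size (iota_vtx k) = k.+1.
Proof. by rewrite size_map size_enum_ord. Qed.

Lemma nth_iota_vtx k (i : 'I_k.+1) : nth (vtx ord0) (iota_vtx k) i = vtx i.
Proof.
by rewrite (nth_map ord0) ?size_enum_ord// nth_ord_enum.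
Qed.

Lemma aff_iota_vtx k (t : simplex R k) : aff (iota_vtx k) t = t.
Proof.
apply: simplex_inj => /=; rewrite /comb.
under eq_bigr do rewrite nth_iota_vtx /=.
apply/rowP => j; rewrite summxE (bigD1 j)//= !mxE eqxx mulr1 big1 ?addr0//.
by move=> i ij; rewrite !mxE; case: eqP => [/val_inj ij0|_]; [rewrite ij0 eqxx in ij|exact: mulr0].
Qed.

Lemma map_aff_iota k j (l : seq (simplex R k)) : size l = j.+1 ->
  map (@aff k j l) (iota_vtx j) = l.
Proof.
move=> ls; apply: (@eq_from_nth _ (vtx ord0)).
  by rewrite size_map size_iota_vtx ls.
rewrite size_map size_iota_vtx => i il.
rewrite (nth_map (vtx ord0)) ?size_iota_vtx//.
rewrite -[i]/(nat_of_ord (Ordinal il)) nth_iota_vtx.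
apply: simplex_inj => /=; rewrite /comb (bigD1 (Ordinal il))//= mxE eqxx.
rewrite scale1r big1 ?addr0// => a ai; rewrite mxE.
by case: eqP => [E|]; [case/eqP: ai; apply/val_inj|rewrite scale0r].
Qed.

Lemma aff_aff k j i (l : seq (simplex R k)) (m : seq (simplex R j))
    (t : simplex R i) : size m = i.+1 ->
  aff l (aff m t) = aff (map (@aff k j l) m) t.
Proof.
move=> ms; apply: simplex_inj => /=; rewrite /comb.
under [RHS]eq_bigr => a _ do
  rewrite (nth_map (vtx ord0)) ?ms//= /comb scaler_sumr.
rewrite exchange_big /=; apply: eq_bigr => b _.
rewrite summxE scaler_suml; apply: eq_bigr => a _.
by rewrite scalerA mxE.
Qed.
End Affine.

Section Sub.
Variables (R : realType) (X : topologicalType).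

(** Turns lists of points of the standard simplex into singular simplices: [l] lists the vertices of
    an affine simplex, to which [s] is restricted. *)
Definition sub k (s : singular R X k) j (l : seq (simplex R k)) :
  singular R X j := s \o @aff R k j l.

Lemma singular_ext k (s t : singular R X k) : s =1 t -> s = t.
Proof. by move=> st; apply/continuousEP. Qed.

Lemma sub_iota k (s : singular R X k) : sub s k (iota_vtx R k) = s.
Proof. by apply: singular_ext => t; rewrite /sub /= aff_iota_vtx. Qed.

Lemma face_sub k (s : singular R X k) j (l : seq (simplex R k)) (i : 'I_j.+2) :
  size l = j.+2 -> face i (sub s j.+1 l) = sub s j (del i l).
Proof.
move=> ls; apply: singular_ext => t; rewrite /face /sub /=; congr (s _).
by apply: simplex_inj => /=; rewrite comb_insert0.
Qed.

Lemma sub_sub k (s : singular R X k) j l i m : size m = i.+1 ->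
  sub (sub s j l) i m = sub s i (map (@aff R k j l) m).
Proof.
move=> ms; apply: singular_ext => t; rewrite /sub /=; congr (s _).
exact: aff_aff.
Qed.

Lemma coboundary_sub k (s : singular R X k) j (l : seq (simplex R k))
  (c : cochain R X j) : size l = j.+2 ->
  coboundary c (sub s j.+1 l) = \sum_(m <- bd l) c (sub s j m).
Proof.
move=> ls; rewrite (big_bd (fun m => c (sub s j m))) ls.
by apply: eq_bigr => i _; rewrite face_sub.
Qed.

Lemma coboundary_iota k (s : singular R X k.+1) (c : cochain R X k) :
  coboundary c s = \sum_(m <- bd (iota_vtx R k.+1)) c (sub s k m).
Proof. by rewrite -coboundary_sub ?size_iota_vtx// sub_iota. Qed.

Lemma coboundaryK k (c : cochain R X k) s : coboundary (coboundary c) s = 0.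
Proof.
rewrite coboundary_iota -[RHS](bd_bd (fun m => c (sub s k m)) (iota_vtx R k.+2)).
apply: (@eq_big_bd _ k.+2); first by rewrite size_iota_vtx.
by move=> m ms; rewrite coboundary_sub.
Qed.
End Sub.

(** * Homotopy invariance *)

Definition mkcont (X Y : topologicalType) (f : X -> Y) (fc : continuous f) :
  continuousType X Y := HB.pack f (@isContinuous.Build X Y f fc).

Lemma continuous_pair (X Y Z : topologicalType) (f : X -> Y) (g : X -> Z) :
  continuous f -> continuous g -> continuous (fun x => (f x, g x)).
Proof. by move=> fc gc x; exact: (cvg_pair (fc x) (gc x)). Qed.

Lemma continuous_comp2 (X Y Z : topologicalType) (f : X -> Y) (g : Y -> Z) :
  continuous f -> continuous g -> continuous (g \o f).
Proof. by move=> fc gc x; apply: continuous_comp; [exact: fc|exact: gc]. Qed.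

Section PrismHomotopy.
Variables (R : realType) (X : topologicalType) (h : R * X -> X).
Hypothesis h_cont : {within `[0, 1]%classic `*` [set: X], continuous h}.

(** A vertex of the prism is a point with a level, [true] standing for time 1; this is the time
    coordinate of the affine simplex on such vertices. *)
Definition ptime k j (l : seq (bool * simplex R k)) (t : 'rV[R]_j.+1) : R^o :=
  \sum_(i < j.+1) t ord0 i *: ((nth (false, vtx R ord0) l i).1%:R : R^o).

Definition ppath k j (s : singular R X k) (l : seq (bool * simplex R k))
    (t : simplex R j) : X :=
  h (ptime l (\val t), s (aff (map snd l) t)).

Lemma ptime01 k j (l : seq (bool * simplex R k)) (t : simplex R j) :
  0 <= ptime l (\val t) <= 1.
Proof.
have [t0 t1] := simplexP t.
apply/andP; split; first by apply: sumr_ge0 => i _; rewrite mulr_ge0.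
rewrite -t1; apply: ler_sum => i _; rewrite -[leRHS]mulr1 ler_wpM2l//.
by case: (nth _ _ _).1.
Qed.

Lemma ptime_continuous k j (l : seq (bool * simplex R k)) :
  continuous (@ptime k j l).
Proof.
have scale_continuous (f : 'rV[R]_j.+1 -> R) (v : R^o) :
    continuous f -> continuous (fun x => f x *: v : R^o).
  by move=> fc x; apply: (@cvgZr_tmp R _ _ (nbhs x) _ f); exact: fc.
apply: (@continuous_big R^o) => [|i _]; first exact: add_continuous.
apply: scale_continuous; exact: coord_continuous.
Qed.

Lemma ppath_continuous k j (s : singular R X k) (l : seq (bool * simplex R k)) :
  continuous (@ppath k j s l).
Proof.
move=> t; rewrite /ppath.
pose u (t : simplex R j) := (ptime l (\val t), s (aff (map snd l) t)).
have uc : continuous u.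
  apply: continuous_pair.
    apply: (@continuous_comp2 _ _ _ (@set_val _ (simplex R j)) (@ptime k j l)).
      exact: initial_continuous.
    exact: ptime_continuous.
  apply: (@continuous_comp2 _ _ _ (@aff R k j (map snd l)) s).
    exact: aff_continuous.
  exact: cts_fun.
(* [h] is continuous only on the cylinder over the unit interval, which [u] never leaves. *)
have uA x : (`[0, 1]%classic `*` [set: X]) (u x).
  by split => //=; rewrite in_itv/=; exact: ptime01.
have hc := (subspace_continuousP _ _).1 h_cont _ (uA t).
move=> B /hc nB; apply: (@filterS _ (nbhs t) (nbhs_filter t) _ _ _ (uc t _ nB)) => x /=.
by move/(_ (uA x)).
Qed.

Definition psimp k (s : singular R X k) j l : singular R X j :=
  mkcont (@ppath_continuous k j s l).

Lemma face_psimp k (s : singular R X k) j l (i : 'I_j.+2) :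
  size l = j.+2 -> face i (psimp s j.+1 l) = psimp s j (del i l).
Proof.
move=> ls; apply: singular_ext => t; rewrite /face /psimp /= /ppath.
congr (h (_, s _)); last first.
  apply: simplex_inj => /=; rewrite comb_insert0 ?size_map//.
  by rewrite /del map_cat map_take map_drop.
rewrite /ptime (sum_insert0 (fun a => (nth _ l a).1%:R : R^o)).
by apply: eq_bigr => a _; rewrite nth_del// ls.
Qed.

Lemma coboundary_psimp k (s : singular R X k) j l (c : cochain R X j) :
  size l = j.+2 ->
  coboundary c (psimp s j.+1 l) = \sum_(m <- bd l) c (psimp s j m).
Proof.
move=> ls; rewrite (big_bd (fun m => c (psimp s j m))) ls.
by apply: eq_bigr => i _; rewrite face_psimp.
Qed.

Lemma psimp_sub k (s : singular R X k) j l i m : size m = i.+1 ->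
  psimp (sub s j l) i m =
  psimp s i (map (fun p => (p.1, @aff R k j l p.2)) m).
Proof.
move=> ms; apply: singular_ext => t; rewrite /psimp /= /ppath.
congr (h (_, _)).
  apply: eq_bigr => a _.
  by rewrite [in RHS](nth_map (false, vtx R ord0)) ?ms.
by rewrite /sub /= aff_aff ?size_map// -!map_comp.
Qed.

Definition bot k (p : simplex R k) := (false, p).
Definition top k (p : simplex R k) := (true, p).

Lemma map_prism (T U T' U' : Type) (i0 i1 : T -> U) (i0' i1' : T' -> U')
    (f : T -> T') (g : U -> U') l :
  (forall p, g (i0 p) = i0' (f p)) -> (forall p, g (i1 p) = i1' (f p)) ->
  prism i0' i1' (map f l) = map (map g) (prism i0 i1 l).
Proof.
move=> g0 g1; elim: l => // p l IHl; rewrite map_cons !prism_cons IHl /=.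
rewrite -!map_comp /= g0 g1; congr ((_ :: _ :: _) :: _).
  by apply: eq_map => q /=; rewrite g1.
by apply: eq_map => q /=; rewrite g0.
Qed.

Definition prism_op k (c : cochain R X k.+1) : cochain R X k := fun s =>
  \sum_(l <- prism (@bot k) (@top k) (iota_vtx R k)) c (psimp s k.+1 l).

Lemma eq_big_all (T : Type) (a : pred T) (l : seq T) (F G : T -> 'F_2) :
  all a l -> (forall x, a x -> F x = G x) ->
  \sum_(x <- l) F x = \sum_(x <- l) G x.
Proof.
move=> al FG; elim: l al => [|x l IHl] /=; first by rewrite !big_nil.
by move=> /andP[ax /IHl E]; rewrite !big_cons E FG.
Qed.

Lemma prism_op_sub k (s : singular R X k) j l (c : cochain R X j.+1) :
  size l = j.+1 ->
  prism_op c (sub s j l) =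
  \sum_(m <- prism (@bot k) (@top k) l) c (psimp s j.+1 m).
Proof.
move=> ls; rewrite /prism_op.
rewrite -[in RHS](map_aff_iota ls).
rewrite (@map_prism _ _ _ _ (@bot j) (@top j) (@bot k) (@top k) (aff l)
  (fun p => (p.1, @aff R k j l p.2)))// big_map.
apply: (eq_big_all (all_prism_size _ _ _)) => m /eqP.
by rewrite size_iota_vtx => ms; rewrite psimp_sub.
Qed.

Lemma psimp_bot k (s : singular R X k) (t : simplex R k) :
  psimp s k (map (@bot k) (iota_vtx R k)) t = h (0, s t).
Proof.
rewrite /psimp /= /ppath -map_comp map_id aff_iota_vtx; congr (h (_, _)).
apply: big1 => i _; rewrite (nth_map (vtx R ord0)) ?size_iota_vtx//=.
by rewrite scaler0.
Qed.

Lemma psimp_top k (s : singular R X k) (t : simplex R k) :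
  psimp s k (map (@top k) (iota_vtx R k)) t = h (1, s t).
Proof.
rewrite /psimp /= /ppath -map_comp map_id aff_iota_vtx; congr (h (_, _)).
rewrite -[RHS](simplexP t).2.
apply: eq_bigr => i _; rewrite (nth_map (vtx R ord0)) ?size_iota_vtx//=.
by rewrite /GRing.scale/= mulr1.
Qed.

Hypothesis h0 : forall x, h (0, x) = x.

Lemma prism_op_coboundary k (c : cochain R X k.+1) (s s1 : singular R X k.+1) :
  (forall t, s1 t = h (1, s t)) ->
  coboundary (prism_op c) s + prism_op (coboundary c) s = c s + c s1.
Proof.
move=> s1E; rewrite addrC coboundary_iota.
have -> : c s = c (psimp s k.+1 (map (@bot k.+1) (iota_vtx R k.+1))).
  by congr c; apply: singular_ext => t; rewrite psimp_bot h0.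
have -> : s1 = psimp s k.+1 (map (@top k.+1) (iota_vtx R k.+1)).
  by apply: singular_ext => t; rewrite psimp_top s1E.
rewrite -(prism_bd (@bot k.+1) (@top k.+1) (fun m => c (psimp s k.+1 m))).
congr (_ + _).
  apply: (eq_big_all (all_prism_size _ _ _)) => m /eqP ms.
  by rewrite coboundary_psimp// ms size_iota_vtx.
apply: (@eq_big_bd _ k.+1); first by rewrite size_iota_vtx.
by move=> m ms; rewrite prism_op_sub.
Qed.

(** Degree 0 is separate because [prism_op] lowers the degree: the only face of a vertex is the
    empty list, whose prism is empty. *)
Lemma prism_op_coboundary0 (c : cochain R X 0) (s s1 : singular R X 0) :
  (forall t, s1 t = h (1, s t)) ->
  prism_op (coboundary c) s = c s + c s1.
Proof.
move=> s1E.
have -> : c s = c (psimp s 0 (map (@bot 0) (iota_vtx R 0))).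
  by congr c; apply: singular_ext => t; rewrite psimp_bot h0.
have -> : s1 = psimp s 0 (map (@top 0) (iota_vtx R 0)).
  by apply: singular_ext => t; rewrite psimp_top s1E.
rewrite -(prism_bd (@bot 0) (@top 0) (fun m => c (psimp s 0 m))).
rewrite [X in _ = _ + X](_ : _ = 0) ?addr0.
  apply: (eq_big_all (all_prism_size _ _ _)) => m /eqP ms.
  by rewrite coboundary_psimp// ms size_iota_vtx.
case E: (iota_vtx R 0) (size_iota_vtx R 0) => [//|p [|//]] _.
by rewrite bd_cons big_cons big_map !big_nil addr0.
Qed.
End PrismHomotopy.

(** * Small simplices *)

Lemma rV_norm_le (R : realType) n (x : 'rV[R]_n) D : 0 <= D ->
  (forall j, `|x ord0 j| <= D) -> `|x| <= D.
Proof.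
move=> D0 xD; rewrite [leLHS]/Num.Def.normr /= mx_normrE.
by apply/bigmax_leP; split => // -[i j] _; rewrite ord1; exact: xD.
Qed.

Lemma rV_coord_le_norm (R : realType) n (x : 'rV[R]_n) j : `|x ord0 j| <= `|x|.
Proof.
rewrite [leRHS]/Num.Def.normr /= mx_normrE; apply/bigmax_geP; right => /=.
by exists (ord0, j).
Qed.

Section Mesh.
Variable R : realType.

Definition near_pts k (D : R) (p q : simplex R k) := `|\val p - \val q| <= D.

Lemma near_pts_sym k D : symmetric (@near_pts k D).
Proof. by move=> p q; rewrite /near_pts distrC. Qed.

Lemma simplex_coord01 k (x : simplex R k) i : 0 <= \val x ord0 i <= 1.
Proof.
have [x0 x1] := simplexP x; rewrite x0 /= -x1 (bigD1 i)//= lerDl.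
exact: sumr_ge0.
Qed.

Lemma simplex_dist1 k (x y : simplex R k) : near_pts 1 x y.
Proof.
apply: rV_norm_le => // j; rewrite !mxE.
have /andP[a b] := simplex_coord01 x j; have /andP[c d] := simplex_coord01 y j.
rewrite ler_norml; apply/andP; split; lra.
Qed.

Lemma comb_dist k j (l : seq (simplex R k)) (t : simplex R j) (v : 'rV[R]_k.+1) D :
  (forall i, (i <= j)%N -> `|v - \val (nth (vtx R ord0) l i)| <= D) ->
  `|v - comb l (\val t)| <= D.
Proof.
move=> vD; have [t0 t1] := simplexP t.
have -> : v - comb l (\val t) =
    \sum_i \val t ord0 i *: (v - \val (nth (vtx R ord0) l i)).
  under eq_bigr do rewrite scalerBr.
  by rewrite sumrB -scaler_suml t1 scale1r.
apply: (le_trans (ler_norm_sum _ _ _)).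
rewrite -[leRHS]mul1r -t1 mulr_suml; apply: ler_sum => i _.
by rewrite normrZ ger0_norm// ler_wpM2l// vD// -ltnS.
Qed.

Definition center_row k : 'rV[R]_k.+1 := \row__ (k.+1%:R^-1).

Lemma center_simplex k : center_row k \in simplex R k.
Proof.
rewrite inE; split=> [i|]; first by rewrite mxE invr_ge0 ler0n.
under eq_bigr do rewrite mxE.
by rewrite sumr_const card_ord -[_ *+ _]mulr_natr mulVf// pnatr_eq0.
Qed.

Definition center k : simplex R k := exist _ (center_row k) (center_simplex k).

Definition bar k (l : seq (simplex R k)) : simplex R k :=
  aff l (center (size l).-1).

Lemma aff_bar k j (l : seq (simplex R k)) (m : seq (simplex R j)) :
  (0 < size m)%N -> aff l (bar m) = bar (map (@aff R k j l) m).
Proof.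
by move=> m0; rewrite /bar aff_aff ?prednK// size_map.
Qed.

Lemma bar_dist k (l : seq (simplex R k)) (v : 'rV[R]_k.+1) D : (0 < size l)%N ->
  all (fun p => `|v - \val p| <= D) l -> `|v - \val (bar l)| <= D.
Proof.
move=> l0 /(all_nthP (vtx R ord0)) lD; apply: comb_dist => i il.
by apply: lD; rewrite -(prednK l0) ltnS.
Qed.

Lemma all_bd (T : Type) (a : pred T) l : all a l -> all (all a) (bd l).
Proof.
have allE (p : T) s : all a (p :: s) = a p && all a s by [].
have allE' (p : seq T) s : all (all a) (p :: s) = all a p && all (all a) s by [].
elim: l => // p l IHl; rewrite bd_cons allE allE' => /andP[ap al].
rewrite al all_map; apply: sub_all (IHl al) => m am.
by rewrite /= ap.
Qed.

Lemma sd_hull k (l : seq (simplex R k)) (v : 'rV[R]_k.+1) D :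
  all (fun p => `|v - \val p| <= D) l ->
  all (all (fun p => `|v - \val p| <= D)) (sd (@bar k) l).
Proof.
rewrite /sd; move ln: (size l) => n; elim: n l ln => //= n IHn l ln al.
rewrite all_map all_flatten all_map /=.
have := all_bd_size l; have := all_bd al; rewrite ln.
elim: (bd l) => //= m L IHL /andP[am aL] /andP[/eqP[mn] Ln].
rewrite IHL// andbT; apply: sub_all (IHn _ mn am) => x /= ->.
by rewrite bar_dist// ln.
Qed.

Lemma all2rel_bd (T : eqType) (r : rel T) (l : seq T) : symmetric r ->
  all2rel r l -> all (fun m => all2rel r m) (bd l).
Proof.
move=> rs; elim: l => // p l IHl; rewrite all2rel_cons// => /and3P[rp al rl].
rewrite bd_cons /= rl all_map; have := all_bd al.
elim: (bd l) (IHl rl) => //= m L IHL /andP[rm rL] /andP[am aL].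
by rewrite all2rel_cons// rp am rm /=; exact: IHL.
Qed.

(** The difference to the barycenter is the average of [n.+1] differences to vertices, one of which,
    that to [p] itself, is zero. *)
Lemma bar_mesh k (l : seq (simplex R k)) n D p : size l = n.+1 ->
  all2rel (near_pts D) l -> p \in l ->
  `|\val p - \val (bar l)| <= n%:R / n.+1%:R * D.
Proof.
move=> ln /allrelP lD pl.
have -> : \val p - \val (bar l) = n.+1%:R^-1 *:
    \sum_(i < n.+1) (\val p - \val (nth (vtx R ord0) l i)).
  rewrite /bar ln /= /comb sumrB scalerBr sumr_const card_ord.
  rewrite -scalerMnr scalerMnl -[_^-1 *+ _]mulr_natr mulVf ?pnatr_eq0//.
  rewrite scale1r; congr (_ - _).
  by rewrite scaler_sumr; apply: eq_bigr => i _; rewrite mxE.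
rewrite normrZ ger0_norm ?invr_ge0// [X in X * D]mulrC -mulrA ler_wpM2l ?invr_ge0//.
apply: (le_trans (ler_norm_sum _ _ _)).
have il : (index p l < n.+1)%N by rewrite -ln index_mem.
rewrite (bigD1 (Ordinal il))//= nth_index// subrr normr0 add0r.
apply: (@le_trans _ _ (\sum_(i < n.+1 | i != Ordinal il) D)).
  by apply: ler_sum => i _; apply: lD => //; rewrite mem_nth// ln.
by rewrite sumr_const cardC1 card_ord mulr_natl lexx.
Qed.

(** An edge of the subdivision lies in a subdivided face, or it joins [bar l] to a point of the
    convex hull, which is no farther away than the vertices of [l]. As n/(n+1) grows with n, one [q]
    serves all faces. *)
Lemma mesh k n (l : seq (simplex R k)) q D : 0 <= D -> q <= 1 ->
  size l = n.+1 -> n%:R / n.+1%:R <= q -> all2rel (near_pts D) l ->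
  all (fun m => all2rel (near_pts (q * D)) m) (sd (@bar k) l).
Proof.
move=> D0 q1; elim: n l => [|n IHn] l ln nq lD.
  case: l ln lD => [//|p [|//]] _ pD; rewrite /sd /= andbT.
  rewrite all2rel1; last exact: near_pts_sym.
  by rewrite /near_pts subrr normr0 mulr_ge0// (le_trans _ nq)// mul0r.
have /allP hull : all (all (near_pts (q * D) (bar l))) (sd (@bar k) l).
  apply: sd_hull; apply/allP => p pl; rewrite distrC.
  by apply: le_trans (bar_mesh ln lD pl) _; rewrite ler_wpM2r.
apply/allP => x xs; have := hull _ xs; move: xs.
rewrite /sd ln /= => /mapP[y /flattenP[L /mapP[m mb ->{L}]] ym ->{x}].
rewrite all2rel_cons; last exact: near_pts_sym.
move=> /= /andP[-> ->] /=.
have mn : size m = n.+1.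
  by have := allP (all_bd_size l) _ mb; rewrite ln => /eqP[].
have mD := allP (all2rel_bd (@near_pts_sym _ _) lD) _ mb.
have ym1 : y \in sd (@bar k) m by rewrite /sd mn; exact: ym.
apply: (allP (IHn m mn _ mD)) => //.
apply: le_trans nq; rewrite ler_pdivrMr ?ltr0n// mulrAC ler_pdivlMr ?ltr0n//.
by rewrite -!natrM ler_nat mulnSr mulSn; lia.
Qed.

Lemma mesh_iter k n N (l : seq (simplex R k)) q D : 0 <= D -> 0 <= q <= 1 ->
  size l = n.+1 -> n%:R / n.+1%:R <= q -> all2rel (near_pts D) l ->
  all (fun m => all2rel (near_pts (q ^+ N * D)) m) (sdN (@bar k) N l).
Proof.
move=> D0 /andP[q0 q1]; elim: N l D D0 => [|N IHN] l D D0 ln nq lD /=.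
  by rewrite expr0 mul1r lD.
rewrite all_flatten all_map exprSr -mulrA.
have := sd_size (@bar k) l; have := mesh D0 q1 ln nq lD.
elim: (sd _ l) => //= m L IHL /andP[mD mL] /andP[/eqP ms Ls].
by rewrite IHL// andbT; apply: IHN; rewrite ?mulr_ge0// ms.
Qed.
End Mesh.

Section SmallSimplices.
Variables (R : realType) (W : topologicalType) (O : set (set W)).
Hypothesis O_open : forall A, O A -> open A.
Hypothesis O_cover : forall w, exists2 A, O A & A w.

Lemma simplex_compact k : compact (simplex R k).
Proof.
apply: bounded_closed_compact.
  exists 1; split; first exact: num_real.
  move=> r r1 x [x0 x1]; apply: (@le_trans _ _ 1 _ _ _ (ltW r1)).
  apply: rV_norm_le => // j; rewrite ger0_norm// -x1 (bigD1 j)//= lerDl.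
  exact: sumr_ge0.
have -> : simplex R k = [set x : 'rV[R]_k.+1 | \sum_i x ord0 i = 1] `&`
    \bigcap_(i : 'I_k.+1) [set x : 'rV[R]_k.+1 | 0 <= x ord0 i].
  apply/seteqP; split=> x [] /=; first by move=> x0 x1; split => // i _; exact: x0.
  by move=> x1 x0; split => // i; exact: (x0 i I).
have coordc (i : 'I_k.+1) : continuous (fun x : 'rV[R]_k.+1 => x ord0 i).
  exact: coord_continuous.
apply: closedI.
  apply: (@preimage_closed _ _ (fun x : 'rV[R]_k.+1 => \sum_i x ord0 i)
    [set y | y = 1]); last exact: closed_eq.
  move=> x _; apply: (@continuous_big R) => [|i _]; first exact: add_continuous.
  exact: coordc.
apply: closed_bigI => i _.
apply: (@preimage_closed _ _ (fun x : 'rV[R]_k.+1 => x ord0 i) [set y | 0 <= y]).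
  by move=> x _; exact: coordc.
exact: closed_ge.
Qed.

Lemma simplex_nbhs k (p : simplex R k) (B : set (simplex R k)) : nbhs p B ->
  exists2 e : R, 0 < e & forall q, `|\val p - \val q| < e -> B q.
Proof.
rewrite nbhsE /= => -[U [oU Up] UB]; case: oU => C oC CU.
have Cp : C (\val p) by rewrite -CU in Up.
have [e e0 eC] := (nbhs_ballP _ _).1 (open_nbhs_nbhs (conj oC Cp)).
exists e => // q pq; apply: UB; rewrite -CU; apply: eC.
by rewrite -ball_normE.
Qed.

Lemma lebesgue_number k (s : singular R W k) : exists2 e : R, 0 < e &
  forall p : simplex R k, exists2 A, O A &
    forall q : simplex R k, `|\val p - \val q| < e -> A (s q).
Proof.
pose P (e : R) (x : 'rV[R]_k.+1) := forall p : simplex R k, \val p = x ->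
  exists2 A, O A & forall q : simplex R k, `|\val p - \val q| < e -> A (s q).
have cover := (compact_near_coveringP _).1 (@simplex_compact k) R (0 : R)^'+ P _.
have {cover} eP : \forall e \near (0 : R)^'+, simplex R k `<=` P e.
  apply: cover => x Kx; pose p : simplex R k := exist _ x (mem_set Kx).
  have [A OA Ap] := O_cover (s p).
  have sA : nbhs p (s @^-1` A).
    by apply: (@cts_fun _ _ s); apply: open_nbhs_nbhs; split => //; exact: O_open.
  have [e e0 eA] := simplex_nbhs sA.
  (* Half of [e] is spent on moving the center from [x] to [y]. *)
  exists (ball x (e / 2), [set d : R | d < e / 2]) => /=.
    split; first by apply: nbhsx_ballx; rewrite divr_gt0.
    by apply: nbhs_right_lt; rewrite divr_gt0.
  move=> [y d] [/= xy de] p' p'y; exists A => // q p'q; apply: eA.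
  rewrite -ball_normE /= in xy.
  rewrite -(subrKA y); apply: le_lt_trans (ler_normD _ _) _.
  by rewrite [e]splitr ltrD// -p'y (lt_trans p'q).
have [e [e0 {}eP]] := filter_ex (filterI (nbhs_right_gt 0) eP).
by exists e => // p; apply: (eP (\val p)) => //; exact: set_mem (valP p).
Qed.

Definition small k (s : singular R W k) := exists2 A, O A & forall t, A (s t).

Lemma small_sub k (s : singular R W k) j l : small s -> small (sub s j l).
Proof. by move=> [A OA sA]; exists A => // t; exact: sA. Qed.

(** All affine simplices of dimension at most [k] are included, not just [s] itself, so that the
    condition passes to further subdivisions and to faces. *)
Definition sd_small (N : nat) k (s : singular R W k) := forall j (l : seq (simplex R k)),
  size l = j.+1 -> (j <= k)%N ->
  all (fun x => `[< small (sub s j x) >]) (sdN (@bar R k) N l).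

Lemma sd_smallS N k (s : singular R W k) : sd_small N s -> sd_small N.+1 s.
Proof.
move=> sN j l lj jk /=; rewrite all_flatten all_map.
by apply: sub_all (sd_size (@bar R k) l) => m /eqP ms; apply: sN; rewrite ?ms.
Qed.

Lemma sd_small_le N M k (s : singular R W k) :
  (N <= M)%N -> sd_small N s -> sd_small M s.
Proof. by move=> /subnKC <-; elim: (M - N)%N => [|m IHm]; rewrite ?addn0// addnS => /IHm /sd_smallS. Qed.

Lemma sd_small_exists k (s : singular R W k) : exists N, sd_small N s.
Proof.
have [e e0 eA] := lebesgue_number s.
(* The contraction ratio in dimension [k], which also bounds those of lower dimensions. *)
pose q : R := k%:R / k.+1%:R.
have q0 : 0 <= q by rewrite divr_ge0.
have q1 : q < 1 by rewrite ltr_pdivrMr ?ltr0n// mul1r ltr_nat.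
have [N qN] : exists N, q ^+ N < e.
  have /cvgrPdist_lt/(_ e e0)[N _ /(_ N)] : q ^+ n @[n --> \oo] --> 0.
    by apply: cvg_expr; rewrite ger0_norm.
  by move=> /(_ (leqnn N)); rewrite sub0r normrN ger0_norm ?exprn_ge0// => ?; exists N.
exists N => j l lj jk.
have jq : j%:R / j.+1%:R <= q.
  rewrite ler_pdivrMr ?ltr0n// mulrAC ler_pdivlMr ?ltr0n//.
  by rewrite -!natrM ler_nat !mulnS; lia.
have lD : all2rel (near_pts 1) l.
  by apply/allrelP => x y _ _; exact: simplex_dist1.
have := mesh_iter N ler01 (introT andP (conj q0 (ltW q1))) lj jq lD.
have := sdN_size (@bar R k) N l.
elim: (sdN _ _ _) => //= m L IHL /andP[/eqP ms Ls] /andP[mD LD].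
rewrite IHL// andbT; apply/asboolP.
have [A OA sA] := eA (nth (vtx R ord0) m 0).
exists A => // t; apply: sA => /=; apply: le_lt_trans qN.
apply: comb_dist => i ij; rewrite -[leRHS]mulr1.
by apply: (allrelP mD); rewrite mem_nth// ms lj.
Qed.

Lemma sd_small_face N k (s : singular R W k.+1) (i : 'I_k.+2) :
  sd_small N s -> sd_small N (face i s).
Proof.
move=> sN j l lj jk.
have faceE : face i s = sub s k (del i (iota_vtx R k.+1)).
  by rewrite -face_sub ?size_iota_vtx// sub_iota.
set d := del i _ in faceE; have := sN j (map (@aff R k.+1 k d) l).
rewrite size_map => /(_ lj (leqW jk)).
rewrite (sdN_map _ _ (@aff_bar R k.+1 k d)) all_map.
have := sdN_size (@bar R k) N l.
elim: (sdN _ _ _) => //= m L IHL /andP[/eqP ms Ls] /andP[mD LD].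
by rewrite IHL// andbT faceE sub_sub// ms.
Qed.
End SmallSimplices.

(** * Extending cocycles from small simplices to all simplices *)

Section Extension.
Variables (R : realType) (W : topologicalType) (O : set (set W)).
Hypothesis O_open : forall A, O A -> open A.
Hypothesis O_cover : forall w, exists2 A, O A & A w.

Definition sd_op k (c : cochain R W k) : cochain R W k := fun s =>
  \sum_(m <- sd (@bar R k) (iota_vtx R k)) c (sub s k m).

Definition td_op k (c : cochain R W k.+1) : cochain R W k := fun s =>
  \sum_(m <- td (@bar R k) (iota_vtx R k)) c (sub s k.+1 m).

Lemma tdn_map T U (b : seq T -> T) (b' : seq U -> U) (f : T -> U) n l :
  (forall l, (0 < size l)%N -> f (b l) = b' (map f l)) ->
  size l = n -> tdn b' n (map f l) = map (map f) (tdn b n l).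
Proof.
move=> fb; elim: n l => //= n IHn l ln.
rewrite -fb ?ln// bd_map -(map_comp (tdn b' n)); congr (_ :: _).
have -> : flatten (map (tdn b' n \o map f) (bd l)) =
    map (map f) (flatten [seq tdn b n x | x <- bd l]).
  rewrite map_flatten -map_comp; congr flatten.
  have := all_bd_size l; rewrite ln; elim: (bd l) => //= m L IHL.
  by move=> /andP[/eqP[mn] /IHL ->]; rewrite /= IHn.
by rewrite -!map_comp; apply: eq_map.
Qed.

Lemma sd_op_sub k (s : singular R W k) j l (c : cochain R W j) :
  size l = j.+1 ->
  sd_op c (sub s j l) = \sum_(m <- sd (@bar R k) l) c (sub s j m).
Proof.
move=> ls; rewrite -[in RHS](map_aff_iota ls) (sd_map _ (@aff_bar R k j l)).
rewrite big_map; apply: (eq_big_all (sd_size _ _)) => m /eqP.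
by rewrite size_iota_vtx => ms; rewrite sub_sub.
Qed.

Lemma td_op_sub k (s : singular R W k) j l (c : cochain R W j.+1) :
  size l = j.+1 ->
  td_op c (sub s j l) = \sum_(m <- td (@bar R k) l) c (sub s j.+1 m).
Proof.
move=> ls; rewrite -[in RHS](map_aff_iota ls) /td size_map.
rewrite (tdn_map (@aff_bar R k j l) erefl).
rewrite big_map; apply: (eq_big_all (td_size _ _)) => m /eqP.
by rewrite size_iota_vtx => ms; rewrite sub_sub.
Qed.

Lemma cochain_addrr k (c : cochain R W k) : c + c = 0.
Proof. by apply/funext => s; exact: F2_addrr. Qed.

Lemma coboundaryD k (b c : cochain R W k) :
  coboundary (b + c) = coboundary b + coboundary c.
Proof. by apply/funext => s; exact: big_split. Qed.

Lemma coboundary_coboundary k (c : cochain R W k) :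
  coboundary (coboundary c) = 0.
Proof. by apply/funext => s; exact: coboundaryK. Qed.

Lemma sd_opD k (b c : cochain R W k) : sd_op (b + c) = sd_op b + sd_op c.
Proof. by apply/funext => s; exact: big_split. Qed.

Lemma td_op0 k : td_op (0 : cochain R W k.+1) = 0.
Proof. by apply/funext => s; exact: big1. Qed.

Lemma td_op_coboundary k (c : cochain R W k.+1) :
  coboundary (td_op c) + td_op (coboundary c) = c + sd_op c.
Proof.
apply/funext => s; rewrite addrC.
change (td_op (coboundary c) s + coboundary (td_op c) s = c s + sd_op c s).
rewrite coboundary_iota -{3}[s]sub_iota.
rewrite -(td_bd (@bar R k.+1) (fun m => c (sub s k.+1 m)) (iota_vtx R k.+1)).
congr (_ + _).
  apply: (eq_big_all (td_size _ _)) => m /eqP ms.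
  by rewrite coboundary_sub// ms size_iota_vtx.
apply: (@eq_big_bd _ k.+1); first by rewrite size_iota_vtx.
by move=> m ms; rewrite td_op_sub.
Qed.

Lemma td_op_coboundary0 (c : cochain R W 0) :
  td_op (coboundary c) = c + sd_op c.
Proof.
apply/funext => s; change (td_op (coboundary c) s = c s + sd_op c s).
rewrite -{2}[s]sub_iota.
rewrite -(td_bd (@bar R 0) (fun m => c (sub s 0 m)) (iota_vtx R 0)).
rewrite [X in _ = _ + X](_ : _ = 0) ?addr0.
  apply: (eq_big_all (td_size _ _)) => m /eqP ms.
  by rewrite coboundary_sub// ms size_iota_vtx.
case E: (iota_vtx R 0) (size_iota_vtx R 0) => [//|p [|//]] _.
by rewrite bd_cons big_cons !big_nil addr0.
Qed.

(** A formal consequence of the homotopy: [sd_op] is the identity plus the commutator of [td_op]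
    with the coboundary, which squares to 0. *)
Lemma coboundary_sd_op k (c : cochain R W k) :
  coboundary (sd_op c) = sd_op (coboundary c).
Proof.
have E1 := td_op_coboundary (coboundary c).
rewrite coboundary_coboundary td_op0 addr0 in E1.
case: k c E1 => [|k] c E1.
  have -> : sd_op c = c + td_op (coboundary c).
    by rewrite td_op_coboundary0 addrA cochain_addrr add0r.
  by rewrite coboundaryD E1 addrA cochain_addrr add0r.
have -> : sd_op c = c + (coboundary (td_op c) + td_op (coboundary c)).
  by rewrite td_op_coboundary addrA cochain_addrr add0r.
rewrite !coboundaryD coboundary_coboundary add0r E1.
by rewrite addrA cochain_addrr add0r.
Qed.

Definition sd_iter m k (c : cochain R W k) := iter m (@sd_op k) c.

Lemma sd_iterD m k (b c : cochain R W k) :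
  sd_iter m (b + c) = sd_iter m b + sd_iter m c.
Proof. by rewrite /sd_iter; elim: m => //= m ->; rewrite sd_opD. Qed.

Lemma coboundary_sd_iter m k (c : cochain R W k) :
  coboundary (sd_iter m c) = sd_iter m (coboundary c).
Proof. by rewrite /sd_iter; elim: m => //= m <-; rewrite coboundary_sd_op. Qed.

Lemma sd_iter_sub m k (s : singular R W k) j l (c : cochain R W j) :
  size l = j.+1 ->
  sd_iter m c (sub s j l) = \sum_(x <- sdN (@bar R k) m l) c (sub s j x).
Proof.
elim: m l => [|m IHm] l ls; first by rewrite big_seq1.
rewrite /sd_iter iterS sd_op_sub//= big_flatten big_map.
by apply: (eq_big_all (sd_size _ _)) => x /eqP xs; apply: IHm; rewrite xs.
Qed.

(** The telescoping homotopy from the identity to the [m]-fold subdivision. *)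
Fixpoint htpy m k (c : cochain R W k.+1) : cochain R W k :=
  if m is m'.+1 then htpy m' c + sd_iter m' (td_op c) else 0.

Lemma htpy_coboundary m k (c : cochain R W k.+1) :
  coboundary (htpy m c) + htpy m (coboundary c) = c + sd_iter m c.
Proof.
elim: m => [|m IHm].
  by rewrite /= cochain_addrr addr0; apply/funext => s; exact: big1.
rewrite /= coboundaryD addrACA IHm coboundary_sd_iter -sd_iterD.
rewrite td_op_coboundary sd_iterD.
have -> : sd_op (sd_iter m c) = sd_iter m (sd_op c).
  by rewrite /sd_iter -iterS iterSr.
by rewrite addrA -[c + _ + _]addrA cochain_addrr addr0.
Qed.

Notation small := (@small R W O).

Definition vanish_small k (c : cochain R W k) := forall s, small s -> c s = 0.

Lemma sd_iter_small m k (c : cochain R W k) s :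
  vanish_small c -> sd_small O m s -> sd_iter m c s = 0.
Proof.
move=> c0 sm; rewrite -[s]sub_iota sd_iter_sub ?size_iota_vtx//.
have := sm k (iota_vtx R k); rewrite size_iota_vtx => /(_ erefl (leqnn k)) al.
rewrite (eq_big_all (G := fun=> 0) al) ?big1// => x /asboolP.
exact: c0.
Qed.

Lemma td_op_small k (c : cochain R W k.+1) : vanish_small c ->
  vanish_small (td_op c).
Proof. by move=> c0 s ss; apply: big1 => m _; apply: c0; exact: small_sub. Qed.

Lemma sd_small_ex k (s : singular R W k) : exists N, `[< sd_small O N s >].
Proof. by have [N sN] := sd_small_exists O_open O_cover s; exists N; apply/asboolP. Qed.

Definition sd_depth k (s : singular R W k) := ex_minn (sd_small_ex s).

Lemma sd_depthP k (s : singular R W k) : sd_small O (sd_depth s) s.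
Proof. by rewrite /sd_depth; case: ex_minnP => m /asboolP. Qed.

Lemma sd_depth_min m k (s : singular R W k) :
  sd_small O m s -> (sd_depth s <= m)%N.
Proof. by rewrite /sd_depth; case: ex_minnP => N _ Nm /asboolP; exact: Nm. Qed.

Lemma sd_depth_small k (s : singular R W k) : small s -> sd_depth s = 0.
Proof.
move=> ss; apply/eqP; rewrite -leqn0; apply: sd_depth_min => j l _ _ /=.
by rewrite andbT; apply/asboolP; exact: small_sub.
Qed.

(** Every summand beyond the depth of [s] evaluates a cochain that vanishes on small simplices at
    pieces that are already small. Hence the depth of a simplex can also be used for its faces. *)
Lemma htpy_stable m k (c : cochain R W k.+1) s : vanish_small c ->
  (sd_depth s <= m)%N -> htpy m c s = htpy (sd_depth s) c s.
Proof.
move=> c0 /subnKC <-; elim: (m - _)%N => [|i IHi]; first by rewrite addn0.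
rewrite addnS -IHi /= -[RHS]addr0; congr (_ + _).
apply: sd_iter_small; first exact: td_op_small.
exact: sd_small_le (leq_addr _ _) (sd_depthP s).
Qed.

Definition retract_op k (c : cochain R W k.+1) : cochain R W k :=
  fun s => htpy (sd_depth s) c s.

(* Every simplex is subdivided just as often as it needs to become small, and a
   small one not at all. *)
Lemma retract_op_coboundary k (c : cochain R W k.+1) s : vanish_small c ->
  coboundary (retract_op c) s + retract_op (coboundary c) s = c s.
Proof.
move=> c0; set m := sd_depth s.
have -> : coboundary (retract_op c) s = coboundary (htpy m c) s.
  apply: eq_bigr => i _; symmetry; apply: htpy_stable => //.
  by apply: sd_depth_min; apply: sd_small_face; exact: sd_depthP.
have E : coboundary (htpy m c) s + htpy m (coboundary c) s = c s + sd_iter m c s.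
  exact: (congr1 (@^~ s) (htpy_coboundary m c)).
rewrite [X in _ + X]/retract_op -/m E.
by rewrite (sd_iter_small c0) ?addr0//; exact: sd_depthP.
Qed.

(** The coboundary of [z] vanishes on small simplices, so [retract_op] provides a primitive of it
    that is itself zero there; adding this primitive closes [z]. *)
Lemma small_cocycle_extend k (z : cochain R W k) :
  (forall s, small s -> coboundary z s = 0) ->
  exists2 z', coboundary z' = 0 & forall s, small s -> z' s = z s.
Proof.
move=> z0; exists (z + retract_op (coboundary z)).
  rewrite coboundaryD; apply/funext => s.
  have := retract_op_coboundary s z0; rewrite coboundary_coboundary.
  have -> : retract_op (0 : cochain R W k.+2) s = 0.
    rewrite /retract_op; elim: (sd_depth s) => //= m IHm.
    have -> : td_op (0 : cochain R W k.+2) = 0 by exact: td_op0.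
    have -> : sd_iter m (0 : cochain R W k.+1) = 0.
      rewrite -[X in sd_iter m X](cochain_addrr (0 : cochain R W k.+1)).
      by rewrite sd_iterD cochain_addrr.
    by rewrite addr0.
  rewrite addr0 => E.
  have -> : (coboundary z + coboundary (retract_op (coboundary z))) s =
    coboundary z s + coboundary (retract_op (coboundary z)) s by [].
  by rewrite E F2_addrr.
move=> s ss; rewrite -[RHS]addr0.
have -> : (z + retract_op (coboundary z)) s =
  z s + retract_op (coboundary z) s by [].
by rewrite /retract_op sd_depth_small.
Qed.
End Extension.

(** * Invariant cochains on the Borel construction *)

Section BorelCochains.
Variables (R : realType) (n : nat) (E W : topologicalType).
Variables (aE : Z2_action n E) (aW : Z2_action n W).
Hypothesis aE_cont : continuous_action aE.
Hypothesis aW_cont : continuous_action aW.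

Notation X := (E * W)%type.
Notation S := (singular R X).

Definition mapc (Y Z : topologicalType) (f : Y -> Z) (fc : continuous f) k
  (s : singular R Y k) : singular R Z k := mkcont (continuous_comp2 (@cts_fun _ _ s) fc).

Lemma face_mapc (Y Z : topologicalType) (f : Y -> Z) (fc : continuous f) k
    (s : singular R Y k.+1) i : face i (mapc fc s) = mapc fc (face i s).
Proof. exact: singular_ext. Qed.

Definition diag_act (g : Z2 n) (x : X) : X := (aE x.1 g, aW x.2 g).

Lemma fst_continuous : continuous (fst : X -> E).
Proof. by move=> x; exact: cvg_fst. Qed.

Lemma snd_continuous : continuous (snd : X -> W).
Proof. by move=> x; exact: cvg_snd. Qed.

Lemma diag_act_continuous g : continuous (diag_act g).
Proof.
apply: continuous_pair.
  exact: (@continuous_comp2 X E E fst (fun e => aE e g) fst_continuous (@aE_cont g)).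
exact: (@continuous_comp2 X W W snd (fun e => aW e g) snd_continuous (@aW_cont g)).
Qed.

Definition act_simplex k (s : S k) (g : Z2 n) : S k :=
  mapc (@diag_act_continuous g) s.

Lemma act_simplexD k (s : S k) g h :
  act_simplex s (g + h) = act_simplex (act_simplex s g) h.
Proof.
by apply: singular_ext => t; rewrite /= /diag_act /= !Z2_actD.
Qed.

Lemma act_simplex0 k (s : S k) : act_simplex s 0 = s.
Proof.
by apply: singular_ext => t; rewrite /= /diag_act !Z2_act0 -surjective_pairing.
Qed.

Lemma face_act_simplex k (i : 'I_k.+2) (s : S k.+1) g :
  face i (act_simplex s g) = act_simplex (face i s) g.
Proof. exact: face_mapc. Qed.

Variables (Hc : R * E -> E) (x0 : E).
Hypothesis Hc_cont : {within `[0, 1]%classic `*` [set: E], continuous Hc}.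
Hypothesis Hc0 : forall x, Hc (0, x) = x.
Hypothesis Hc1 : forall x, Hc (1, x) = x0.

Definition cylinder (p : R * X) : X := (Hc (p.1, p.2.1), p.2.2).

Lemma cylinder_continuous :
  {within `[0, 1]%classic `*` [set: X], continuous cylinder}.
Proof.
apply/subspace_continuousP => -[t [e w]] [/= t01 _].
set F := within _ _.
apply: (@cvg_pair _ _ _ F _ _ _ _ _ (fun p => Hc (p.1, p.2.1)) (fun p => p.2.2)).
  have A01 : (`[0, 1]%classic `*` [set: E]) (t, e) by [].
  have hc := (subspace_continuousP _ _).1 Hc_cont _ A01.
  move=> B /hc nB.
  have pc : continuous (fun p : R * X => (p.1, p.2.1)).
    apply: continuous_pair; first by move=> x; exact: cvg_fst.
    apply: (@continuous_comp2 _ _ _ snd fst) => x; first exact: cvg_snd.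
    exact: cvg_fst.
  apply: (@filterS _ (nbhs (t, (e, w))) (nbhs_filter _) _ _ _ (pc (t, (e, w)) _ nB)).
  by move=> [t' [e' w']] /= H [/= t'01 _]; exact: H.
have pc : continuous (fun p : R * X => p.2.2).
  apply: (@continuous_comp2 _ _ _ snd snd) => x; first exact: cvg_snd.
  exact: cvg_snd.
apply: cvg_trans (pc (t, (e, w))); apply: cvg_app; exact: cvg_within.
Qed.

Definition to_base (x : X) : X := (x0, x.2).

Lemma to_base_continuous : continuous to_base.
Proof. by apply: continuous_pair; [exact: cst_continuous|exact: snd_continuous]. Qed.

Variable O : set (set W).

(* Only the second coordinate has to be small, so that the contraction of [E]
   preserves smallness. *)
Definition small2 k (s : S k) := exists2 A, O A & forall t, A (s t).2.

Lemma small2_face k (i : 'I_k.+2) (s : S k.+1) : small2 s -> small2 (face i s).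
Proof. by move=> [A OA sA]; exists A => // t; exact: sA. Qed.

Notation closed2 := (closedc (@face R X) small2).
Notation exact2 := (exactc (@face R X) act_simplex small2).

(** The contraction of [E] is not equivariant, so the primitive is invariant only under the trivial
    group. *)
Lemma cylinder_exact k (c : S k -> 'F_2) : closed2 c ->
  exact2 [set 0]%SET (fun s => c s + c (mapc to_base_continuous s)).
Proof.
have small_psimp k' (s : S k') j l : small2 s -> small2 (psimp cylinder_continuous s j l).
  by move=> [A OA sA]; exists A => // t; exact: sA.
have toE k' (s : S k') (t : simplex R k') : mapc to_base_continuous s t = cylinder (1, s t).
  by rewrite /cylinder /= Hc1.
have cyl0 x : cylinder (0, x) = x by rewrite /cylinder /= Hc0 -surjective_pairing.
case: k c => [|k] c c0.
  move=> s Ps.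
  rewrite -(prism_op_coboundary0 cylinder_continuous cyl0 c (toE _ s)).
  by apply: big1 => l _; apply: c0; exact: small_psimp.
exists (prism_op cylinder_continuous c).
  by move=> s g Ps; rewrite inE => /eqP ->; rewrite act_simplex0.
move=> s Ps.
rewrite -(prism_op_coboundary cylinder_continuous cyl0 c (toE _ s)).
rewrite [X in _ + X](_ : _ = 0) ?addr0//.
by apply: big1 => l _; apply: c0; exact: small_psimp.
Qed.
End BorelCochains.

(** * Formality in terms of invariant cochains on small simplices *)

Section Formality.
Variables (R : realType) (n : nat) (E W : topologicalType).
Variables (aE : Z2_action n E) (aW : Z2_action n W).
Hypothesis aE_cont : continuous_action aE.
Hypothesis aW_cont : continuous_action aW.
Variables (Hc : R * E -> E) (x0 : E).
Hypothesis Hc_cont : {within `[0, 1]%classic `*` [set: E], continuous Hc}.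
Hypothesis Hc0 : forall x, Hc (0, x) = x.
Hypothesis Hc1 : forall x, Hc (1, x) = x0.

Notation X := (E * W)%type.
Notation act_s := (@act_simplex R n E W aE aW aE_cont aW_cont).
Notation closed2 O := (closedc (@face R X) (@small2 R E W O)).
Notation exact2 O := (exactc (@face R X) act_s (@small2 R E W O)).
Notation invar2 O := (invar act_s (@small2 R E W O)).

Definition stab (x : W) : {set Z2 n} := [set g | `[< aW x g = x >]]%SET.

Lemma stabP x g : reflect (aW x g = x) (g \in stab x).
Proof. by rewrite inE; exact: asboolP. Qed.

(** The family with the single member [[set x]] selects the simplices over [x]. The contraction of
    [E] moves all of them to a constant one, so [c] is cohomologous to a constant cochain, which is
    invariant. *)
Lemma slice_formal (x : W) k (c : singular R X k -> 'F_2) :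
  closed2 [set [set x]] c ->
  exists d, [/\ invar2 [set [set x]] (stab x) d, closed2 [set [set x]] d
    & exact2 [set [set x]] [set 0]%SET (fun s => c s + d s)].
Proof.
set O := [set [set x]] => c0.
pose pt j : singular R X j := mkcont (@cst_continuous (simplex R j) X (x0, x)).
have ptO j : small2 O (pt j) by exists [set x].
exists (fun=> c (pt k)); split => //.
  move=> s sO; rewrite -[RHS](c0 (pt k.+1)); last exact: ptO.
  by apply: eq_bigr => i _; congr c; exact: singular_ext.
have := cylinder_exact aE_cont aW_cont Hc_cont Hc0 Hc1 c0.
apply: exactc_ext => s [A AE sA]; congr (_ + c _); apply: singular_ext => t.
by rewrite /= /to_base; have := sA t; rewrite AE => ->.
Qed.

Variable e0 : E.
Hypothesis formalW : equivariantly_formal aE aW R e0.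

Definition at_e0 (w : W) : X := (e0, w).

Lemma at_e0_continuous : continuous at_e0.
Proof. by apply: continuous_pair; [exact: cst_continuous|move=> w; exact: cvg_id]. Qed.

Definition exact_simple (Y : topologicalType) k : cochain R Y k -> Prop :=
  match k return cochain R Y k -> Prop with
  | 0 => fun c => forall s, c s = 0
  | j.+1 => fun c => exists b, forall s, c s = coboundary b s
  end.

(** Formality lifts the class of [z] to the Borel construction. The quotient map does not
    distinguish [s] from its translates, so the pullback of a representing cocycle is invariant. *)
Lemma formal_lift k (z : cochain R W k) : coboundary z = 0 ->
  exists d : cochain R X k, [/\ forall s g, d (act_s s g) = d s,
    coboundary d = 0
  & exact_simple (fun s => z s + d (mapc at_e0_continuous s))].
Proof.
move=> z0.
have zP : z \in @cocycle_pred R W k by apply/eqP.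
have [h' hE] := formalW (\pi_(cohomology R W k) (Cocycle zP))%qT.
set c' := repr h' in hE.
pose p (x : X) : borel aE aW := (\pi_(borel aE aW) x)%qT.
have pc : continuous p by exact: pi_continuous.
exists (fun s => cocycle_val (repr h') (mapc pc s)); split.
- move=> s g; congr (cocycle_val _ _); apply: singular_ext => t /=.
  apply/eqmodP => /=; apply/asboolP; exists (- g).
  by rewrite /diag_act /= -!Z2_actD subrr !Z2_act0 -surjective_pairing.
- have /eqP c0 : coboundary (cocycle_val (repr h')) == 0 := cocycle_valP (repr h').
  apply/funext => s; rewrite -[RHS](congr1 (@^~ (mapc pc s)) c0).
  by apply: eq_bigr => i _; rewrite face_mapc.
move: hE; rewrite /cohomology_map => /eqP; rewrite -Quotient.idealrBE.
have fibE s : pullback (fiber_inclusion aE aW e0) (cocycle_val (repr h')) s =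
    cocycle_val (repr h') (mapc pc (mapc at_e0_continuous s)).
  by congr (cocycle_val _ _); exact: singular_ext.
move: fibE; move: (repr h') => {}c' fibE; clear -fibE.
case: k z zP c' fibE => [|k] z zP c' fibE; rewrite !unfold_in /=.
  move=> /eqP /(congr1 (@cocycle_val _ _ _)) /= /(congr1 (@^~ _)) H s.
  by rewrite -fibE addrC -[z s]F2_oppr; exact: H.
move=> /asboolP[b bE]; exists b => s; rewrite bE -fibE addrC.
by rewrite -[z s]F2_oppr.
Qed.

Variable O : set (set W).
Hypothesis O_open : forall A, O A -> open A.
Hypothesis O_cover : forall w, exists2 A, O A & A w.

(** The restriction of [c] to the fiber over [e0] is closed on small simplices only; it is extended
    to a cocycle of [W], lifted by formality, and compared with [c] through the contraction of
    [E]. *)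
Lemma cover_formal k (c : singular R X k -> 'F_2) : closed2 O c ->
  exists d, [/\ invar2 O [set: Z2 n]%SET d, closed2 O d
    & exact2 O [set 0]%SET (fun s => c s + d s)].
Proof.
move=> c0; pose z (s : singular R W k) := c (mapc at_e0_continuous s).
have at_small j (s : singular R W j) : small O s -> small2 O (mapc at_e0_continuous s).
  by move=> [A OA sA]; exists A.
have [z' z'0 z'E] : exists2 z' : cochain R W k, coboundary z' = 0 &
    forall s, small O s -> z' s = z s.
  apply: (small_cocycle_extend O_open O_cover) => s /at_small sO.
  rewrite -[RHS](c0 _ sO); apply: eq_bigr => i _.
  by rewrite face_mapc.
have [d [dG d0 dE]] := formal_lift z'0.
have d0' : closed2 O d by move=> s _; exact: (congr1 (@^~ s) d0).
exists d; split => //.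
pose y s := c s + d s.
have yE := cylinder_exact aE_cont aW_cont Hc_cont Hc0 Hc1 (closedcD c0 d0').
pose w (j : nat) (s : singular R X j) : singular R W j := mapc (@snd_continuous E W) s.
pose u j (s : singular R X j) := mapc at_e0_continuous (w j s).
have wO j s : small2 O s -> small O (w j s).
  by move=> [A OA sA]; exists A => // t; exact: sA.
have uO j s : small2 O s -> small2 O (u j s) by move=> /wO /at_small.
(* [s] and its push [u s] into the fiber over [e0] have the same image over [x0], so [y] and its
   value on [u s] are cohomologous. *)
have ubase j s : mapc (@to_base_continuous E W x0) (u j s) =
    mapc (@to_base_continuous E W x0) s.
  by apply: singular_ext.
have yu s : small2 O s -> y (u k s) = z' (w k s) + d (mapc at_e0_continuous (w k s)).
  by move=> /wO /z'E ->.
case: k c c0 @z z' z'0 z'E d dG d0 dE d0' @y yE yu => [|k] c c0 z z' z'0 z'E d dG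
    d0 dE d0' y yE yu.
  have {}yE s : small2 O s -> y s + y (mapc (@to_base_continuous E W x0) s) = 0.
    exact: yE.
  move=> s sO; have := yE s sO; have := yE (u 0%N s) (uO _ _ sO).
  by rewrite yu// dE add0r ubase => ->; rewrite addr0.
case: yE dE => b1 _ b1E [b2 b2E].
exists (fun s => b1 s + (b1 (u k s) + b2 (w k s))).
  by move=> s g Ps; rewrite inE => /eqP ->; rewrite act_simplex0.
move=> s sO; rewrite !cobD.
have -> : cob (@face R X) (fun s => b1 (u k s)) s = cob (@face R X) b1 (u k.+1 s).
  by apply: eq_bigr => i _; rewrite /u /w !face_mapc.
have -> : cob (@face R X) (fun s => b2 (w k s)) s = coboundary b2 (w k.+1 s).
  by apply: eq_bigr => i _; rewrite /w !face_mapc.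
have {}b1E s' : small2 O s' ->
    y s' + y (mapc (@to_base_continuous E W x0) s') = cob (@face R X) b1 s'.
  exact: b1E.
rewrite -b2E -b1E// -b1E; last exact: uO.
rewrite ubase yu// -[c s + d s]/(y s).
move: (y s) (y (mapc _ s)) (z' _ + _) => p q r.
by F2_case p; F2_case q; F2_case r; apply: val_inj.
Qed.
End Formality.

(** * Existence of fixed points *)

(** A subgroup is an F_2-subspace, so [h] is nonzero modulo the span [M] of [K], and some coordinate
    of the quotient detects it. *)
Lemma character_separates n (K : {set Z2 n}) h : subgrp K -> h \notin K ->
  exists chi : Z2 n -> 'F_2, [/\ forall g g', chi (g + g') = chi g + chi g',
    forall g, g \in K -> chi g = 0 & chi h = 1].
Proof.
move=> [K0 KD] hK.
pose M : 'M['F_2]_n := (\sum_(g in K) <<g>>)%MS.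
have KM g : (g <= M)%MS -> g \in K.
  move=> /sub_sumsmxP[u ->].
  apply: (big_ind (fun g : Z2 n => g \in K)) => // i Ki.
  have /sub_rVP[a ->] : (u i *m <<i>> <= i)%MS.
    by rewrite (submx_trans (submxMl _ _))// genmxE.
  by case: (F2_dichotomy a) => ->; rewrite ?scale0r ?scale1r.
have : ~~ (h <= M)%MS by apply: contra hK; exact: KM.
rewrite submxE => hM.
have [j hj] : exists j, (h *m cokermx M) ord0 j <> 0.
  apply: contrapT => h0'; move/eqP: hM; apply; apply/rowP => j.
  by rewrite [RHS]mxE; apply: contrapT => ?; apply: h0'; exists j.
exists (fun g => (g *m cokermx M) ord0 j); split.
- by move=> g g'; rewrite mulmxDl [LHS]mxE.
- move=> g Kg; have : (g <= M)%MS.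
    by rewrite (sumsmx_sup g)// genmxE.
  by rewrite submxE => /eqP ->; rewrite [LHS]mxE.
- by case: (F2_dichotomy ((h *m cokermx M) ord0 j)).
Qed.

Section Slices.
Variables (n : nat) (W : topologicalType) (aW : Z2_action n W).
Hypothesis aW_cont : continuous_action aW.
Hypothesis W_hausdorff : hausdorff_space W.

Lemma Z2_actK (w : W) g : aW (aW w g) g = w.
Proof. by rewrite -Z2_actD Z2_addrr Z2_act0. Qed.

Lemma stab_subgrp w : subgrp (stab aW w).
Proof.
split; first by apply/stabP; exact: Z2_act0.
by move=> g h /stabP wg /stabP wh; apply/stabP; rewrite Z2_actD wg wh.
Qed.

Lemma stab_act w g : stab aW (aW w g) = stab aW w.
Proof.
apply/setP => h; apply/stabP/stabP; last first.
  by move=> wh; rewrite -Z2_actD addrC Z2_actD wh.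
move=> E; have := congr1 (fun v => aW v g) E.
by rewrite -!Z2_actD addrCA Z2_addrr addr0 Z2_act0.
Qed.

Lemma open_act (A : set W) g : open A -> open [set w | A (aW w g)].
Proof. by move=> oA; apply: open_comp => // w _; exact: (@aW_cont g). Qed.

(** Each [g] outside the stabilizer moves [w], so some neighborhood is disjoint from its
    [g]-translate; intersect over the finite group. *)
Lemma slice_nbhd w : exists B : set W, [/\ open B, B w &
  forall v g, B v -> B (aW v g) -> g \in stab aW w].
Proof.
have H g : exists B : set W, nbhs w B /\
    forall v, B v -> B (aW v g) -> g \in stab aW w.
  have [gw|gw] := boolP (g \in stab aW w).
    by exists [set: W]; split => //; exact: filterT.
  have wg : w != aW w g by apply/eqP => wg; case/stabP: gw.
  have := W_hausdorff; rewrite open_hausdorff => /(_ _ _ wg).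
  move=> [[P Q] [/= wP wQ] [oP oQ PQ]].
  exists (P `&` [set v | Q (aW v g)]); split.
    apply: open_nbhs_nbhs; split; first by apply: openI => //; exact: open_act.
    by split; exact: set_mem.
  move=> v [_ /= Qv] [Pv _]; exfalso.
  by move/eqP/seteqP: PQ => [/(_ (aW v g))/(_ (conj Pv Qv))].
have [B BH] := choice H.
have nB : nbhs w [set v | forall g : Z2 n, B g v].
  by apply: filter_forall => g; exact: (BH g).1.
exists (interior [set v | forall g : Z2 n, B g v]); split.
- exact: open_interior.
- exact: nB.
- move=> v g /interior_subset Bv /interior_subset Bvg.
  exact: (BH g).2 v (Bv g) (Bvg g).
Qed.

(* The invariant open set [A 0 `|` A 1] maps equivariantly to [Z_2], on which the
   group acts through [chi]: the Euler class of [chi] vanishes on it. *)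
Definition piece (chi : Z2 n -> 'F_2) (A : 'F_2 -> set W) :=
  [/\ forall b, open (A b), forall w, A 0 w -> A 1 w -> False &
    forall b w g, A b w -> A (b + chi g) (aW w g)].

Lemma piece_at w U (chi : Z2 n -> 'F_2) :
  (forall g h, chi (g + h) = chi g + chi h) ->
  (forall g, g \in stab aW w -> chi g = 0) ->
  open U -> U w -> (forall v g, U v -> U (aW v g)) ->
  exists A, [/\ piece chi A, A 0 w & forall b, A b `<=` U].
Proof.
move=> chiD chi0 oU Uw UG; have [B [oB Bw BS]] := slice_nbhd w.
exists (fun b => U `&` \bigcup_(g in [set g | chi g = b]) [set v | B (aW v g)]).
split; last by move=> b v [].
  split=> [b|v [_ [g /= g0 Bg]] [_ [h /= h1 Bh]]|b v h [Uv [g /= gb Bg]]].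
  - apply: openI => //; apply: bigcup_open => g _; exact: open_act.
  - have : g + h \in stab aW w.
      by apply: (BS (aW v g)) => //; rewrite -Z2_actD addrA Z2_addrr add0r.
    by move=> /chi0; rewrite chiD g0 h1 add0r => /eqP.
  - split; first exact: UG.
    exists (g + h) => /=; first by rewrite chiD gb.
    by rewrite -Z2_actD addrCA Z2_addrr addr0.
split => //; exists 0 => /=; last by rewrite Z2_act0.
by rewrite -(Z2_addrr (0 : Z2 n)) chiD F2_addrr.
Qed.

Lemma invariant_core (U : set W) : open U ->
  open [set w | forall g, U (aW w g)].
Proof.
move=> oU; rewrite openE => w Uw; apply: filter_forall => g.
by apply: open_nbhs_nbhs; split; [exact: open_act|exact: Uw].
Qed.

Lemma invariant_separation (Y Z : set W) : compact [set: W] ->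
  closed Y -> closed Z -> Y `&` Z = set0 ->
  (forall w g, Y w -> Y (aW w g)) -> (forall w g, Z w -> Z (aW w g)) ->
  exists U V : set W, [/\ open U /\ open V, U `&` V = set0, Y `<=` U /\ Z `<=` V,
    forall w g, U w -> U (aW w g) & forall w g, V w -> V (aW w g)].
Proof.
move=> Wc cY cZ YZ YG ZG.
have nY : set_nbhs Y (~` Z).
  apply/set_nbhsP; exists (~` Z); split => //; first exact: closed_openC.
  by move=> w Yw Zw; have : (Y `&` Z) w by []; rewrite YZ.
have [U0 /set_nbhsP[U [oU YU UU0]] U0Z] := compact_normal W_hausdorff Wc cY nY.
pose core (A : set W) := [set w | forall g, A (aW w g)].
have coreG A w g : core A w -> core A (aW w g).
  by move=> Aw h; rewrite -Z2_actD; exact: Aw.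
have coreS A w : core A w -> A w by move=> /(_ 0); rewrite Z2_act0.
exists (core U), (core (~` closure U0)); split.
- by split; apply: invariant_core => //; exact/closed_openC/closed_closure.
- apply/seteqP; split => // w [/coreS /UU0 /subset_closure Uw /coreS]; exact.
- split=> w; first by move=> Yw g; apply: YU; exact: YG.
  by move=> Zw g /U0Z; apply; exact: ZG.
- exact: coreG.
- exact: coreG.
Qed.
End Slices.

(** Continuity is not asked for, since cochains are arbitrary functions: choosing a point in each
    orbit is enough. *)
Lemma free_trivialization n (E : topologicalType) (a : Z2_action n E) :
  free_action a -> exists gam : E -> Z2 n, forall e g, gam (a e g) = gam e + g.
Proof.
move=> a_free.
pose orb (e : E) : pred E := fun e' => `[< exists g, a e g = e' >].
have orbe e : orb e e by apply/asboolP; exists 0; rewrite Z2_act0.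
pose r e := choose (orb e) e.
have rP e : exists g, a (r e) g = e.
  have /asboolP[g <-] : orb e (r e) := chooseP (orbe e).
  by exists g; rewrite -Z2_actD Z2_addrr Z2_act0.
have [gam gamP] := choice rP.
exists gam => e g; have re : r (a e g) = r e.
  rewrite /r (@eq_choose _ _ (orb e)); last first.
    move=> e'; apply/asboolP/asboolP => -[h <-]; first by exists (g + h); rewrite Z2_actD.
    by exists (g + h); rewrite -Z2_actD addrA Z2_addrr add0r.
  by apply: choose_id; [apply/asboolP; exists g|exact: orbe].
have E1 : a (r e) (gam (a e g)) = a (r e) (gam e + g).
  by rewrite -{1}re gamP Z2_actD gamP.
have := a_free (a (r e) (gam (a e g))) (gam (a e g) + (gam e + g)).
rewrite -[in X in X = _]Z2_actD addrA Z2_addrr add0r -E1 => /(_ erefl) /eqP.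
rewrite addr_eq0 => /eqP ->; apply/rowP => j; rewrite !mxE.
exact: F2_oppr.
Qed.

Lemma compact_finite_cover (W : topologicalType) (N : W -> set W) (w0 : W) :
  compact [set: W] -> (forall w, open (N w)) -> (forall w, N w w) ->
  exists js : seq W, forall w, exists2 j, j \in js & N j w.
Proof.
move=> Wc oN NN.
pose W' : ptopologicalType := HB.pack W (isPointed.Build W w0).
have : @cover_compact W' [set: W'] by rewrite -compact_cover.
move=> /(_ W setT N (fun i _ => oN i)) [|D _ DN].
  by move=> w _; exists w => //; exact: NN.
exists (finmap.enum_fset D) => w.
by have [j jD Njw] := DN w I; exists j.
Qed.

Section FixedPoint.
Variables (R : realType) (n : nat) (E W : topologicalType).
Variables (aE : Z2_action n E) (aW : Z2_action n W).
Hypothesis aE_univ : universal_action R aE.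
Hypothesis aW_cont : continuous_action aW.
Variable e0 : E.
Hypothesis formalW : equivariantly_formal aE aW R e0.
Hypothesis W_hausdorff : hausdorff_space W.
Hypothesis W_compact : compact [set: W].

Notation X := (E * W)%type.
Notation S := (singular R X).

Section PieceFunction.
Variable gam : E -> Z2 n.
Hypothesis gamD : forall e g, gam (aE e g) = gam e + g.

(** Locally constant on the piece, so that the associated Euler operator vanishes there; elsewhere
    any function twisted by chi will do. *)
Definition piece_fun (chi : Z2 n -> 'F_2) (A : 'F_2 -> set W) (x : X) : 'F_2 :=
  if `[< A 0 x.2 >] then 0 else if `[< A 1 x.2 >] then 1 else chi (gam x.1).

Lemma piece_fun_in chi A b x : piece aW chi A -> A b x.2 -> piece_fun chi A x = b.
Proof.
move=> [_ A01 _]; rewrite /piece_fun; case: (F2_dichotomy b) => -> Ax.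
  by case: asboolP.
by case: asboolP => [A0|_]; [case: (A01 _ A0 Ax)|case: asboolP].
Qed.

Lemma piece_fun_act chi A g x : (forall g h, chi (g + h) = chi g + chi h) ->
  piece aW chi A ->
  piece_fun chi A (diag_act aE aW g x) = piece_fun chi A x + chi g.
Proof.
move=> chiD Ap; have [_ _ AG] := Ap.
have [[b Ab]|Ax] := pselect (exists b, A b x.2).
  rewrite (piece_fun_in Ap Ab).
    exact: (@piece_fun_in chi A _ (diag_act aE aW g x) Ap (AG _ _ g Ab)).
have nA b : ~ A b x.2 by move=> ?; apply: Ax; exists b.
have nAg b : ~ A b (aW x.2 g).
  by move=> Ag; have := AG _ _ g Ag; rewrite Z2_actK; exact: nA.
rewrite /piece_fun /diag_act /=; do 4! (case: asboolP => [|_]; first by move=> /nA || move=> /nAg).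
by rewrite gamD chiD.
Qed.
End PieceFunction.

Lemma fixed_point_exists (H : {set Z2 n}) (Y : set W) : Y !=set0 ->
  (forall y, Y y -> H \subset stab aW y) -> (forall y g, Y y -> Y (aW y g)) ->
  closed Y -> closed ([set y | H \subset stab aW y] `\` Y) ->
  exists2 y, Y y & forall g, aW y g = y.
Proof.
move=> [x Yx] YH YG cY cZ; apply: contrapT => nofix.
pose Z : set W := [set y | H \subset stab aW y] `\` Y.
have ZG w g : Z w -> Z (aW w g).
  move=> [/= wH nYw]; split; first by rewrite /= stab_act.
  by move=> /(YG _ g); rewrite Z2_actK.
have YZ : Y `&` Z = set0 by apply/seteqP; split => // w [Yw [_ /(_ Yw)]].
have [U [V [[oU oV] UV [YU ZV] UG VG]]] :=
  invariant_separation aW_cont W_hausdorff W_compact cY cZ YZ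
    (fun w g => @YG w g) ZG.
have [aE_hausdorff aE_cont aE_free [x0 [Hc [Hc_cont Hc0 Hc1]]]] := aE_univ.
have [gam gamD] := free_trivialization aE_free.
(* The last two clauses separate the two kinds of Euler classes: off the fixed set of [H] the
   character is nontrivial on [H]; at points of [Y] it is merely nontrivial, but the piece stays
   inside [U]. *)
pose good w (chi : Z2 n -> 'F_2) (A : 'F_2 -> set W) :=
  [/\ forall g h, chi (g + h) = chi g + chi h, piece aW chi A, A 0 w,
   ~~ (H \subset stab aW w) -> exists2 h, h \in H & chi h = 1 &
   Y w -> (forall b, A b `<=` U) /\ exists h, chi h = 1].
have pieces w : exists p : (Z2 n -> 'F_2) * ('F_2 -> set W),
    ~ Z w -> good w p.1 p.2.
  (* Points of [Z] will be covered by [V]; their pair is a dummy. *)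
  have [Zw|nZw] := pselect (Z w); first by exists (fun=> 0, fun=> setT).
  have [Yw|nYw] := pselect (Y w).
    have [g gw] : exists g, g \notin stab aW w.
      apply: contrapT => all_stab; apply: nofix; exists w => // g.
      apply/(stabP aW); apply: contrapT => gw; apply: all_stab.
      by exists g; apply/negP.
    have [chi [chiD chi0 chi1]] := character_separates (stab_subgrp aW w) gw.
    have [A [Ap Aw AU]] := piece_at aW_cont W_hausdorff chiD chi0 oU (YU _ Yw) UG.
    exists (chi, A) => _; split => //=; first by rewrite YH.
    by move=> _; split => //; exists g.
  have wH : ~~ (H \subset stab aW w) by apply/negP => wH; apply: nZw.
  have /subsetPn[h hH hw] := wH.
  have [chi [chiD chi0 chi1]] := character_separates (stab_subgrp aW w) hw.
  have [A [Ap Aw _]] := piece_at aW_cont W_hausdorff chiD chi0 openT I (fun _ _ _ => I).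
  by exists (chi, A) => _; split => // _; exists h.
have [p pP] := choice pieces.
pose chi w := (p w).1; pose A w := (p w).2.
pose N w := if pselect (Z w) then V else A w 0.
have [js jsP] : exists js : seq W, forall w, exists2 j, j \in js & N j w.
  apply: (@compact_finite_cover _ N x) => //.
    move=> w; rewrite /N; case: pselect => [//|nZw] /=.
    by have [_ [oA _ _] _ _ _] := pP w nZw; exact: oA.
  move=> w; rewrite /N; case: pselect => [Zw|nZw] /=; first exact: ZV.
  by have [_ _ Aw _ _] := pP w nZw; exact: Aw.
(* [js1] indexes the Euler classes of the first kind, [js2] those of the second. *)
pose js1 := [seq w <- js | ~~ (H \subset stab aW w)].
pose js2 := [seq w <- js | `[< Y w >]].
have js1P j : j \in js1 -> good j (chi j) (A j) /\ ~~ (H \subset stab aW j).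
  rewrite mem_filter => /andP[jH _]; split => //; apply: pP => -[/= jH' _].
  by rewrite jH' in jH.
have js2P j : j \in js2 -> good j (chi j) (A j) /\ Y j.
  by rewrite mem_filter => /andP[/asboolP Yj _]; split => //; apply: pP => -[].
pose O : set (set W) := [set B | B = V \/
  exists j b, (j \in js1 \/ j \in js2) /\ B = A j b].
have O_open B : O B -> open B.
  move=> [->//|[j [b [jP ->]]]].
  have [_ [oA _ _] _ _ _] : good j (chi j) (A j).
    by case: jP => [/js1P[]|/js2P[]].
  exact: oA.
have O_cover w : exists2 B, O B & B w.
  have [j jjs] := jsP w; rewrite /N; case: pselect => [Zj|nZj] /= Aw.
    by exists V => //; left.
  exists (A j 0) => //; right; exists j, 0; split => //.
  have [Yj|nYj] := pselect (Y j); [right|left]; rewrite mem_filter jjs andbT.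
    exact/asboolP.
  by apply/negP => jH; apply: nZj.
have O_act B g : O B -> exists2 B', O B' & forall w, B w -> B' (aW w g).
  move=> [->|[j [b [jP ->]]]]; first by exists V; [left|move=> w; exact: VG].
  have [_ [_ _ AG] _ _ _] : good j (chi j) (A j).
    by case: jP => [/js1P[]|/js2P[]].
  exists (A j (b + chi j g)); first by right; exists j, (b + chi j g).
  by move=> w; exact: AG.
(* Functions on [E * W] are read off at the first vertex of a simplex: they have to be compatible
   with the action, not with faces. *)
pose F (j : W) k (s : S k) : 'F_2 := piece_fun gam (chi j) (A j) (s (vtx R ord0)).
pose act_s := @act_simplex R n E W aE aW aE_cont aW_cont.
pose P k := @small2 R E W O k.
pose dd := @face R X.
pose one (s : S 0) : 'F_2 := 1.
pose w := eulers dd F js1 one.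
pose v (s : S (size js1 + 0)) : 'F_2 :=
  if `[< U (s (vtx R ord0)).2 >] then w s else 0.
have dd0 k (c : S k -> 'F_2) s : cob dd (cob dd c) s = 0 by exact: coboundaryK.
have d_act k (i : 'I_k.+2) (s : S k.+1) g : dd k i (act_s k.+1 s g) = act_s k (dd k i s) g.
  exact: face_act_simplex.
have actD k (s : S k) g h : act_s k s (g + h) = act_s k (act_s k s g) h.
  exact: act_simplexD.
have small_d Q k (i : 'I_k.+2) (s : S k.+1) : small2 Q s -> small2 Q (dd k i s).
  exact: small2_face.
have P_act k (s : S k) g : g \in [set: Z2 n]%SET -> P k s -> P k (act_s k s g).
  by move=> _ [B OB sB]; have [B' OB' BB'] := O_act B g OB; exists B' => // t; exact: BB'.
have F_twisted (Q : forall k, S k -> Prop) K j : good j (chi j) (A j) ->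
    twisted act_s Q K (F j) (chi j).
  by move=> [chiD Aj _ _ _] k s g _ _; exact: piece_fun_act.
have all_twisted (Q : forall k, S k -> Prop) K (ch : Z2 n -> 'F_2) :
    (forall g h, ch (g + h) = ch g + ch h) -> exists f, twisted act_s Q K f ch.
  move=> chD; exists (fun k s => ch (gam (s (vtx R ord0)).1)) => k s g _ _ /=.
  by rewrite gamD chD.
pose vanish (B : set W) k (c : S k -> 'F_2) :=
  forall s : S k, (forall t, B (s t).2) -> c s = 0.
have vanish_euler B f k (c : S k -> 'F_2) : vanish B k c -> vanish B k.+1 (euler dd f c).
  move=> c0 s sB; rewrite eulerE big1// => i _; rewrite c0 ?mulr0// => t.
  exact: sB.
have vanish_piece j b k (c : S k -> 'F_2) : good j (chi j) (A j) ->
    vanish (A j b) k.+1 (euler dd (F j) c).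
  move=> [_ Aj _ _ _] s sA; rewrite eulerE big1// => i _.
  rewrite {1}/F (piece_fun_in gam Aj (sA _)).
  by rewrite /F (piece_fun_in gam Aj (sA _)) F2_addrr mul0r.
have vanish_eulers B l k (c : S k -> 'F_2) :
    vanish B k c -> vanish B (size l + k)%N (eulers dd F l c).
  by move=> c0; elim: l => //= j l IHl; exact: vanish_euler.
have vanish_mem l j b k (c : S k -> 'F_2) : j \in l -> good j (chi j) (A j) ->
    vanish (A j b) (size l + k)%N (eulers dd F l c).
  move=> + jg; elim: l => //= i l IHl; rewrite inE => /orP[/eqP <-|jl].
    exact: vanish_piece.
  by apply: vanish_euler; exact: IHl.
have one0 (Q : forall k, S k -> Prop) : closedc dd Q one.
  by move=> s _; rewrite /cob !big_ord_recl big_ord0 addr0 F2_addrr.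
have w0 Q : closedc dd (@small2 R E W Q) w.
  exact: (closedc_eulers dd0 (small_d Q)).
have v_in (s : S (size js1 + 0)) : U (s (vtx R ord0)).2 -> v s = w s.
  by rewrite /v; case: asboolP.
have v_out (s : S (size js1 + 0)) : ~ U (s (vtx R ord0)).2 -> v s = 0.
  by rewrite /v; case: asboolP.
have v_vanish j b : j \in js1 -> vanish (A j b) (size js1 + 0)%N v.
  move=> jjs s sA; rewrite /v; case: asboolP => // _.
  by apply: (vanish_mem _ j b) => //; case: (js1P _ jjs).
have v_vanishV : vanish V (size js1 + 0)%N v.
  move=> s sV; apply: v_out => Us; have : (U `&` V) (s (vtx R ord0)).2 by split.
  by rewrite UV.
have AU j b t : j \in js2 -> A j b t -> U t.
  by move=> /js2P[[_ _ _ _ jY] /jY[AU _]]; exact: AU.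
(* No small simplex sees the cut: in [V] the cochain [v] is 0, on the pieces of [js1] already [w] is
   0, and the pieces of [js2] lie in [U], where [v] is [w]. *)
have v0 : closedc dd P v.
  move=> s [B [->|[j [b [[jjs|jjs] ->]]]] sB].
  - by apply: big1 => i _; apply: v_vanishV => t; exact: sB.
  - by apply: big1 => i _; apply: (v_vanish j b jjs) => t; exact: sB.
  - rewrite -[RHS](w0 O s); last first.
      by exists (A j b) => //; right; exists j, b; split => //; right.
    apply: eq_bigr => i _; apply: v_in.
    by apply: (AU j b) => //; exact: sB.
have subT (K : {set Z2 n}) : K \subset [set: Z2 n]%SET by exact: finset.subsetT.
have w_inv Q (K : {set Z2 n}) : invar act_s (@small2 R E W Q) K w.
  apply: (invar_eulers (Gam := K) d_act (small_d Q) (chi := chi)) => //.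
  by move=> j /js1P[jg _]; exact: F_twisted.
have v_inv : invar act_s P [set: Z2 n]%SET v.
  move=> s g Ps _; rewrite /v; case: asboolP => /= Ug; case: asboolP => // Us.
  - exact: (w_inv O [set: Z2 n]%SET).
  - by case: Us; rewrite -[(s _).2](Z2_actK aW _ g); exact: UG.
  - by case: Ug; exact: UG.
(* The product is zero as a cochain on small simplices: each piece of [js2] kills its own factor,
   and [v] vanishes on the other members of the cover. *)
have ev : exactc dd act_s P [set: Z2 n]%SET (eulers dd F js2 v).
  apply: (@exactc_ext _ _ _ _ _ _ _ (fun=> 0)).
    move=> s [B [->|[j [b [[jjs|jjs] ->]]]] sB]; symmetry.
    - exact: (vanish_eulers V).
    - by apply: (vanish_eulers (A j b)) => //; exact: v_vanish.
    - by apply: (vanish_mem js2 j b) => //; case: (js2P _ jjs).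
  case: (size js2 + _)%N => [//|k]; exists (fun=> 0) => // s _.
  by rewrite /cob big1.
have {ev} : exactc dd act_s P [set: Z2 n]%SET v.
  apply: (eulers_injective dd0 d_act actD (small_d O) P_act (all_twisted _ _) _
    (cover_formal aE_cont aW_cont Hc_cont Hc0 Hc1 formalW O_open O_cover)
    (chi := chi)) ev => //.
    by split => // *; rewrite finset.inE.
  move=> j /js2P[jg Yj]; split; [exact: F_twisted|by case: jg|].
  by case: jg => _ _ _ _ /(_ Yj)[_ [h h1]]; exists h => //; rewrite finset.inE.
(* Simplices over the point [x] of [Y] are small, and on them [v] is the full product [w]. *)
pose Q k := @small2 R E W [set [set x]] k.
have QP k (s : S k) : Q k s -> P k s.
  move=> [_ -> sx]; have [B OB Bx] := O_cover x.
  by exists B => // t; rewrite (sx t).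
have exQ k (c : S k -> 'F_2) : exactc dd act_s P [set: Z2 n]%SET c ->
    exactc dd act_s Q (stab aW x) c.
  case: k c => [|k] c /=; first by move=> c0 s /QP; exact: c0.
  move=> [b bG bE]; exists b; last by move=> s /QP; exact: bE.
  by move=> s g /QP Ps _; apply: bG => //; rewrite finset.inE.
move=> /exQ vQ.
(* Over [x] formality is automatic, and the characters of [js1] are nontrivial on [H], hence on the
   stabilizer; so exactness of the product descends to the unit cochain, which is absurd in degree
   0. *)
have : exactc dd act_s Q (stab aW x) one.
  apply: (@eulers_injective _ _ dd act_s Q (stab aW x) dd0 d_act actD (small_d _) _
    (all_twisted _ _) (stab_subgrp aW x) _ _ F chi js1) => //.
  - move=> k s g /stabP gx [_ -> sx]; exists [set x] => // t.
    by rewrite /= (sx t) gx.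
  - by move=> k c; exact: (slice_formal aE_cont aW_cont Hc_cont Hc0 Hc1).
  - move=> j /js1P[jg jH]; split; [exact: F_twisted|by case: jg|].
    case: jg => _ _ _ /(_ jH)[h hH h1] _; exists h => //.
    exact: (fintype.subsetP (YH _ Yx)).
  - apply: exactc_ext vQ => s [_ -> sx]; apply: v_in.
    by rewrite (sx _); exact: YU.
move=> /= one_exact.
pose pt : S 0 := mkcont (@cst_continuous (simplex R 0) X (x0, x)).
have : one pt = 0 by apply: one_exact; exists [set x].
by move=> /eqP.
Qed.
End FixedPoint.

(** * Strict derivatives and the inverse function theorem *)

Section StrictDerivative.
Variable R : realType.

(** The strict derivative: the estimate for pairs of points near [x] yields local injectivity and
    openness from information at [x] alone. *)
Definition sdiff m n (f : 'rV[R]_m -> 'rV[R]_n) (x : 'rV[R]_m) (A : 'M[R]_(m, n)) :=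
  forall e : R, 0 < e -> exists2 d : R, 0 < d & forall a b : 'rV[R]_m,
    `|a - x| < d -> `|b - x| < d -> `|f b - f a - (b - a) *m A| <= e * `|b - a|.

Lemma is_derive_line m n (f : 'rV[R]_m -> 'rV[R]_n) (c v : 'rV[R]_m) (s : R) j :
  derivable f (c + s *: v) v ->
  is_derive s 1 (fun s : R => f (c + s *: v) ord0 j)
    (('D_v f (c + s *: v)) ord0 j).
Proof.
move=> fd; pose F (h : R) := h^-1 *: ((f \o shift (c + s *: v)) (h *: v) - f (c + s *: v)).
have Fc : F h @[h --> 0^'] --> 'D_v f (c + s *: v) by exact: fd.
have Fjc : F h ord0 j @[h --> 0^'] --> ('D_v f (c + s *: v)) ord0 j.
  exact: (cvg_comp _ _ Fc (@coord_continuous R 1 n ord0 j _)).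
pose phi (s : R) := f (c + s *: v) ord0 j.
have H : (h^-1 *: ((phi \o shift s) (h *: 1) - phi s)) @[h --> 0^'] -->
    ('D_v f (c + s *: v)) ord0 j.
  apply: cvg_trans Fjc; apply: near_eq_cvg; near=> h.
  rewrite /F /phi /= !mxE; congr (_ * (_ - _)); congr (f _ _ _).
  by rewrite addrCA -scalerDl [h *: 1](mulr1 h).
apply: DeriveDef; first exact: (cvgP _ H).
exact: (cvg_lim _ H).
Unshelve. all: by end_near. Qed.

Lemma MVT_any (f df : R -> R) (t : R) :
  (forall x : R, `|x| <= `|t| -> is_derive x 1 f (df x)) ->
  exists2 c : R, `|c| <= `|t| & f t - f 0 = df c * t.
Proof.
move=> fd; have cont a b : (forall x : R, x \in `[a, b] -> `|x| <= `|t|) ->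
    {within `[a, b], continuous f}.
  move=> ab; apply: derivable_within_continuous => x /ab /fd.
  by move=> [].
have [t0|t0] := leP 0 t.
  have inT x : x \in `[0, t] -> `|x| <= `|t|.
    by rewrite in_itv /= => /andP[x0 xt]; rewrite !ger0_norm// (le_trans x0).
  have [|c ct ->] := @MVT_segment R f df 0 t t0 _ (cont _ _ inT).
    by move=> x /subset_itv_oo_cc /inT; exact: fd.
  by exists c; rewrite ?subr0//; exact: inT.
have inT x : x \in `[t, 0] -> `|x| <= `|t|.
  by rewrite in_itv /= => /andP[x0 xt]; rewrite !ler0_norm ?lerN2// ltW.
have [|c ct E] := @MVT_segment R f df t 0 (ltW t0) _ (cont _ _ inT).
  by move=> x /subset_itv_oo_cc /inT; exact: fd.
exists c; first exact: inT.
by rewrite -opprB E sub0r mulrN opprK.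
Qed.

(** Move from [a] to [b] one coordinate at a time and apply the mean value theorem to each
    component; the partial derivatives are continuous at [x]. *)
Lemma C1_sdiff m n (U : set 'rV[R]_m) (f : 'rV[R]_m -> 'rV[R]_n) x :
  open U -> U x -> Ck 1 U f -> exists A, sdiff f x A.
Proof.
move=> oU Ux fC; pose e_ i : 'rV[R]_m := delta_mx ord0 i.
pose A : 'M[R]_(m, n) := \matrix_i ('D_(e_ i) f x).
exists A => e e0; pose e' := e / m.+1%:R.
have e'0 : 0 < e' by rewrite divr_gt0.
have nearU : \forall y \near x, U y /\
    forall i, `|'D_(e_ i) f x - 'D_(e_ i) f y| < e'.
  apply: filterI; first by apply: open_nbhs_nbhs; split.
  apply: (@filter_forall _ _ _ (nbhs x) (nbhs_filter x)) => i.
  have [_ /(_ x (mem_set Ux)) Dc] := fC (e_ i).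
  by move/cvgrPdist_lt : Dc => /(_ _ e'0).
have [d d0 dU] := (nbhs_ballP _ _).1 nearU.
have {}dU y : `|y - x| < d -> U y /\ forall i, `|'D_(e_ i) f x - 'D_(e_ i) f y| < e'.
  by move=> yx; apply: dU; rewrite -ball_normE /= distrC.
(* One third is for the corner [c i], two thirds for the step along an axis, which is at most |a -
   x| + |b - x|. *)
exists (d / 3) => [|a b ax bx]; first by rewrite divr_gt0.
pose c (k : nat) : 'rV[R]_m := \row_j (if (j < k)%N then b ord0 j else a ord0 j).
have c0 : c 0%N = a by apply/rowP => j; rewrite mxE.
have cm : c m = b by apply/rowP => j; rewrite mxE ltn_ord.
have cS (i : 'I_m) : c i.+1 = c i + (b - a) ord0 i *: e_ i.
  apply/rowP => j; rewrite !mxE ltnS leq_eqVlt.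
  have [->|ij] := eqVneq j i; first by rewrite eqxx ltnn /= mulr1 addrCA subrr addr0.
  have -> : (j == i :> nat) = false by exact: negPf ij.
  by rewrite andbF mulr0 addr0.
have c_ball k : `|c k - x| < d / 3.
  apply: (@le_lt_trans _ _ (Num.max `|a - x| `|b - x|)); last by rewrite gt_max ax bx.
  apply: rV_norm_le => [|j]; first by rewrite le_max normr_ge0.
  rewrite !mxE le_max; case: ifP => _; apply/orP; [right|left].
    by have := rV_coord_le_norm (b - x) j; rewrite !mxE.
  by have := rV_coord_le_norm (a - x) j; rewrite !mxE.
have e_norm i : `|e_ i| <= 1.
  by apply: rV_norm_le => // j; rewrite mxE; case: (_ && _); rewrite ?normr1 ?normr0.
have in_ball (i : 'I_m) s : `|s| <= `|(b - a) ord0 i| -> `|c i + s *: e_ i - x| < d.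
  move=> sba; rewrite addrAC; apply: le_lt_trans (ler_normD _ _) _.
  have : `|s *: e_ i| <= `|a - x| + `|b - x|.
    rewrite normrZ; apply: (@le_trans _ _ `|s|); first by rewrite ler_piMr.
    apply: (le_trans sba); apply: (le_trans (rV_coord_le_norm _ _)).
    by rewrite -(subrKA x) addrC (le_trans (ler_normD _ _))// [`|x - a|]distrC.
  have := c_ball i; move: ax bx; lra.
have step (i : 'I_m) j : `|(f (c i.+1) - f (c i)) ord0 j - (b - a) ord0 i * A i j|
    <= e' * `|b - a|.
  pose phi (s : R) := f (c i + s *: e_ i) ord0 j.
  have [s sP phiE] := @MVT_any phi (fun s => ('D_(e_ i) f (c i + s *: e_ i)) ord0 j)
    ((b - a) ord0 i) (fun s sP => is_derive_line j
      ((fC (e_ i)).1 _ (dU _ (in_ball i s sP)).1)).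
  have -> : (f (c i.+1) - f (c i)) ord0 j = phi ((b - a) ord0 i) - phi 0.
    by rewrite /phi -cS scale0r addr0 !mxE.
  rewrite phiE [X in _ - X]mulrC -mulrBl normrM mxE.
  apply: ler_pM => //; last exact: rV_coord_le_norm.
  have := (dU _ (in_ball i s sP)).2 i; rewrite distrC => /ltW; apply: le_trans.
  by have := rV_coord_le_norm ('D_(e_ i) f (c i + s *: e_ i) - 'D_(e_ i) f x) j; rewrite !mxE.
apply: rV_norm_le => [|j]; first by rewrite mulr_ge0// ltW.
have -> : (f b - f a - (b - a) *m A) ord0 j =
    \sum_(i < m) ((f (c i.+1) - f (c i)) ord0 j - (b - a) ord0 i * A i j).
  rewrite sumrB !mxE; congr (_ - _).
  rewrite -{1}cm -c0 -(telescope_sumr (fun k => f (c k) ord0 j) (leq0n m)) big_mkord.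
  by apply: eq_bigr => i _; rewrite !mxE.
apply: (le_trans (ler_norm_sum _ _ _)).
apply: (@le_trans _ _ (\sum_(i < m) e' * `|b - a|)).
  by apply: ler_sum => i _; exact: step.
rewrite sumr_const card_ord -mulr_natl mulrA ler_wpM2r// /e' mulrCA ger_pMr//.
by rewrite ler_pdivrMr ?ltr0n// mul1r ler_nat.
Qed.
End StrictDerivative.

Section InverseFunction.
Variable R : realType.

Lemma mulmx_bound m n (A : 'M[R]_(m, n)) : exists2 K : R, 0 < K &
  forall v : 'rV[R]_m, `|v *m A| <= K * `|v|.
Proof.
pose K : R := 1 + \sum_i \sum_j `|A i j|.
have K0 : 0 < K by rewrite ltr_pwDl// !sumr_ge0// => i _; rewrite sumr_ge0.
exists K => // v; apply: rV_norm_le => [|j]; first by rewrite mulr_ge0// ltW.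
rewrite mxE; apply: (le_trans (ler_norm_sum _ _ _)).
rewrite mulrC; apply: (@le_trans _ _ (`|v| * \sum_i \sum_j `|A i j|)); last first.
  by rewrite ler_wpM2l// lerDr.
rewrite mulr_sumr; apply: ler_sum => i _; rewrite normrM.
rewrite ler_pM ?rV_coord_le_norm// (bigD1 j)//= lerDl.
exact: sumr_ge0.
Qed.

Lemma sdiff_lipschitz m n (f : 'rV[R]_m -> 'rV[R]_n) x A : sdiff f x A ->
  exists K d : R, [/\ 0 < K, 0 < d & forall a b : 'rV[R]_m,
    `|a - x| < d -> `|b - x| < d -> `|f b - f a| <= K * `|b - a|].
Proof.
move=> fA; have [K K0 KA] := mulmx_bound A; have [d d0 dP] := fA 1 ltr01.
exists (K + 1), d; split => //; first by rewrite addr_gt0.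
move=> a b ax bx; rewrite -(subrK ((b - a) *m A) (f b - f a)).
rewrite (le_trans (ler_normD _ _))// addrC mulrDl lerD//.
exact: dP.
Qed.

Lemma sdiff_unique m n (f : 'rV[R]_m -> 'rV[R]_n) x A B :
  sdiff f x A -> sdiff f x B -> A = B.
Proof.
move=> fA fB; apply/row_matrixP => i; apply/eqP; rewrite -subr_eq0 -normr_le0.
apply/ler_addgt0Pr => e e0; rewrite add0r.
have e2 : 0 < e / 2 by rewrite divr_gt0.
have [d d0 dA] := fA _ e2; have [d' d'0 dB] := fB _ e2.
pose t := Num.min d d' / 2.
have t0 : 0 < t by rewrite divr_gt0// lt_min d0.
pose u : 'rV[R]_m := delta_mx ord0 i.
have u1 : `|u| <= 1.
  by apply: rV_norm_le => // j; rewrite mxE; case: (_ && _); rewrite ?normr1 ?normr0.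
have tu : `|t *: u| <= t by rewrite normrZ (gtr0_norm t0) ler_piMr// ltW.
have tm : t < Num.min d d' by rewrite ltr_pdivrMr// ltr_pMr ?ltr1n// lt_min d0.
have yE : x + t *: u - x = t *: u by rewrite addrC addKr.
have xb : `|x + t *: u - x| < d by rewrite yE (le_lt_trans tu)// (lt_le_trans tm)// ge_min lexx.
have xb' : `|x + t *: u - x| < d' by rewrite yE (le_lt_trans tu)// (lt_le_trans tm)// ge_min lexx orbT.
have xx : `|x - x| < d by rewrite subrr normr0.
have xx' : `|x - x| < d' by rewrite subrr normr0.
have := dA _ _ xx xb; have := dB _ _ xx' xb'.
rewrite yE; set w := f _ - f _ => H1 H2.
have H : `|t *: (row i A - row i B)| <= e * t.
  have -> : t *: (row i A - row i B) =
      (w - (t *: u) *m B) - (w - (t *: u) *m A).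
    by rewrite -!scalemxAl -!rowE opprB [w - _]addrC -addrA (addrCA w) subrr
      addr0 addrC -scalerBr.
  rewrite (le_trans (ler_normB _ _))// [e]splitr mulrDl lerD//.
    by rewrite (le_trans H1)// ler_wpM2l// ltW.
  by rewrite (le_trans H2)// ler_wpM2l// ltW.
by move: H; rewrite normrZ (gtr0_norm t0) mulrC ler_pM2r.
Qed.

Lemma sdiff_comp m n p (f : 'rV[R]_m -> 'rV[R]_n) (g : 'rV[R]_n -> 'rV[R]_p) x A B :
  sdiff f x A -> sdiff g (f x) B -> sdiff (g \o f) x (A *m B).
Proof.
move=> fA gB e e0; have [K [dK [K0 dK0 fK]]] := sdiff_lipschitz fA.
have [L L0 LB] := mulmx_bound B.
have eK : 0 < e / 2 / K by rewrite !divr_gt0.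
have eL : 0 < e / 2 / L by rewrite !divr_gt0.
have [d1 d10 fd1] := fA _ eL; have [d2 d20 gd2] := gB _ eK.
pose d := Num.min (Num.min dK d1) (d2 / K).
have d0 : 0 < d by rewrite !lt_min dK0 d10 divr_gt0.
exists d => // a b; rewrite !lt_min => /andP[/andP[aK a1] a2] /andP[/andP[bK b1] b2].
have xK : `|x - x| < dK by rewrite subrr normr0.
have fclose y : `|y - x| < dK -> `|y - x| < d2 / K -> `|f y - f x| < d2.
  move=> yK y2; apply: le_lt_trans (fK _ _ xK yK) _.
  by rewrite mulrC -ltr_pdivlMr.
have H1 := gd2 _ _ (fclose _ aK a2) (fclose _ bK b2).
have H2 := fd1 _ _ a1 b1.
have -> : (g \o f) b - (g \o f) a - (b - a) *m (A *m B) =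
    (g (f b) - g (f a) - (f b - f a) *m B) + (f b - f a - (b - a) *m A) *m B.
  by rewrite mulmxA [in RHS](mulmxBl (f b - f a)) addrA subrK.
rewrite (le_trans (ler_normD _ _))// [e]splitr mulrDl lerD//.
  rewrite (le_trans H1)// mulrAC ler_pdivrMr// -[leRHS]mulrA.
  rewrite ler_wpM2l ?divr_ge0 ?(ltW e0)// mulrC; exact: fK.
rewrite (le_trans (LB _))// mulrC -ler_pdivlMr// (le_trans H2)//.
by rewrite mulrAC.
Qed.

Lemma sdiff_linear m n (A : 'M[R]_(m, n)) c x : sdiff (fun v => (v - c) *m A) x A.
Proof.
move=> e e0; exists 1 => // a b _ _.
by rewrite -mulmxBl opprB addrA subrK -mulmxBl subrr mul0mx normr0 mulr_ge0// ltW.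
Qed.

Lemma sdiff_id m x : sdiff (id : 'rV[R]_m -> 'rV[R]_m) x 1%:M.
Proof.
by move=> e e0; exists 1 => // a b _ _; rewrite mulmx1 subrr normr0 mulr_ge0// ltW.
Qed.

Lemma sdiff_near m n (f g : 'rV[R]_m -> 'rV[R]_n) x A :
  (\forall y \near x, f y = g y) -> sdiff f x A -> sdiff g x A.
Proof.
move=> /nbhs_ballP[r /= r0 fg] fA e e0; have [d d0 dA] := fA e e0.
exists (Num.min d r) => [|a b]; first by rewrite lt_min d0.
rewrite !lt_min => /andP[ad ar] /andP[bd br].
rewrite -!fg; first exact: dA.
  by rewrite -ball_normE /= distrC.
by rewrite -ball_normE /= distrC.
Qed.

Lemma sdiff_sum m n (I : finType) (P : pred I) (f : I -> 'rV[R]_m -> 'rV[R]_n) x A :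
  (forall i, P i -> sdiff (f i) x (A i)) ->
  sdiff (fun v => \sum_(i | P i) f i v) x (\sum_(i | P i) A i).
Proof.
move=> fA e e0; pose N := #|I|.+1; have eN : 0 < e / N%:R by rewrite divr_gt0.
have exd i : exists d : R, 0 < d /\ (P i -> forall a b : 'rV[R]_m,
    `|a - x| < d -> `|b - x| < d ->
    `|f i b - f i a - (b - a) *m A i| <= e / N%:R * `|b - a|).
  have [Pi|] := boolP (P i); last by exists 1.
  by have [d d0 H] := fA i Pi _ eN; exists d.
have [d dP] := choice exd.
exists (\big[Num.min/1]_i d i).
  by apply/bigmin_gtP; split => // i _; exact: (dP i).1.
move=> a b /bigmin_gtP[_ ad] /bigmin_gtP[_ bd].
have -> : \sum_(i | P i) f i b - \sum_(i | P i) f i a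
    - (b - a) *m \sum_(i | P i) A i =
    \sum_(i | P i) (f i b - f i a - (b - a) *m A i).
  by rewrite mulmx_sumr -!sumrB.
rewrite (le_trans (ler_norm_sum _ _ _))//.
apply: (@le_trans _ _ (\sum_(i | P i) e / N%:R * `|b - a|)).
  by apply: ler_sum => i Pi; apply: (dP i).2 => //; [exact: ad|exact: bd].
rewrite sumr_const -[leLHS]mulr_natl mulrA ler_wpM2r// mulrCA ger_pMr//.
by rewrite ler_pdivrMr ?ltr0n// mul1r ler_nat (leq_trans (max_card _)).
Qed.

(* Values near [f a] are attained: a minimizer [m] of the distance to [y] on a
   closed ball is improved by the Newton step [m + c^-1 (y - f m)] unless
   [f m = y]. *)
Lemma sdiff_scalar_local_homeo n (f : 'rV[R]_n -> 'rV[R]_n) x c : 0 < c ->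
  sdiff f x c%:M -> exists2 d : R, 0 < d &
    [/\ forall a b, ball x d a -> ball x d b -> f a = f b -> a = b,
      forall a, ball x d a -> {for a, continuous f} &
      forall O, open O -> O `<=` ball x d -> open (f @` O)].
Proof.
move=> c0 fA; have c4 : 0 < c / 4 by rewrite divr_gt0.
have [d d0 dP] := fA _ c4; exists d => //.
have {}dP a b : ball x d a -> ball x d b ->
    `|f b - f a - c *: (b - a)| <= c / 4 * `|b - a|.
  rewrite -ball_normE /= ![`|x - _|]distrC => ad bd; rewrite -mul_mx_scalar.
  exact: dP.
have lower a b : ball x d a -> ball x d b -> c / 4 * 3 * `|b - a| <= `|f b - f a|.
  move=> ad bd; have := dP _ _ ad bd.
  have : `|c *: (b - a)| <= `|f b - f a| + `|f b - f a - c *: (b - a)|.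
    rewrite -[X in `|X| <= _](subKr (f b - f a)).
    exact: ler_normB.
  by rewrite normrZ (gtr0_norm c0); lra.
have upper a b : ball x d a -> ball x d b -> `|f b - f a| <= c * 2 * `|b - a|.
  move=> ad bd; have := dP _ _ ad bd.
  have : `|f b - f a| <= `|f b - f a - c *: (b - a)| + `|c *: (b - a)|.
    by rewrite -[X in `|X| <= _](subrK (c *: (b - a))); exact: ler_normD.
  have := normr_ge0 (b - a); have := mulr_ge0 (ltW c0) (normr_ge0 (b - a)).
  by rewrite normrZ (gtr0_norm c0); lra.
have fcont a : ball x d a -> {for a, continuous f}.
  move=> ad; apply: (proj2 (@cvgrPdist_lt _ _ _ (nbhs a) (nbhs_filter a) f (f a))) => e e0.
  have e' : 0 < e / (c * 2) by rewrite divr_gt0// mulr_gt0.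
  have : nbhs a (ball x d `&` ball a (e / (c * 2))).
    apply: (@filterI _ (nbhs a) (nbhs_filter a)); last exact: nbhsx_ballx.
    by apply: open_nbhs_nbhs; split => //; exact: ball_open.
  apply: (@filterS _ (nbhs a) (nbhs_filter a)) => b [bd].
  rewrite -ball_normE /= ltr_pdivlMr ?mulr_gt0// mulrC; apply: le_lt_trans.
  exact: upper.
split => //.
  move=> a b ad bd E; apply/eqP; rewrite eq_sym -subr_eq0 -normr_le0.
  have := lower _ _ ad bd; rewrite E subrr normr0.
  by rewrite pmulr_rle0// mulr_gt0.
move=> O oO Od; rewrite openE => _ [a Oa <-].
have [r r0 rO] : exists2 r : R, 0 < r & closed_ball a r `<=` O.
  have /nbhs_closedballP[r rO] : nbhs a O by apply: open_nbhs_nbhs; split.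
  by exists r%:num.
(* Small enough for the Newton step to stay in the ball even from its boundary: c|a - z| is at most
   11/3 |y - f a|. *)
have r8 : 0 < c * r / 4 by rewrite divr_gt0// mulr_gt0.
apply/nbhs_ballP; exists (c * r / 4) => //= y; rewrite -ball_normE /= => yr.
pose K := closed_ball a r.
have KE z : K z <-> `|a - z| <= r by rewrite /K closed_ballE.
have Kd z : K z -> ball x d z by move=> /rO /Od.
have Ka : K a by apply/KE; rewrite subrr normr0 ltW.
have Kc : compact K.
  apply: bounded_closed_compact; last exact: closed_ball_closed.
  exists (`|a| + r); split; first exact: num_real.
  move=> M aM z /KE zr; apply: le_trans (ltW aM).
  rewrite -(subKr a z) (le_trans (ler_normB _ _))// lerD2l //.
have [m Km mmin] : exists2 m, K m & forall z, K z -> `|y - f m| <= `|y - f z|.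
  have [||m Km mmin] := @EVT_min_rV R n (fun z => `|y - f z|) K _ Kc _.
  - by exists a.
  - apply: continuous_in_subspaceT => z /set_mem /Kd zd.
    apply: (@continuous_comp _ _ _ (fun z => y - f z) (fun v => `|v|)).
      by apply: (@continuousB _ _ _ (fun=> y) f z); [exact: cst_continuous|exact: fcont].
    exact: norm_continuous.
  by exists m; [exact: set_mem|move=> z Kz; apply: mmin; exact: mem_set].
exists m; first exact: rO.
apply/eqP; rewrite eq_sym -subr_eq0 -normr_le0 leNgt; apply/negP => ym.
pose z := m + c^-1 *: (y - f m).
have zm : z - m = c^-1 *: (y - f m) by rewrite /z addrC addKr.
have nzm : c * `|z - m| = `|y - f m|.
  by rewrite zm normrZ gtr0_norm ?invr_gt0// mulrA mulfV ?gt_eqF// mul1r.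
have ya : `|y - f m| <= `|y - f a| by exact: mmin.
have Kz : K z.
  apply/KE; have := lower _ _ (Kd _ Ka) (Kd _ Km).
  have : `|f m - f a| <= `|y - f a| + `|y - f m|.
    by rewrite -(subrKA y) addrC [`|y - f m|]distrC ler_normD.
  have : c * `|a - z| <= c * `|m - a| + c * `|z - m|.
    rewrite -mulrDr ler_pM2l// [`|m - a|]distrC [`|z - m|]distrC.
    by rewrite -{1}(subrKA m) ler_normD.
  rewrite nzm -[`|a - z| <= r](ler_pM2l c0).
  move: yr ya; rewrite [`|f a - y|]distrC; lra.
have := dP _ _ (Kd _ Km) (Kd _ Kz).
have -> : f z - f m - c *: (z - m) = - (y - f z).
  by rewrite zm scalerA mulfV ?gt_eqF// scale1r opprB addrA subrK opprB.
rewrite normrN; have := mmin _ Kz; have : c / 4 * `|z - m| = `|y - f m| / 4.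
  by rewrite mulrAC nzm.
lra.
Qed.
End InverseFunction.

(** * Linearization of the action *)

Section LinearCharts.
Variables (R : realType) (n : nat) (W : topologicalType).

Definition embedding (B : set W) (f : W -> 'rV[R]_n) :=
  [/\ open B, forall w, B w -> {for w, continuous f},
    forall v w, B v -> B w -> f v = f w -> v = w &
    forall O, open O -> O `<=` B -> open (f @` O)].

Lemma embedding_preimage (B : set W) f C : embedding B f -> open C ->
  open (B `&` f @^-1` C).
Proof.
move=> [oB fc _ _] oC; rewrite openE => w [Bw Cw]; apply: filterI.
  by apply: open_nbhs_nbhs; split.
by apply: (fc w Bw); apply: open_nbhs_nbhs; split.
Qed.

Lemma chart_embedding (c : chart R n W) : embedding (chart_dom c) (chart_map c).
Proof.
have oD := chart_dom_open c; have oI := @chart_img_open _ _ _ c.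
split => //.
- move=> w Dw; have := @chart_map_continuous _ _ _ c.
  by rewrite continuous_open_subspace// => /(_ w (mem_set Dw)).
- move=> v w Dv Dw E.
  by rewrite -[v](chart_mapK (mem_set Dv)) E (chart_mapK (mem_set Dw)).
- move=> O oO OD; have -> : chart_map c @` O =
      chart_map c @` chart_dom c `&` chart_inv c @^-1` O.
    apply/seteqP; split => [_ [w Ow <-]|_ [[w Dw <-]]].
      split; first by exists w => //; exact: OD.
      by rewrite /= (chart_mapK (mem_set (OD _ Ow))).
    by rewrite /= (chart_mapK (mem_set Dw)) => Ow; exists w.
  have := @chart_inv_continuous _ _ _ c; rewrite continuous_open_subspace// => ic.
  rewrite openE => x [Ix Ox]; apply: filterI.
    by apply: open_nbhs_nbhs; split.
  by apply: (ic x (mem_set Ix)); apply: open_nbhs_nbhs; split.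
Qed.

Variables (A : smooth_atlas R n W) (a : Z2_action n W).
Hypothesis a_smooth : smooth_action A a.

Lemma smooth_continuous : continuous_action a.
Proof. by move=> g; have [] := a_smooth g. Qed.

Lemma invariant_nbhd (K : {set Z2 n}) (U : set W) : open U ->
  open [set w | forall g, g \in K -> U (a w g)].
Proof.
move=> oU; rewrite openE => w Uw.
apply: (@filter_forall _ _ _ (nbhs w) (nbhs_filter w)) => g.
have [gK|gK] := boolP (g \in K); last by apply: nearW.
have : nbhs w [set v | U (a v g)].
  apply: open_nbhs_nbhs; split; last exact: Uw.
  exact: (open_act smooth_continuous).
by apply: (@filterS _ (nbhs w) (nbhs_filter w)).
Qed.

(* Averaging: [Phi] is the sum over the stabilizer of [D_g (g x - p)]; it is
   equivariant, and its derivative is scalar because the [D_g] are involutions. *)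
Lemma linear_chart y : exists (U : set W) (th : W -> 'rV[R]_n) (M : Z2 n -> 'M[R]_n),
  [/\ embedding U th, U y, th y = 0,
    forall w g, U w -> g \in stab a y -> U (a w g) &
    forall w g, U w -> g \in stab a y -> th (a w g) = th w *m M g].
Proof.
have [c cA Dy] := charts_cover A y.
set D := chart_dom c in Dy; set ka := chart_map c; set io := chart_inv c.
have kaK w : D w -> io (ka w) = w by move=> Dw; exact: (chart_mapK (mem_set Dw)).
have kaE : embedding D ka := chart_embedding c.
have [oD kac kai kao] := kaE.
pose p := ka y; pose F g x := ka (a (io x) g).
pose Ug g := D `&` [set w | D (a w g)].
have oUg g : open (ka @` Ug g).
  apply: kao; last by move=> w [].
  by apply: openI => //; exact: (open_act smooth_continuous).
have Ugy g : g \in stab a y -> (ka @` Ug g) p.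
  by move=> /stabP gy; exists y => //; split; rewrite //= gy.
have F_ex g : exists M, g \in stab a y -> sdiff (F g) p M.
  have [gy|gy] := boolP (g \in stab a y); last by exists 0.
  have [_ /(_ c c cA cA 1%N)] := a_smooth g.
  by move=> /(C1_sdiff (oUg g) (Ugy g gy))[M FM]; exists M.
have [M FM] := choice F_ex.
have Fp g : g \in stab a y -> F g p = p.
  by move=> /stabP gy; rewrite /F kaK// gy.
have K0 : 0 \in stab a y := (stab_subgrp a y).1.
have M0 : M 0 = 1%:M.
  apply: (sdiff_unique (FM 0 K0)); apply: (@sdiff_near R _ _ id); last exact: sdiff_id.
  have : nbhs p (ka @` D).
    by apply: open_nbhs_nbhs; split; [exact: kao|exists y].
  apply: (@filterS _ (nbhs p) (nbhs_filter p)) => _ [w Dw <-].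
  by rewrite /F kaK// Z2_act0.
have MD g h : g \in stab a y -> h \in stab a y -> M (g + h) = M g *m M h.
  move=> gy hy; have ghy := (stab_subgrp a y).2 _ _ gy hy.
  apply: (sdiff_unique (FM _ ghy)); apply: (@sdiff_near R _ _ (F h \o F g)).
    have : nbhs p (ka @` Ug g) by apply: open_nbhs_nbhs; split; [exact: oUg|exact: Ugy].
    apply: (@filterS _ (nbhs p) (nbhs_filter p)) => _ [w [Dw Dwg] <-].
    by rewrite /F /= !kaK// Z2_actD.
  by apply: sdiff_comp; [exact: FM|rewrite Fp//; exact: FM].
pose Phi x := \sum_(g in stab a y) (F g x - p) *m M g.
have PhiD : sdiff Phi p (#|stab a y|%:R%:M).
  have -> : (#|stab a y|%:R%:M : 'M[R]_n) = \sum_(g in stab a y) M g *m M g.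
    rewrite (eq_bigr (fun=> 1%:M)); last by move=> g gy; rewrite -MD// Z2_addrr.
    by rewrite sumr_const -raddfMn.
  apply: sdiff_sum => g gy.
  exact: (sdiff_comp (FM g gy) (@sdiff_linear R n n (M g) p (F g p))).
have K_gt0 : (0 : R) < #|stab a y|%:R.
  by rewrite ltr0n; apply/card_gt0P; exists 0.
have [d d0 [Phi_inj Phi_cont Phi_open]] := sdiff_scalar_local_homeo K_gt0 PhiD.
pose U0 := D `&` ka @^-1` ball p d.
have oU0 : open U0 by apply: embedding_preimage => //; exact: ball_open.
pose U := [set w | forall g, g \in stab a y -> U0 (a w g)].
have UU0 w : U w -> U0 w by move=> /(_ 0 K0); rewrite Z2_act0.
exists U, (Phi \o ka), M; split.
- split.
  + exact: invariant_nbhd.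
  + move=> w /UU0[Dw pw]; apply: (@continuous_comp _ _ _ ka Phi w).
      exact: kac.
    exact: Phi_cont.
  + move=> v w /UU0[Dv pv] /UU0[Dw pw] E; apply: kai => //.
    exact: Phi_inj.
  + move=> O oO OU; rewrite -image_comp; apply: Phi_open.
      by apply: kao => // w /OU /UU0[].
    by move=> _ [w /OU /UU0[_ pw] <-].
- by move=> g /stabP ->; split => //; exact: ballxx.
- rewrite /= /Phi big1// => g gy; rewrite -/p Fp// subrr mul0mx //.
- move=> w g Uw gy h hy; rewrite -Z2_actD; apply: Uw.
  exact: (stab_subgrp a y).2.
- move=> w h Uw hy /=; have [Dw _] := UU0 _ Uw.
  have [Dwh _] := Uw _ hy.
  have hg g : h + (h + g) = g by rewrite addrA Z2_addrr add0r.
  have stabD := (stab_subgrp a y).2.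
  rewrite /Phi mulmx_suml [in RHS](reindex_inj (addrI h)) /=.
  apply: eq_big => [g|g gy].
    by apply/idP/idP => gy; [exact: stabD|rewrite -(hg g); exact: stabD].
  rewrite -mulmxA -MD//; last exact: stabD.
  by rewrite (addrC (h + g)) hg /F !kaK// Z2_actD.
Qed.
End LinearCharts.

(** * Locally linear points and their standard neighborhoods *)

Section LocalStandardness.
Variables (R : realType) (n : nat) (W : topologicalType) (a : Z2_action n W).
Hypothesis a_cont : continuous_action a.

Lemma embedding_inverse (B : set W) (f : W -> 'rV[R]_n) (b0 : W) : embedding B f ->
  exists g : 'rV[R]_n -> W, [/\ forall w, B w -> g (f w) = w,
    forall v, (f @` B) v -> B (g v) /\ f (g v) = v &
    forall v, (f @` B) v -> {for v, continuous g}].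
Proof.
move=> [oB fc fi fo].
have inv v : exists w, (f @` B) v -> B w /\ f w = v.
  have [[w Bw <-]|nv] := pselect ((f @` B) v); first by exists w.
  by exists b0.
have [g gP] := choice inv.
have gK w : B w -> g (f w) = w.
  by move=> Bw; have [Bg E] := gP (f w) (imageP _ Bw); exact: fi.
exists g; split => // v fBv.
have [Bg gv] := gP _ fBv.
move=> N; rewrite /= nbhsE => -[ C [oC Cg] CN].
have : nbhs v (f @` (B `&` C)).
  apply: open_nbhs_nbhs; split; first by apply: fo; [exact: openI|move=> w []].
  by exists (g v).
apply: (@filterS _ (nbhs v) (nbhs_filter v)) => _ [w [Bw Cw] <-] /=.
by rewrite gK//; exact: CN.
Qed.

Lemma mulmxr_continuous m (M : 'M[R]_(m, n)) : continuous (fun v : 'rV[R]_m => v *m M).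
Proof.
move=> v; apply: (proj2 (@cvgrPdist_lt _ _ _ (nbhs v) (nbhs_filter v) _ _)) => e e0.
have [K K0 KM] := mulmx_bound M; have eK : 0 < e / K by rewrite divr_gt0.
apply: (@filterS _ (nbhs v) (nbhs_filter v) _ _ _ (nbhsx_ballx v _ eK)) => w.
rewrite -ball_normE /= ltr_pdivlMr// => vw.
by rewrite -mulmxBl (le_lt_trans (KM _))// mulrC.
Qed.

(* Unlike local standardness, this does not ask for an invariant neighborhood, so
   that it is visibly an open condition that can be transported by local
   homeomorphisms commuting with the stabilizers. *)
Definition locally_linear z := exists (B : set W) (th : W -> 'rV[R]_n)
    (rho : Z2 n -> 'M[R]_n),
  [/\ embedding B th /\ B z, rho 0 = 1%:M,
    forall g h, rho (g + h) = rho g *m rho h,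
    forall g, rho g = 1%:M -> g = 0 &
    forall v w g, B v -> B w -> (w = a v g <-> th w = th v *m rho g)].

Lemma locally_linear_open : open [set z | locally_linear z].
Proof.
rewrite openE => z [B [th [rho [[thE Bz] rho0 rhoD rhof rhoP]]]].
have oB : open B by case: thE.
have : nbhs z B by apply: open_nbhs_nbhs; split.
apply: (@filterS _ (nbhs z) (nbhs_filter z)) => w Bw.
by exists B, th, rho.
Qed.

Lemma locally_linear_act z g : locally_linear z -> locally_linear (a z g).
Proof.
move=> [B [th [rho [[thE Bz] rho0 rhoD rhof rhoP]]]].
have [oB fc fi fo] := thE.
exists [set w | B (a w g)], (fun w => th (a w g)), rho; split => //.
- split; last by rewrite /= Z2_actK.
  split; first exact: open_act.
  + move=> w Bw; apply: (@continuous_comp _ _ _ (fun w => a w g) th w).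
      exact: a_cont.
    exact: fc.
  + move=> v w Bv Bw /(fi _ _ Bv Bw) /(congr1 (fun v => a v g)).
    by rewrite !Z2_actK.
  + move=> O oO OB.
    have -> : (fun w => th (a w g)) @` O = th @` [set w | O (a w g)].
      apply/seteqP; split => [_ [w Ow <-]|_ [w /= Ow <-]].
        by exists (a w g) => //=; rewrite Z2_actK.
      by exists (a w g) => //; rewrite Z2_actK.
    apply: fo; first exact: open_act.
    by move=> w /= /OB /=; rewrite Z2_actK.
- move=> v w h Bv Bw; rewrite -rhoP//; split => [->|].
    by rewrite -!Z2_actD addrC.
  rewrite -Z2_actD addrC Z2_actD => /(congr1 (fun v => a v g)).
  by rewrite !Z2_actK.
Qed.

(** [U] and [V] are the saturations of [B] and of its image: a point is moved into [B], mapped by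
    [th] and moved back by [rho]. The result does not depend on the element used, by the equivalence
    in [locally_linear]. *)
Lemma locally_linear_standard z : locally_linear z ->
  exists (U : set W) (rho : mx_representation R (setT_group (Z2 n)) n)
      (V : set 'rV[R]_n) (phi : W -> 'rV[R]_n) (psi : 'rV[R]_n -> W),
    [/\ nbhs z U /\ (forall y g, U y -> U (a y g)),
        mx_faithful rho,
        open V /\ (forall v g, V v -> V (v *m rho g)),
        [/\ set_fun U V phi, set_fun V U psi,
            {in U, cancel phi psi} & {in V, cancel psi phi}] /\
        ({within U, continuous phi} /\ {within V, continuous psi})
      & forall y g, U y -> phi (a y g) = phi y *m rho g].
Proof.
move=> [B [th [rho [[thE Bz] rho0 rhoD rhof rhoP]]]].
have [oB thc thi tho] := thE.
have rho2 g : rho g *m rho g = 1%:M by rewrite -rhoD Z2_addrr.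
have rhoK g (v : 'rV[R]_n) : v *m rho g *m rho g = v.
  by rewrite -mulmxA rho2 mulmx1.
have rho_repr : mx_repr (setT_group (Z2 n)) rho.
  by split => [|g h _ _]; [exact: rho0|exact: rhoD].
pose U := [set w | exists g, B (a w g)].
pose V := [set v | exists g, (th @` B) (v *m rho g)].
have [ith [ithK ithP ithc]] := embedding_inverse z thE.
have exg w : exists g, U w -> B (a w g).
  by have [[g Bg]|nU] := pselect (U w); [exists g|exists 0].
have [gw gwP] := choice exg.
have exh v : exists g, V v -> (th @` B) (v *m rho g).
  by have [[g Bg]|nU] := pselect (V v); [exists g|exists 0].
have [gv gvP] := choice exh.
pose phi w := th (a w (gw w)) *m rho (gw w).
pose psi v := a (ith (v *m rho (gv v))) (gv v).
have phiE w g : B (a w g) -> phi w = th (a w g) *m rho g.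
  move=> Bg; have Bw := gwP w (ex_intro _ g Bg).
  have /(rhoP _ _ _ Bg Bw) E : a w (gw w) = a (a w g) (g + gw w).
    by rewrite -Z2_actD addrA Z2_addrr add0r.
  by rewrite /phi E rhoD mulmxA rhoK.
have psiE v g : (th @` B) (v *m rho g) -> psi v = a (ith (v *m rho g)) g.
  move=> Bg; have Bv := gvP v (ex_intro _ g Bg).
  have [Bi iE] := ithP _ Bg; have [Bi' iE'] := ithP _ Bv.
  have : ith (v *m rho (gv v)) = a (ith (v *m rho g)) (g + gv v).
    by apply/(rhoP _ _ _ Bi Bi'); rewrite iE iE' rhoD mulmxA rhoK.
  by move=> E; rewrite /psi E -Z2_actD -addrA Z2_addrr addr0.
have UV w g : B (a w g) -> (th @` B) (phi w *m rho g).
  by move=> Bg; exists (a w g) => //; rewrite (phiE _ _ Bg) rhoK.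
have VU v g : (th @` B) (v *m rho g) -> B (a (psi v) g).
  by move=> Bg; rewrite (psiE _ _ Bg) Z2_actK; case: (ithP _ Bg).
have oVg g : open [set v | (th @` B) (v *m rho g)].
  apply: (@open_comp _ _ (fun v : 'rV[R]_n => v *m rho g)); last exact: tho.
  by move=> v _; exact: mulmxr_continuous.
have oV : open V.
  rewrite openE => v [g Bg].
  have : nbhs v [set v | (th @` B) (v *m rho g)] by apply: open_nbhs_nbhs; split.
  by apply: (@filterS _ (nbhs v) (nbhs_filter v)) => w; exists g.
exists U, (MxRepresentation rho_repr), V, phi, psi; split.
- split.
    have : nbhs z B by apply: open_nbhs_nbhs; split.
    by apply: (@filterS _ (nbhs z) (nbhs_filter z)) => w Bw; exists 0; rewrite Z2_act0.
  by move=> w g [h Bh]; exists (g + h); rewrite -Z2_actD addrA Z2_addrr add0r.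
- apply/fintype.subsetP => g; rewrite !inE /= mul1mx => /eqP /rhof ->.
  exact: eqxx.
- split => // v g [h vh]; exists (g + h).
  by rewrite /= rhoD mulmxA rhoK.
- split; last first.
    split.
      apply: continuous_in_subspaceT => w /set_mem [g Bg].
      have ag : {for w, continuous (fun w => th (a w g) *m rho g)}.
        apply: (@continuous_comp _ _ _ (fun w => th (a w g)) (fun v => v *m rho g)).
          apply: (@continuous_comp _ _ _ (fun w => a w g) th); first exact: a_cont.
          exact: thc.
        exact: mulmxr_continuous.
      have near_phi : \forall v \near w, th (a v g) *m rho g = phi v.
        have : nbhs w [set w | B (a w g)].
          by apply: open_nbhs_nbhs; split => //; exact: open_act.
        by apply: (@filterS _ (nbhs w) (nbhs_filter w)) => v Bv; rewrite (phiE _ _ Bv).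
      rewrite /continuous_at (phiE _ _ Bg).
      exact: (cvg_trans (near_eq_cvg near_phi) ag).
    apply: continuous_in_subspaceT => v /set_mem [g Bg].
    have ag : {for v, continuous (fun v : 'rV[R]_n => a (ith (v *m rho g)) g)}.
      apply: (@continuous_comp _ _ _ (fun v : 'rV[R]_n => ith (v *m rho g)) (fun w => a w g)).
        apply: (@continuous_comp _ _ _ (fun v : 'rV[R]_n => v *m rho g) ith).
          exact: mulmxr_continuous.
        exact: ithc.
      exact: a_cont.
    have near_psi : \forall u \near v, a (ith (u *m rho g)) g = psi u.
      have : nbhs v [set v | (th @` B) (v *m rho g)].
        by apply: open_nbhs_nbhs; split.
      by apply: (@filterS _ (nbhs v) (nbhs_filter v)) => u Bu; rewrite (psiE _ _ Bu).
    rewrite /continuous_at (psiE _ _ Bg).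
    exact: (cvg_trans (near_eq_cvg near_psi) ag).
  split.
  + by move=> w [g Bg]; exists g; exact: UV.
  + by move=> v [g Bg]; exists g; exact: VU.
  + move=> w /set_mem [g Bg].
    by rewrite (psiE _ _ (UV _ _ Bg)) (phiE _ _ Bg) rhoK ithK// Z2_actK.
  + move=> v /set_mem [g Bg].
    by rewrite (phiE _ _ (VU _ _ Bg)) (psiE _ _ Bg) Z2_actK (ithP _ Bg).2 rhoK.
- move=> w h [g Bg] /=; have Bgh : B (a (a w h) (h + g)).
    by rewrite -Z2_actD addrA Z2_addrr add0r.
  rewrite (phiE _ _ Bgh) (phiE _ _ Bg) -Z2_actD addrA Z2_addrr add0r.
  by rewrite addrC rhoD mulmxA.
Qed.
End LocalStandardness.

(** * Effectiveness, and transport of local linearity *)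

Section MainArgument.
Variables (R : realType) (n : nat) (W : topologicalType).
Variables (A : smooth_atlas R n W) (a : Z2_action n W).
Hypothesis a_smooth : smooth_action A a.
Hypothesis W_hausdorff : hausdorff_space W.
Hypothesis W_connected : connected [set: W].
Hypothesis a_eff : effective_action a.

Let a_cont : continuous_action a := smooth_continuous a_smooth.

Lemma open_set_spans (O : set 'rV[R]_n) (M N : 'M[R]_n) v0 : open O -> O v0 ->
  (forall v, O v -> v *m M = v *m N) -> M = N.
Proof.
move=> oO Ov0 MN; apply/row_matrixP => i.
have : nbhs v0 O by apply: open_nbhs_nbhs; split.
move=> /nbhs_ballP[e /= e0 eO]; have e2 : 0 < e / 2 by rewrite divr_gt0.
pose u : 'rV[R]_n := delta_mx ord0 i.
have Ou : O (v0 + (e / 2) *: u).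
  apply: eO; rewrite -ball_normE /= opprD addrA subrr sub0r normrN normrZ gtr0_norm//.
  apply: (@le_lt_trans _ _ (e / 2)); last by rewrite ltr_pdivrMr// ltr_pMr// ltr1n.
  rewrite ler_piMr ?(ltW e2)//; apply: rV_norm_le => // j.
  by rewrite mxE; case: (_ && _); rewrite ?normr1 ?normr0.
have := MN _ Ou; rewrite !mulmxDl (MN _ Ov0) => /addrI.
rewrite -!scalemxAl => /(congr1 (fun v => (e / 2)^-1 *: v)).
by rewrite !scalerA mulVf ?gt_eqF// !scale1r -!rowE.
Qed.

Lemma closed_fixed g : closed [set w | a w g = w].
Proof.
rewrite -openC openE => w /= /eqP gw.
have := W_hausdorff; rewrite open_hausdorff => /(_ _ _ gw).
move=> [[P Q] [/= wP wQ] [oP oQ PQ]].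
have : nbhs w (Q `&` [set v | P (a v g)]).
  apply: open_nbhs_nbhs; split; first by apply: openI => //; exact: open_act.
  by split; exact: set_mem.
apply: (@filterS _ (nbhs w) (nbhs_filter w)) => v [Qv Pv] /= E.
by move/eqP/seteqP: PQ => [/(_ v) H _]; apply: H; split => //; rewrite -E.
Qed.

(** The interior of the fixed set of [g] is also closed: at a limit point the matrix of [g] in a
    linear chart is the identity on a nonempty open set, hence everywhere. By connectedness [g] then
    acts trivially. *)
Lemma locally_trivial_fixed g (y : W) : nbhs y [set w | a w g = w] -> g = 0.
Proof.
move=> gy; apply: a_eff => x.
pose S : set W := interior [set w | a w g = w].
have oS : open S by exact: open_interior.
have ST : S = [set: W].
  apply: W_connected; first by exists y.
    by exists S => //; rewrite setTI.
  exists S; last by rewrite setTI.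
  move=> w Sw; have wg : a w g = w.
    by apply: (@closed_fixed g); apply: (closure_subset _ Sw); exact: interior_subset.
  have gw : g \in stab a w by apply/stabP.
  have [U [th [M [thE Uw th0 UG thM]]]] := linear_chart a_smooth w.
  have [oU _ thi tho] := thE.
  have nU : nbhs w U by apply: open_nbhs_nbhs; split.
  have [v [Sv Uv]] := Sw _ nU.
  have MN : M g = 1%:M.
    apply: (@open_set_spans (th @` (S `&` U)) _ _ (th v)).
    - by apply: tho; [exact: openI|move=> u []].
    - by exists v.
    - move=> _ [u [Su Uu] <-]; rewrite mulmx1 -thM//.
      by have /= -> := interior_subset Su.
  apply: (@filterS _ (nbhs w) (nbhs_filter w) _ _ _ nU) => u Uu /=.
  by apply: thi => //; [exact: UG|rewrite thM// MN mulmx1].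
have : S x by rewrite ST.
by move=> /interior_subset.
Qed.

Lemma fixed_point_locally_linear p : (forall g, a p g = p) ->
  locally_linear R a p.
Proof.
move=> pfix; have pG g : g \in stab a p by apply/stabP.
have [U [th [M [thE Up th0 UG thM]]]] := linear_chart a_smooth p.
have [oU _ thi tho] := thE.
have span := @open_set_spans (th @` U) _ _ (th p) (tho _ oU (@subset_refl _ U))
  (imageP _ Up).
exists U, th, M; split => //.
- by apply: span => _ [w Uw <-]; rewrite mulmx1 -thM// Z2_act0.
- move=> g h; apply: span => _ [w Uw <-].
  by rewrite -thM// mulmxA -thM// -thM ?Z2_actD//; exact: UG.
(* An element with identity matrix fixes a whole neighborhood of [p]. *)
- move=> g Mg; apply: (@locally_trivial_fixed g p).
  have : nbhs p U by apply: open_nbhs_nbhs; split.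
  apply: (@filterS _ (nbhs p) (nbhs_filter p)) => w Uw /=.
  by apply: thi => //; [exact: UG|rewrite thM// Mg mulmx1].
- move=> v w g Uv Uw; split => [->|E]; first by rewrite thM.
  by apply: thi => //; [exact: UG|rewrite thM].
Qed.

(* In a linear chart, the translation by a vector fixed by the common stabilizer
   of [z] and [z'] is equivariant. *)
Lemma locally_linear_translate y (U : set W) (th : W -> 'rV[R]_n) M z z' :
  embedding U th ->
  (forall w g, U w -> g \in stab a y -> U (a w g)) ->
  (forall w g, U w -> g \in stab a y -> th (a w g) = th w *m M g) ->
  U z -> U z' -> stab a z = stab a z' -> stab a z \subset stab a y ->
  locally_linear R a z -> locally_linear R a z'.
Proof.
move=> thE UG thM Uz Uz' zz' zy [B [f [rho [[fE Bz] rho0 rhoD rhof rhoP]]]].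
have [oU thc thi tho] := thE; have [oB fc fi fo] := fE.
(* The slices ensure that an element carrying one point of the slice to another lies in the common
   stabilizer, for which the translation is equivariant. *)
have [S [oS Sz SP]] := slice_nbhd a_cont W_hausdorff z.
have [S' [oS' Sz' SP']] := slice_nbhd a_cont W_hausdorff z'.
have [ith [ithK ithP ithc]] := embedding_inverse z thE.
pose c := th z - th z'.
have cM g : g \in stab a z -> c *m M g = c.
  move=> gz; have gy := fintype.subsetP zy _ gz.
  have gz' : g \in stab a z' by rewrite -zz'.
  rewrite mulmxBl -!thM//.
  by have /stabP -> := gz; have /stabP -> := gz'.
pose B0 := U `&` B `&` S.
have oB0 : open B0 by do 2! apply: openI => //.
pose sg w := ith (th w + c).
pose B' := U `&` S' `&` [set w | (th @` B0) (th w + c)].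
have shift_cont d : continuous (fun v : 'rV[R]_n => v + d).
  move=> v; apply: (@continuousD _ _ _ id (fun=> d) v); [exact: cvg_id|exact: cst_continuous].
have shift_open d (C : set 'rV[R]_n) : open C -> open [set v : 'rV[R]_n | C (v + d)].
  by move=> oC; apply: (@open_comp _ _ (fun v : 'rV[R]_n => v + d)) => // v _; exact: shift_cont.
have oB0' : open (th @` B0) by apply: tho => // w [[]].
have oB' : open B'.
  have -> : B' = (U `&` th @^-1` [set v | (th @` B0) (v + c)]) `&` S'.
    by apply/seteqP; split => w [[? ?] ?].
  apply: openI => //; apply: (embedding_preimage thE); exact: shift_open.
have sgP w : B' w -> B0 (sg w) /\ th (sg w) = th w + c.
  move=> [_ [w0 [[Uw0 Bw0] Sw0] E]].
  by rewrite /sg -E ithK.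
have sg_equiv v w g : B' v -> B' w -> (w = a v g <-> sg w = a (sg v) g).
  move=> Bv Bw; have [[[Usv Bsv] Ssv] Ev] := sgP v Bv.
  have [[[Usw Bsw] Ssw] Ew] := sgP w Bw.
  have [[Uv Sv] _] := Bv; have [[Uw Sw] _] := Bw.
  split => E.
    have gz : g \in stab a z by rewrite zz'; apply: (SP' v) => //; rewrite -E.
    have gy := fintype.subsetP zy _ gz.
    apply: thi => //; first exact: UG.
    by rewrite thM// Ew Ev E thM// mulmxDl cM.
  have gz : g \in stab a z by apply: (SP (sg v)) => //; rewrite -E.
  have gy := fintype.subsetP zy _ gz.
  apply: thi => //; first exact: UG.
  by apply: (addIr c); rewrite -Ew E thM// Ev thM// mulmxDl cM.
have B'z' : B' z'.
  by split; [split|exists z; [split|rewrite /c addrC subrK]].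
exists B', (f \o sg), rho; split; [split; [|exact: B'z'] | exact: rho0 | exact: rhoD
  | exact: rhof |].
- split; first exact: oB'.
  + move=> w Bw; have [[[Usw Bsw] _] Ew] := sgP w Bw.
    apply: (@continuous_comp _ _ _ sg f); last exact: fc.
    apply: (@continuous_comp _ _ _ (fun w => th w + c) ith).
      apply: (@continuous_comp _ _ _ th (fun v => v + c)); last exact: shift_cont.
      by apply: thc; case: Bw => -[].
    by apply: ithc; rewrite -Ew; exact: imageP.
  + move=> v w Bv Bw E.
    have [[[Usv Bsv] _] Ev] := sgP v Bv; have [[[Usw Bsw] _] Ew] := sgP w Bw.
    have sE : sg v = sg w by exact: fi.
    apply: thi; [by case: Bv => -[]|by case: Bw => -[]|].
    by apply: (addIr c); rewrite -Ev -Ew sE.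
  + move=> C oC CB; rewrite -image_comp; apply: fo; last first.
      by move=> _ [w /CB /sgP[[[]]]] _ Bw _ _ <-.
    have -> : sg @` C = U `&` th @^-1` [set v | (th @` C) (v - c)].
      apply/seteqP; split => [_ [w Cw <-]|w [Uw [v Cv E]]].
        have [[[Usw _] _] Ew] := sgP w (CB _ Cw); split => //=.
        by exists w => //; rewrite Ew addrK.
      exists v => //; have [[[Usv _] _] Ev] := sgP v (CB _ Cv).
      by apply: thi => //; rewrite Ev E subrK.
    apply: (embedding_preimage thE); apply: shift_open; apply: tho => //.
    by move=> w /CB[[]].
- move=> v w g Bv Bw; have [[[_ Bsv] _] _] := sgP v Bv; have [[[_ Bsw] _] _] := sgP w Bw.
  by rewrite /= -rhoP//; exact: sg_equiv.
Qed.
End MainArgument.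

(** * The strata of points that are not locally linear *)

Section Strata.
Variables (R : realType) (n : nat) (W : topologicalType).
Variables (A : smooth_atlas R n W) (a : Z2_action n W).
Hypothesis a_smooth : smooth_action A a.
Hypothesis W_hausdorff : hausdorff_space W.

Let a_cont : continuous_action a := smooth_continuous a_smooth.

Definition bad_stratum (H : {set Z2 n}) : set W :=
  [set z | stab a z = H /\ ~ locally_linear R a z].

(** The displacement [u s] is affine in [s] and nonzero at s = 1, so it vanishes at most once; [e]
    is its zero between 0 and 1, or else 1. *)
Lemma generic_on_segment (M : 'M[R]_n) (p q : 'rV[R]_n) : p *m M != p ->
  exists2 e : R, 0 < e & forall s, 0 < s < e ->
    (q + s *: (p - q)) *m M != q + s *: (p - q).
Proof.
move=> pM; pose u s := (q + s *: (p - q)) *m M - (q + s *: (p - q)).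
pose b := q *m M - q; pose d := (p *m M - p) - b.
have uE s : u s = b + s *: d.
  rewrite /u /d /b mulmxDl -scalemxAl mulmxBl opprD addrACA; congr (_ + _).
  rewrite -scalerBr; congr (_ *: _).
  rewrite !opprB addrACA [RHS]addrACA; congr (_ + _); exact: addrC.
have u0 s : u s = 0 <-> (q + s *: (p - q)) *m M = q + s *: (p - q).
  by split => [/eqP|E]; [rewrite subr_eq0 => /eqP|rewrite /u E subrr].
have [[t [t0 ut]]|nt] := pselect (exists t, 0 < t < 1 /\ u t = 0); last first.
  exists 1 => // s s01; apply/eqP => /u0 us; apply: nt.
  by exists s.
exists t => [|s /andP[s0 st]]; first by case/andP: t0.
apply/eqP => /u0 us; case/eqP: pM; apply/eqP; rewrite -subr_eq0.
have : (t - s) *: d = 0.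
  by rewrite scalerBl -[t *: d](addKr b) -uE ut addr0 -[s *: d](addKr b) -uE us addr0 subrr.
move/eqP; rewrite scaler_eq0 [t - s == 0]gt_eqF ?subr_gt0//= => /eqP d0.
have : b = 0 by rewrite -us uE d0 scaler0 addr0.
by move: d0; rewrite /d => + b0; rewrite b0 subr0 => ->.
Qed.

(* The closure of a bad stratum is open in the fixed point set of [H]: in a linear
   chart at [y], all but finitely many points of a segment from a point of the
   stratum to an [H]-fixed point have stabilizer [H]. *)
Lemma bad_stratum_closure H y : closure (bad_stratum H) y ->
  \forall z \near y, H \subset stab a z -> closure (bad_stratum H) z.
Proof.
move=> cy.
have [U [th [M [thE Uy th0 UG thM]]]] := linear_chart a_smooth y.
have [oU thc thi tho] := thE.
have [S [oS Sy SP]] := slice_nbhd a_cont W_hausdorff y.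
have [ith [ithK ithP ithc]] := embedding_inverse y thE.
have [r r0 rUS] : exists2 r : R, 0 < r & ball 0 r `<=` th @` (U `&` S).
  apply/nbhs_ballP; apply: open_nbhs_nbhs; split.
    by apply: tho; [exact: openI|move=> w []].
  by exists y.
pose N := U `&` th @^-1` ball 0 r.
have nN : nbhs y N.
  apply: open_nbhs_nbhs; split; first exact: (embedding_preimage thE (ball_open _ _)).
  by split => //=; rewrite th0; exact: ballxx.
have ball_US v : ball 0 r v -> U (ith v) /\ S (ith v) /\ th (ith v) = v.
  by move=> /rUS[w [Uw Sw] <-]; rewrite ithK.
have NS w : N w -> S w.
  by move=> [Uw /ball_US[_ []]]; rewrite ithK.
have [z [[zH zbad] [Uz zr]]] := cy _ nN.
have Hy : H \subset stab a y.
  apply/fintype.subsetP => g; rewrite -zH => /stabP gz.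
  by apply: (SP z); rewrite ?gz; apply: NS.
apply: (@filterS _ (nbhs y) (nbhs_filter y) _ _ _ nN) => z' [Uz' zr'] z'H C nC.
pose seg (s : R) := th z' + s *: (th z - th z').
have seg_ball s : 0 < s < 1 -> ball 0 r (seg s).
  move=> /andP[s0 s1]; move: zr zr'; rewrite -ball_normE /= !sub0r !normrN => zr zr'.
  have -> : seg s = (1 - s) *: th z' + s *: th z.
    by rewrite /seg scalerBr scalerBl scale1r addrCA addrC.
  apply: le_lt_trans (ler_normD _ _) _; rewrite !normrZ !ger0_norm ?subr_ge0 ?(ltW s0) ?(ltW s1)//.
  have h1 : (1 - s) * `|th z'| < (1 - s) * r by rewrite ltr_pM2l// subr_gt0.
  have h2 : s * `|th z| < s * r by rewrite ltr_pM2l.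
  by move: h1 h2; lra.
have seg_cvg : ith (seg s) @[s --> (0:R)^'+] --> z'.
  have segc : continuous seg.
    move=> s; apply: (@continuousD _ _ _ (fun=> th z') (fun s : R => s *: (th z - th z')) s).
      exact: cst_continuous.
    by apply: (@cvgZr_tmp R _ _ (nbhs s) _ id); exact: cvg_id.
  have seg0 : seg 0 = th z' by rewrite /seg scale0r addr0.
  have ic : {for 0, continuous (ith \o seg)}.
    apply: continuous_comp; first exact: segc.
    by apply: ithc; rewrite seg0; exact: imageP.
  have ic0 : (ith \o seg) 0 = z' by rewrite /comp seg0 ithK.
  by rewrite -ic0; exact: (cvg_at_right_filter ic).
have generic : \forall s \near (0:R)^'+, forall g, g \in stab a y -> g \notin H ->
    seg s *m M g != seg s.
  apply: filter_forall => g.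
  have [gy|gy] := boolP (g \in stab a y); last by apply: nearW.
  have [gH|gH] := boolP (g \in H); first by apply: nearW.
  have gz : th z *m M g != th z.
    apply/eqP; rewrite -thM// => E; move: gH; rewrite -zH => /stabP; apply.
    by apply: thi => //; exact: UG.
  have [e e0 eP] := generic_on_segment (th z') gz.
  near=> s; move=> _ _; apply: eP; apply/andP; split; near: s.
    exact: nbhs_right_gt.
  exact: nbhs_right_lt.
have : \forall s \near (0 : R)^'+, [/\ C (ith (seg s)), 0 < s, s < 1 &
    forall g, g \in stab a y -> g \notin H -> seg s *m M g != seg s].
  near=> s; split; near: s; [exact: seg_cvg nC| | |exact: generic].
    exact: nbhs_right_gt.
  exact: nbhs_right_lt.
move=> /(@filter_ex _ (0 : R)^'+ (at_right_proper_filter 0))[s [Cs s0 s1 gs]].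
have [Us [Ss ths]] := ball_US _ (seg_ball s (introT andP (conj s0 s1))).
(* [H] fixes both ends of the segment and acts linearly in the chart; every other element is
   excluded by the slice or by genericity. *)
have stabs : stab a (ith (seg s)) = H.
  apply/setP => g; apply/idP/idP => [/stabP gs'|gH].
    have gy : g \in stab a y by apply: (SP (ith (seg s))); rewrite ?gs'.
    apply: contrapT => /negP /(gs _ gy) /eqP; apply.
    by rewrite -{1}ths -thM// gs'.
  have gy := fintype.subsetP Hy _ gH.
  apply/stabP; apply: thi => //; first exact: UG.
  rewrite thM// ths /seg mulmxDl -scalemxAl mulmxBl -!thM//.
  have /stabP -> := fintype.subsetP z'H _ gH.
  by have /stabP -> : g \in stab a z by rewrite zH.
(* If this point were locally linear, translation in the chart would make [z] so too, as both have
   stabilizer [H]. *)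
exists (ith (seg s)); split => //; split => // ll; apply: zbad.
apply: (locally_linear_translate a_smooth W_hausdorff thE UG thM Us Uz _ _ ll).
  by rewrite stabs zH.
by rewrite stabs.
Unshelve. all: by end_near. Qed.
End Strata.

Theorem theorem3p3 (R : realType) (n : nat) (W : topologicalType)
  (A : smooth_atlas R n W) (a : Z2_action n W)
  (E : topologicalType) (aE : Z2_action n E) (e0 : E) :
  two_torus_manifold A a ->
  universal_action R aE ->
  equivariantly_formal aE a R e0 ->
  locally_standard R a.
Proof.
move=> [[W_hausdorff _ W_compact W_connected] a_smooth a_eff _] aE_univ formalW.
have a_cont := smooth_continuous a_smooth.
suff linear x : locally_linear R a x by move=> x; exact: locally_linear_standard.
apply: contrapT => x_bad.
pose H := stab a x; pose B := bad_stratum R a H; pose Y := closure B.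
have Bx : B x by [].
pose WH : set W := [set w | H \subset stab a w].
have WH_closed : closed WH.
  have -> : WH = \bigcap_(g in [set g | g \in H]) [set w | a w g = w].
    apply/seteqP; split => w Hw; first by move=> g /= /(fintype.subsetP Hw)/stabP.
    by apply/fintype.subsetP => g gH; apply/stabP; exact: Hw.
  by apply: closed_bigI => g _; exact: (closed_fixed a_smooth).
have YH y : Y y -> H \subset stab a y.
  have BWH : B `<=` WH by move=> w [wH _]; rewrite /WH /= wH.
  by move=> /(closure_subset BWH) /WH_closed.
have YG y g : Y y -> Y (a y g).
  move=> Yy C nC; have := Yy _ (@a_cont g y C nC).
  move=> [z [[zH zbad] Cz]]; exists (a z g); split => //; split.
    by rewrite stab_act.
  by move=> /(locally_linear_act a_cont g); rewrite Z2_actK.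
(* Openness of [Y] in [WH], stated as closedness of the rest: [Y] lies in the interior of its union
   with the complement of [WH]. *)
have Y_open : closed (WH `\` Y).
  have -> : WH `\` Y = WH `&` ~` interior (Y `|` ~` WH).
    apply/seteqP; split => w [Hw Yw]; split => //.
      by move=> /interior_subset[].
    move=> Yw'; apply: Yw.
    have := bad_stratum_closure a_smooth W_hausdorff Yw'.
    apply: (@filterS _ (nbhs w) (nbhs_filter w)) => v Hv.
    by have [Hv'|] := pselect (WH v); [left; exact: Hv|right].
  apply: closedI => //; apply: open_closedC; exact: open_interior.
have [p Yp pfix] := fixed_point_exists aE_univ a_cont formalW W_hausdorff
  W_compact (ex_intro _ x (subset_closure Bx)) YH YG (@closed_closure _ _) Y_open.
have p_lin := fixed_point_locally_linear a_smooth W_hausdorff W_connected a_eff pfix.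
have : nbhs p [set z | locally_linear R a z].
  by apply: open_nbhs_nbhs; split => //; exact: locally_linear_open.
by move=> /Yp[z [[_ zbad] /zbad]].
Qed.
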